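(* Let $\{\varphi^t\}_{t\ge 0}$ be a smooth dynamical system on an open set $U\subseteq\mathbb{R}^n$ (with continuous or discrete time), let $K\subset U$ be a nonempty compact set with $\varphi^t(K)=K$ for all $t\ge 0$, and suppose that all singular values of $D\varphi^t(u)$ are positive for all $t\ge 0$, $u\in U$. Then for every $t>0$ $$\dim_{\rm H}(K)\le d_{\rm L}(\{\varphi^t\}_{t\ge0},K)=d^{\rm E}_{\rm L}(\{\varphi^t\}_{t\ge0},K)=\sup_{u\in K}d^{\rm E}_{\rm L}(\{\varphi^t\}_{t\ge0},u)\le d_{\rm L}(\varphi^t,K)=\sup_{u\in K}d_{\rm L}(\varphi^t,u).$$
   Context: Smooth dynamical system on an open set $U\subseteq\mathbb{R}^n$ (Euclidean norm): either (continuous time) $\varphi^t(u_0)=u(t,u_0)$, $t\in[0,\infty)$, is the solution operator of $\dot u=f(u)$ with $f:U\to\mathbb{R}^n$ continuously differentiable, where every solution with $u(0,u_0)=u_0\in U$ exists on $[0,\infty)$, is unique and stays in $U$; or (discrete time) $\varphi^t=\varphi\circ\cdots\circ\varphi$ ($t$ times), $\varphi^0=\mathrm{id}$, with $\varphi:U\to U$ continuously differentiable and $t\in\{0,1,2,\dots\}$. All times are in $[0,\infty)$ or in $\{0,1,2,\dots\}$ accordingly. $D\varphi^t(u)$ is the $n\times n$ Jacobian matrix of $\varphi^t$ at $u$. For an $n\times n$ matrix $A$ with singular values $\sigma_1\ge\dots\ge\sigma_n\ge0$ and $d\in[0,n]$, the singular value function is $\omega_0(A)=1$, $\omega_d(A)=\sigma_1\cdots\sigma_d$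 for $d\in\{1,\dots,n\}$, and $\omega_d(A)=\sigma_1\cdots\sigma_{\lfloor d\rfloor}\sigma_{\lfloor d\rfloor+1}^{d-\lfloor d\rfloor}$ for non-integer $d\in(0,n)$. $\dim_{\rm H}$ is Hausdorff dimension. Definitions, for $t>0$ and $u\in K$ (an infimum over the empty set of $d\in[0,n]$ is taken to be $n$): $d_{\rm L}(\varphi^t,u)=\sup\{d\in[0,n]:\omega_d(D\varphi^t(u))\ge1\}$; $d_{\rm L}(\varphi^t,K)=\sup_{u\in K}d_{\rm L}(\varphi^t,u)$; $d_{\rm L}(\{\varphi^t\}_{t\ge0},K)=\inf_{t>0}d_{\rm L}(\varphi^t,K)$; $d^{\rm E}_{\rm L}(\{\varphi^t\}_{t\ge0},K)=\inf\{d\in[0,n]:\lim_{t\to+\infty}\max_{u\in K}\frac1t\ln\omega_d(D\varphi^t(u))<0\}$ (the limit exists by subadditivity); $d^{\rm E}_{\rm L}(\{\varphi^t\}_{t\ge0},u)=\inf\{d\in[0,n]:\limsup_{t\to+\infty}\frac1t\ln\omega_d(D\varphi^t(u))<0\}$. *)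

(* Defs.v *)
From HB Require Import structures.
From mathcomp Require Import all_boot all_order all_algebra.
From mathcomp Require Import polyrcf.
From mathcomp Require Import all_classical all_reals all_analysis.

Set Implicit Arguments.
Unset Strict Implicit.
Unset Printing Implicit Defensive.

Import Order.TTheory GRing.Theory Num.Theory.
Import numFieldNormedType.Exports.

Local Open Scope classical_set_scope.
Local Open Scope ring_scope.

Section SingularValues.
Context {R : realType} {n : nat}.

(* Square roots of the eigenvalues of A^T A, repeated according to
   multiplicity, in nonincreasing order. *)
Definition singular_values (A : 'M[R]_n) : seq R :=
  let p := char_poly (A^T *m A) in
  sort >=%R (flatten [seq nseq (mup x p) (Num.sqrt x) | x <- rootsR p]).

(* Since x `^ 0 = 1 for every x (0 included), this is the plain product of the
   d largest singular values when d is an integer, also when d = n, where the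
   out-of-range entry only occurs with exponent 0. *)
Definition omega (d : R) (A : 'M[R]_n) : R :=
  let s := singular_values A in
  let k := Num.truncn d in
  (\prod_(i < k) s`_i) * s`_k `^ (d - k%:R).

End SingularValues.

Section EuclideanHausdorff.
Context {R : realType} {n : nat}.
Local Open Scope ereal_scope.

(* The library norm on 'rV[R]_n is the sup norm. *)
Definition enorm (x : 'rV[R]_n) : R := Num.sqrt (\sum_(i < n) x ord0 i ^+ 2)%R.

Definition diam (A : set 'rV[R]_n) : R :=
  sup [set enorm (p.1 - p.2)%R | p in A `*` A].

(* The empty set has weight 0 and a nonempty set has weight 1 when s = 0. *)
Definition hausdorff_weight (s : R) (A : set 'rV[R]_n) : \bar R :=
  if A == set0 then 0 else (diam A `^ s)%:E.

Definition delta_cover (delta : R) (A : set 'rV[R]_n)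
    (F : nat -> set 'rV[R]_n) : Prop :=
  A `<=` \bigcup_i F i /\
  forall i x y, F i x -> F i y -> (enorm (x - y) <= delta)%R.

Definition hausdorff_premeasure (s delta : R) (A : set 'rV[R]_n) : \bar R :=
  ereal_inf [set \sum_(0 <= i <oo) hausdorff_weight s (F i)
            | F in delta_cover delta A].

Definition hausdorff_measure (s : R) (A : set 'rV[R]_n) : \bar R :=
  ereal_sup [set hausdorff_premeasure s delta A
            | delta in [set delta : R | (0 < delta)%R]].

Definition hausdorff_dim (A : set 'rV[R]_n) : \bar R :=
  ereal_inf [set s%:E | s in [set s : R |
    (0 <= s)%R /\ hausdorff_measure s A = 0]].

End EuclideanHausdorff.

Section SmoothDynamicalSystem.
Context {R : realType} {n : nat}.
Implicit Types (U : set 'rV[R]_n) (f g : 'rV[R]_n -> 'rV[R]_n)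
  (phi : R -> 'rV[R]_n -> 'rV[R]_n).

(* Vectors are rows, so the library's 'J f u satisfies 'd f u v = v *m 'J f u
   and is the transpose of the usual Jacobian matrix. *)
Definition Dmx f (u : 'rV[R]_n) : 'M[R]_n := ('J f u)^T.

Definition C1_on U f : Prop :=
  forall u, U u -> differentiable f u /\ {for u, continuous (Dmx f)}.

(* v solves v' = f(v) in U on [0, b[, with a right derivative at 0. *)
Definition is_solution U f (b : \bar R) (v : R -> 'rV[R]_n) : Prop :=
  forall t : R, 0 <= t -> (t%:E < b)%E ->
    [/\ U (v t),
        0 < t -> is_derive t 1 v (f (v t)) &
        t = 0 -> h^-1 *: (v h - v 0) @[h --> 0^'+] --> f (v 0)].

Definition is_semiflow U f phi : Prop :=
  forall u0, U u0 ->
    [/\ phi 0 u0 = u0,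
        is_solution U f +oo%E (phi ^~ u0) &
        forall (b : \bar R) (v : R -> 'rV[R]_n),
          is_solution U f b v -> v 0 = u0 ->
          forall t : R, 0 <= t -> (t%:E < b)%E -> v t = phi t u0].

Inductive time_kind := ContinuousTime | DiscreteTime.

Definition times (tau : time_kind) : set R :=
  match tau with
  | ContinuousTime => [set t : R | 0 <= t]
  | DiscreteTime => range (fun k : nat => k%:R)
  end.

(* Only the values phi t u with t \in times tau and u \in U are meaningful. *)
Definition smooth_dynamical_system (tau : time_kind) U phi : Prop :=
  match tau with
  | ContinuousTime => exists2 f, C1_on U f & is_semiflow U f phi
  | DiscreteTime => exists g, [/\ C1_on U g, (forall u, U u -> U (g u)) &
      forall (k : nat) u, U u -> phi k%:R u = iter k g u]
  end.

End SmoothDynamicalSystem.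

Section LyapunovDimensions.
Context {R : realType} {n : nat}.
Implicit Types (K : set 'rV[R]_n) (g : 'rV[R]_n -> 'rV[R]_n)
  (phi : R -> 'rV[R]_n -> 'rV[R]_n) (tau : time_kind).

Definition inf_or_n (D : set R) : R := if D == set0 then n%:R else inf D.

Definition times_to_oo tau : set_system R := within (times tau) +oo.

Definition dL_at g (u : 'rV[R]_n) : R :=
  sup [set d : R | 0 <= d <= n%:R /\ 1 <= omega d (Dmx g u)].

Definition dL_on g K : R := sup [set dL_at g u | u in K].

Definition dL tau phi K : R :=
  inf [set dL_on (phi t) K | t in [set t : R | times tau t /\ 0 < t]].

Definition growth phi (d t : R) (u : 'rV[R]_n) : \bar R :=
  (t^-1 * ln (omega d (Dmx (phi t) u)))%:E.

Definition dLE_on tau phi K : R :=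
  inf_or_n [set d : R | 0 <= d <= n%:R /\
    (lim (ereal_sup [set growth phi d t u | u in K]
          @[t --> times_to_oo tau]) < 0)%E].

Definition dLE_at tau phi (u : 'rV[R]_n) : R :=
  inf_or_n [set d : R | 0 <= d <= n%:R /\
    (limf_esup (fun t => growth phi d t u) (times_to_oo tau) < 0)%E].

End LyapunovDimensions.

(* Main.v *)
Require Import Defs.
From mathcomp Require Import all_boot all_order all_algebra.
From mathcomp Require Import fingroup perm polyrcf ring lra.
From mathcomp Require Import all_classical all_reals all_analysis.

Set Implicit Arguments.
Unset Strict Implicit.
Unset Printing Implicit Defensive.

Import Order.TTheory GRing.Theory Num.Theory.
Import numFieldNormedType.Exports.

Local Open Scope classical_set_scope.
Local Open Scope ring_scope.

(** Write [w_d] for [omega d] of a derivative [D phi^t] at a point of [K].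

    Linear algebra. Diagonalizing [A^T A] and expanding Gram determinants by the
    Cauchy-Binet formula shows that the product of the [k] largest singular values
    is the largest factor by which [A] expands a [k]-dimensional Gram determinant
    ([det_gram_le], [det_gram_attained]). Horn's inequality
    [omega d (A B) <= omega d A * omega d B] follows at once ([omega_mul]), and with
    it the upper semicontinuity of [omega d] at invertible matrices, by writing
    [A = (A A0^-1) A0]. Moreover [ln (omega d A)] is concave in [d] and vanishes at
    [d = 0] ([ln_omega_concave]), so [w_d < 1] persists when [d] grows.

    Smoothness. The only facts used about the dynamical system are invariance of
    [K], strict differentiability of [phi^t] uniformly along [K], the chain rule,
    and bounds on derivatives for bounded times ([smooth_cocycle]). In continuous
    time they are obtained from Gronwall's inequality alone: a difference of two
    rescaled increments of the flow solves the linearized equation up to a small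
    error with zero initial value, hence stays small, so the difference quotients
    converge ([flow_unif_sdiff]).

    Growth rates. Suppose that each point [u] of [K] has some time [t > 0] with
    [ln w_d < c t]. By semicontinuity and compactness finitely many times suffice,
    with a uniform gain, and chaining them along orbits with Horn's inequality gives
    [ln w_d <= c' t + B] on [K] for all times, with [c' < c]
    ([lnomega_uniform]). This contains Fekete's lemma, hence the existence of the
    limit, and shows that the following are equivalent for each [d]: [w_d < 1] on all
    of [K] at one time, [w_d < 1] at each point at some time, negative limit of the
    maximal rate, negative upper limit of the rate at each point. The equalities between the dimensions follow by
    comparing the sets of [d] over which the infima and suprema are taken
    ([dim_inf_decay], [decay_on_sup]).

    Hausdorff dimension. Let [s] exceed the Lyapunov dimension. If [s <= n], then
    [w_s] is as small as desired on [K] for some time [t]. A piece of [K] of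
    diameter [r] is cut into boxes along the singular directions of the derivative,
    so that the images of all boxes have diameter of order [s_k r], where [k] is the
    index of the smallest singular value in [w_s]; the total [s]-dimensional content of
    the images is at most a constant times [w_s r^s] ([sdiff_refines]). As
    [phi^t] maps [K] onto itself, iterating gives finite covers of [K] with content
    tending to zero ([refines_measure0]). If [s > n], the identity map and a
    subdivision into cubes do the same ([id_refines]). *)

(** * Euclidean norm of row vectors *)

Definition dotv (R : realType) n (x y : 'rV[R]_n) : R := (x *m y^T) 0 0.

Section DotProduct.
Context {R : realType} {n : nat}.
Implicit Types (x y z : 'rV[R]_n) (a : R).

Lemma dotvE x y : dotv x y = \sum_i x 0 i * y 0 i.
Proof. by rewrite /dotv mxE; apply: eq_bigr => i _; rewrite mxE. Qed.

Lemma dotvC x y : dotv x y = dotv y x.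
Proof. by rewrite !dotvE; apply: eq_bigr => i _; rewrite mulrC. Qed.

Lemma dotvDl x y z : dotv (x + y) z = dotv x z + dotv y z.
Proof. by rewrite /dotv mulmxDl mxE. Qed.

Lemma dotvDr x y z : dotv z (x + y) = dotv z x + dotv z y.
Proof. by rewrite !(dotvC z) dotvDl. Qed.

Lemma dotvZl a x y : dotv (a *: x) y = a * dotv x y.
Proof. by rewrite /dotv -scalemxAl mxE. Qed.

Lemma dotvZr a x y : dotv x (a *: y) = a * dotv x y.
Proof. by rewrite !(dotvC x) dotvZl. Qed.

Lemma dotvNl x y : dotv (- x) y = - dotv x y.
Proof. by rewrite -scaleN1r dotvZl mulN1r. Qed.

Lemma dotvNr x y : dotv x (- y) = - dotv x y.
Proof. by rewrite dotvC dotvNl dotvC. Qed.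

Lemma dotvv_ge0 x : 0 <= dotv x x.
Proof. by rewrite dotvE sumr_ge0// => i _; rewrite -expr2 sqr_ge0. Qed.

Lemma dotvv_eq0 x : dotv x x = 0 -> x = 0.
Proof.
rewrite dotvE => /eqP; rewrite psumr_eq0 => [/allP x0|i _]; last first.
  by rewrite -expr2 sqr_ge0.
apply/rowP => i; rewrite mxE; have := x0 i (mem_index_enum i).
by rewrite /= -expr2 sqrf_eq0 => /eqP.
Qed.

Lemma enorm_sq x : enorm x ^+ 2 = dotv x x.
Proof.
rewrite /enorm sqr_sqrtr; last by apply: sumr_ge0 => i _; rewrite sqr_ge0.
by rewrite dotvE; apply: eq_bigr => i _; rewrite expr2.
Qed.

Lemma enorm_ge0 x : 0 <= enorm x.
Proof. exact: sqrtr_ge0. Qed.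

Lemma enorm0 : enorm (0 : 'rV[R]_n) = 0.
Proof. by apply/eqP; rewrite -sqrf_eq0 enorm_sq /dotv mul0mx mxE. Qed.

Lemma enorm_eq0 x : enorm x = 0 -> x = 0.
Proof. by move=> x0; apply: dotvv_eq0; rewrite -enorm_sq x0 expr0n. Qed.

Lemma enorm_gt0 x : (0 < enorm x) = (x != 0).
Proof.
rewrite lt_def enorm_ge0 andbT; congr (~~ _).
by apply/eqP/eqP => [/enorm_eq0//|->]; rewrite enorm0.
Qed.

Lemma enormZ a x : enorm (a *: x) = `|a| * enorm x.
Proof.
apply: (@pexpIrn _ 2) => //; rewrite ?nnegrE ?mulr_ge0 ?enorm_ge0//.
by rewrite exprMn !enorm_sq dotvZl dotvZr mulrA -expr2 real_normK ?num_real.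
Qed.

Lemma enormN x : enorm (- x) = enorm x.
Proof. by rewrite -scaleN1r enormZ normrN1 mul1r. Qed.

Lemma enormC x y : enorm (x - y) = enorm (y - x).
Proof. by rewrite -enormN opprB. Qed.

Lemma dotv_le x y : dotv x y <= enorm x * enorm y.
Proof.
have [->|x0] := eqVneq x 0; first by rewrite enorm0 mul0r /dotv mul0mx mxE.
have x_gt0 : 0 < enorm x by rewrite enorm_gt0.
rewrite -(ler_pM2l x_gt0).
have := dotvv_ge0 (enorm y *: x - enorm x *: y).
set a := enorm x; set b := enorm y.
have ea : dotv x x = a ^+ 2 by rewrite enorm_sq.
have eb : dotv y y = b ^+ 2 by rewrite enorm_sq.
rewrite dotvDl !dotvDr !(dotvNl, dotvNr) !dotvZl !dotvZr (dotvC y x) ea eb.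
have [b0|b_gt0] := leP b 0.
  have b00 : b = 0 by apply/eqP; rewrite eq_le b0 enorm_ge0.
  have y0 : y = 0 by apply: enorm_eq0.
  by rewrite b00 mulr0 y0 /dotv trmx0 mulmx0 mxE mulr0.
move=> h; rewrite -(ler_pM2l b_gt0) -(ler_pM2l (ltr0n R 2)) -subr_ge0.
by apply: le_trans h _; rewrite le_eqVlt; apply/orP; left; apply/eqP; ring.
Qed.

Lemma enormD x y : enorm (x + y) <= enorm x + enorm y.
Proof.
rewrite -(@ler_pXn2r _ 2) ?nnegrE ?addr_ge0 ?enorm_ge0//.
rewrite enorm_sq dotvDl !dotvDr (dotvC y) sqrrD !enorm_sq.
have := dotv_le x y; rewrite mulr2n; lra.
Qed.

Lemma enormB x y : enorm (x - y) <= enorm x + enorm y.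
Proof. by rewrite -(enormN y); exact: enormD. Qed.

Lemma enorm_triangle y x z : enorm (x - z) <= enorm (x - y) + enorm (y - z).
Proof. by rewrite -[x - z](subrKA y) enormD. Qed.

Lemma enorm_sum (I : Type) (r : seq I) (P : pred I) (F : I -> 'rV[R]_n) :
  enorm (\sum_(i <- r | P i) F i) <= \sum_(i <- r | P i) enorm (F i).
Proof.
elim/big_ind2 : _ => //; first by rewrite enorm0.
by move=> u a v b ua vb; rewrite (le_trans (enormD _ _))// lerD.
Qed.

Lemma coord_le_enorm x i : `|x 0 i| <= enorm x.
Proof.
rewrite -(@ler_pXn2r _ 2) ?nnegrE ?normr_ge0 ?enorm_ge0// enorm_sq dotvE.
rewrite real_normK ?num_real// (bigD1 i)//= -expr2 lerDl sumr_ge0// => j _.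
by rewrite -expr2 sqr_ge0.
Qed.

Lemma norm_le_enorm x : `|x| <= enorm x.
Proof.
rewrite /Num.Def.normr/= mx_normrE (bigmax_le _ (enorm_ge0 _))//= => -[i j] _.
by rewrite /= ord1 coord_le_enorm.
Qed.

Lemma coord_le_norm x i : `|x 0 i| <= `|x|.
Proof.
rewrite [leRHS]/Num.Def.normr/= mx_normrE.
by apply: (le_trans _ (le_bigmax _ _ (0, i))).
Qed.

Lemma enorm_le_coord x c : 0 <= c -> (forall i, `|x 0 i| <= c) ->
  enorm x <= Num.sqrt n%:R * c.
Proof.
move=> c0 xc; rewrite -(@ler_pXn2r _ 2) ?nnegrE ?mulr_ge0 ?enorm_ge0 ?sqrtr_ge0//.
rewrite enorm_sq exprMn sqr_sqrtr// dotvE.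
rewrite mulr_natl -[X in _ *+ X]card_ord -sumr_const ler_sum// => i _.
by rewrite -expr2 -real_normK ?num_real// ler_pXn2r ?nnegrE.
Qed.

Lemma enorm_le_norm x : enorm x <= Num.sqrt n%:R * `|x|.
Proof. by apply: enorm_le_coord => // i; exact: coord_le_norm. Qed.

Lemma dotv_orth (P : 'M[R]_n) x y : P *m P^T = 1%:M ->
  dotv (x *m P) (y *m P) = dotv x y.
Proof. by move=> PP; rewrite /dotv trmx_mul mulmxA -(mulmxA x) PP mulmx1. Qed.

Lemma enorm_orth (P : 'M[R]_n) x : P *m P^T = 1%:M -> enorm (x *m P) = enorm x.
Proof.
move=> PP; apply: (@pexpIrn _ 2) => //; rewrite ?nnegrE ?enorm_ge0//.
by rewrite !enorm_sq dotv_orth.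
Qed.

End DotProduct.

(** * Spectral theorem for real symmetric matrices *)

Lemma dotv_continuous (R : realType) n (S : 'M[R]_n) :
  continuous (fun x : 'rV[R]_n => dotv (x *m S) x).
Proof.
have cc i : continuous (fun x : 'rV[R]_n => x 0 i).
  by move=> x; exact: coord_continuous.
rewrite (_ : (fun _ => _) =
    fun x : 'rV[R]_n => \sum_i (\sum_j x 0 j * S j i) * x 0 i); last first.
  by apply/funext => x; rewrite dotvE; apply: eq_bigr => i _; rewrite mxE.
have sum_cont (F : 'I_n -> 'rV[R]_n -> R) : (forall i, continuous (F i)) ->
    continuous (fun x => \sum_i F i x).
  move=> Fc; elim: (index_enum _) => [|i r IHr].
    rewrite (_ : (fun _ => _) = cst 0); first exact: cst_continuous.
    by apply/funext => x; rewrite big_nil.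
  rewrite (_ : (fun _ => _) = F i \+ fun x => \sum_(j <- r) F j x).
    by move=> x; exact: (continuousD (Fc i x) (IHr x)).
  by apply/funext => x /=; rewrite big_cons.
apply: (sum_cont) => i x; apply: (continuousM _ (cc i x)); move: x.
by apply: sum_cont => j y; exact: (continuousM (cc j y) (@cst_continuous _ _ _ y)).
Qed.

Section Spectral.
Context {R : realType}.

(** The quadratic form of [S] attains its maximum on the unit sphere; at a
    maximizer [v] the form of [l - S] is nonnegative and vanishes, which forces
    [v] into its kernel. *)
Lemma top_eigenvector n (S : 'M[R]_n.+1) : S^T = S ->
  exists (v : 'rV[R]_n.+1) (l : R),
    [/\ dotv v v = 1, v *m S = l *: v & forall x, dotv (x *m S) x <= l * dotv x x].
Proof.
move=> symS.
pose A := [set x : 'rV[R]_n.+1 | dotv x x = 1].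
have e0 : dotv (delta_mx 0 0 : 'rV[R]_n.+1) (delta_mx 0 0) = 1.
  by rewrite /dotv trmx_delta mul_delta_mx mxE !eqxx.
have cA : compact A.
  apply: bounded_closed_compact.
    exists 1; split => [|M M1 x xA]; first by rewrite num_real.
    apply: le_trans (norm_le_enorm x) _; apply: le_trans (ltW M1).
    by rewrite -(@ler_pXn2r _ 2) ?nnegrE ?enorm_ge0// enorm_sq xA expr1n.
  rewrite (_ : A = (fun x : 'rV[R]_n.+1 => dotv (x *m 1%:M) x) @^-1` [set 1]).
    apply: closed_comp; last exact: closed_eq.
    by move=> x _; exact: dotv_continuous.
  by apply/seteqP; split => x; rewrite /A /= mulmx1.
have [|//||v vA vmax] :=
    @EVT_max_rV R _ (fun x : 'rV[R]_n.+1 => dotv (x *m S) x) A.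
- by exists (delta_mx 0 0).
- by apply: continuous_subspaceT => x; exact: dotv_continuous.
rewrite inE /A/= in vA.
set l := dotv (v *m S) v in vmax *.
have lmax x : dotv (x *m S) x <= l * dotv x x.
  have [->|x0] := eqVneq x 0; first by rewrite mul0mx /dotv mul0mx mxE mulr0.
  have x_gt0 : 0 < enorm x by rewrite enorm_gt0.
  have := vmax ((enorm x)^-1 *: x); rewrite inE /A/= dotvZl dotvZr -enorm_sq.
  rewrite -scalemxAl dotvZl dotvZr mulrA -invfM -expr2 mulVf ?expf_neq0 ?gt_eqF//.
  by move=> /(_ erefl); rewrite mulrA -invfM -expr2 ler_pdivrMl ?exprn_gt0// mulrC.
exists v, l; split => //.
apply/eqP; rewrite -subr_eq0; apply/eqP.
set w := v *m S - l *: v.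
have cross x y : dotv (x *m S) y = dotv (y *m S) x.
  rewrite /dotv; transitivity ((x *m S *m y^T)^T 0 0); first by rewrite [RHS]mxE.
  by rewrite !trmx_mul trmxK symS mulmxA.
(* varying the maximizer along its residual [w] *)
have key t : 0 <= 2 * t * - dotv w w + t ^+ 2 * (l * dotv w w - dotv (w *m S) w).
  have := lmax (v + t *: w).
  have ww : dotv w w = dotv (v *m S) w - l * dotv v w.
    by rewrite {1}/w dotvDl dotvNl dotvZl.
  clearbody w; rewrite mulmxDl !dotvDl !dotvDr -scalemxAl !dotvZl !dotvZr vA (cross w v).
  rewrite -/l (dotvC w v) ww -subr_ge0 => h; rewrite (le_trans h)// le_eqVlt.
  by apply/orP; left; apply/eqP; ring.
apply: dotvv_eq0; apply/eqP; rewrite eq_le dotvv_ge0 andbT.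
set a := dotv w w in key *; set c := _ - _ in key.
have [a0|//] := ltP 0 a.
have c1 : 0 < `|c| + 1 by rewrite ltr_wpDl.
have tp : 0 < a / (`|c| + 1) by rewrite divr_gt0.
have := key (a / (`|c| + 1)); set t := _ / _ in tp *.
have tc : t * c <= a.
  rewrite (le_trans (ler_wpM2l (ltW tp) (ler_norm c)))//.
  by rewrite /t mulrAC ler_pdivrMr// ler_wpM2l ?(ltW a0)// lerDl.
rewrite leNgt => /negP[]; nra.
Qed.

(** The Householder reflection in the hyperplane orthogonal to [e_0 - v],
    or the identity when [v] is [e_0]. *)
Lemma reflection_to_e0 n (v : 'rV[R]_n.+1) : dotv v v = 1 ->
  exists H : 'M[R]_n.+1, H *m H^T = 1%:M /\ delta_mx 0 0 *m H = v.
Proof.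
move=> v1; pose e : 'rV[R]_n.+1 := delta_mx 0 0.
have e1 : dotv e e = 1 by rewrite /dotv trmx_delta mul_delta_mx mxE !eqxx.
have [ve|ve] := eqVneq v e.
  by exists 1%:M; rewrite trmx1 mulmx1 ve mulmx1.
pose w := e - v; pose c := dotv w w.
have c0 : c != 0.
  apply: contraNneq ve => /dotvv_eq0/eqP; rewrite subr_eq0 eq_sym; exact.
have wwT : w *m w^T = c%:M by rewrite [LHS]mx11_scalar.
exists (1%:M - (2 / c) *: (w^T *m w)); split.
  set W := w^T *m w; have WT : W^T = W by rewrite trmx_mul trmxK.
  have WW : W *m W = c *: W.
    by rewrite /W -mulmxA (mulmxA w) wwT mul_scalar_mx scalemxAr.
  have -> : (1%:M - (2 / c) *: W)^T = 1%:M - (2 / c) *: W.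
    by rewrite -[in RHS]WT; apply/matrixP => i j; rewrite !mxE eq_sym.
  rewrite mulmxBl mul1mx mulmxBr mulmx1 -scalemxAl -scalemxAr scalerA WW scalerA.
  rewrite (_ : 2 / c * (2 / c) * c = 2 / c + 2 / c); last by field.
  by apply/matrixP => i j; rewrite !mxE; ring.
rewrite mulmxBr mulmx1 -scalemxAr mulmxA.
have -> : e *m w^T = (c / 2)%:M.
  rewrite [LHS]mx11_scalar; congr _%:M.
  rewrite -[LHS]/(dotv e w) /c /w dotvDl !dotvDr !(dotvNl, dotvNr) (dotvC v e) v1 e1.
  by field.
rewrite mul_scalar_mx scalerA (_ : 2 / c * (c / 2) = 1) ?scale1r; last by field.
by rewrite /w opprB addrC subrK.
Qed.

(** By deflation: once a reflection has moved the top eigenvector to the first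
    basis vector, the top eigenvalue splits off as a block. Taking the largest
    eigenvalue at each stage produces them in sorted order. *)
Theorem sym_spectral n (S : 'M[R]_n) : S^T = S ->
  exists (P : 'M[R]_n) (l : 'rV[R]_n),
    [/\ P *m P^T = 1%:M, S = P^T *m diag_mx l *m P &
        forall i j : 'I_n, (i <= j)%N -> l 0 j <= l 0 i].
Proof.
elim: n S => [|n IH] S symS.
  by exists 1%:M, 0; split => [||[]//]; rewrite ?trmx1 ?mulmx1//;
    apply/matrixP => -[].
have [v [l [v1 vS lmax]]] := top_eigenvector symS.
have [H [HH eH]] := reflection_to_e0 v1.
have HtH : H^T *m H = 1%:M by exact: mulmx1C.
pose T : 'M[R]_(1 + n) := H *m S *m H^T.
have symT : T^T = T by rewrite /T !trmx_mul trmxK symS mulmxA.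
have T0 j : T 0 j = l *+ (j == 0).
  have -> : T 0 j = row 0 T 0 j by rewrite [in RHS]mxE.
  rewrite rowE /T !mulmxA eH vS -scalemxAl -eH -mulmxA HH mulmx1 !mxE eqxx /=.
  by rewrite mulr_natr.
have TB : T = block_mx l%:M 0 0 (drsubmx T).
  have ur : ursubmx T = 0.
    apply/matrixP => i j; rewrite [LHS]mxE [LHS]mxE ord1 lshift0 T0 mxE.
    by rewrite rshift1.
  rewrite -[LHS]submxK ur; congr block_mx.
    apply/matrixP => i j; rewrite [LHS]mxE [LHS]mxE !ord1 !lshift0 T0 mxE.
    by rewrite !eqxx.
  by apply: trmx_inj; rewrite trmx_dlsub symT ur trmx0.
have symD : (drsubmx T)^T = drsubmx T by rewrite trmx_drsub symT.
have [P' [l' [PP' S' l's]]] := IH _ symD.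
have PP'' := mulmx1C PP'.
pose B : 'M[R]_(1 + n) := block_mx 1%:M 0 0 P'.
have BB : B *m B^T = 1%:M.
  rewrite tr_block_mx trmx1 !trmx0 mulmx_block !(mulmx0, mul0mx, addr0, add0r).
  by rewrite mulmx1 PP' -scalar_mx_block.
pose P : 'M[R]_n.+1 := B *m H.
pose d : 'rV[R]_(1 + n) := row_mx l%:M l'.
have PP : P *m P^T = 1%:M.
  by rewrite /P trmx_mul mulmxA -(mulmxA B) HH mulmx1.
have BDB : B^T *m diag_mx d *m B = T.
  rewrite [RHS]TB S' tr_block_mx trmx1 !trmx0 diag_mx_row.
  rewrite !mulmx_block !(mulmx0, mul0mx, addr0, add0r, mulmx1, mul1mx).
  by congr block_mx; apply/matrixP => i j; rewrite !ord1 !mxE.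
have SP : S = P^T *m diag_mx d *m P.
  transitivity (H^T *m T *m H).
    by rewrite /T !mulmxA HtH mul1mx -mulmxA HtH mulmx1.
  by rewrite -BDB /P trmx_mul !mulmxA.
have dl i : d 0 i <= l.
  pose x : 'rV[R]_n.+1 := delta_mx 0 i *m P.
  have x1 : dotv x x = 1.
    by rewrite dotv_orth// /dotv trmx_delta mul_delta_mx mxE !eqxx.
  have := lmax x; rewrite x1 mulr1; congr (_ <= _).
  suff -> : x *m S = d 0 i *: x by rewrite dotvZl x1 mulr1.
  have -> : x *m S = delta_mx 0 i *m (P *m P^T) *m diag_mx d *m P.
    by rewrite {1}SP /x !mulmxA.
  rewrite PP mulmx1.
  by rewrite -[_ *m diag_mx d]rowE row_diag_mx -scalemxAl.
exists P, d; split => // i j ij.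
have d0 : d 0 0 = l.
  by rewrite mxE; case: splitP => k //= _; rewrite ord1 mxE eqxx.
case: (splitP (i : 'I_(1 + n))) ij => [i' |i'] ii.
  have -> : i = 0 by apply/val_inj; rewrite /= ii ord1.
  by rewrite d0 dl.
case: (splitP (j : 'I_(1 + n))) => [j' |j'] jj; rewrite ii jj ?ord1//.
have dR k : d 0 (rshift 1 k) = l' 0 k by rewrite row_mxEr.
rewrite leq_add2l => /l's; rewrite -!dR; congr (d 0 _ <= d 0 _).
- exact/val_inj.
- exact/val_inj.
Qed.

End Spectral.

(** * Singular values *)

Lemma perm_flatten_count (S T : eqType) (f : S -> T) (r s : seq S) :
  uniq r -> r =i s ->
  perm_eq (flatten [seq nseq (count_mem x s) (f x) | x <- r]) (map f s).
Proof.
move=> ur rs.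
have -> : flatten [seq nseq (count_mem x s) (f x) | x <- r] =
    map f (tally_seq [seq (x, count_mem x s) | x <- r]).
  rewrite /tally_seq map_flatten -!map_comp; congr flatten.
  by apply: eq_map => x /=; rewrite map_nseq.
apply/perm_map; rewrite -(permPr (tallyK s)); apply: perm_tally_seq.
rewrite (permPr (tallyE s)); apply/perm_map/uniq_perm; rewrite ?undup_uniq//.
by move=> x; rewrite mem_undup rs.
Qed.

(** The characteristic polynomial is the product of the ['X - l_i], so listing
    its real roots with their multiplicities and sorting gives back [l]. *)
Lemma singular_values_spectral (R : realType) n (A P : 'M[R]_n) (l : 'rV[R]_n) :
  P *m P^T = 1%:M -> A^T *m A = P^T *m diag_mx l *m P ->
  (forall i j : 'I_n, (i <= j)%N -> l 0 j <= l 0 i) ->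
  singular_values A = [seq Num.sqrt (l 0 i) | i <- enum 'I_n].
Proof.
move=> PP AP l_noninc.
have PtP := mulmx1C PP.
pose s := [seq l 0 i | i <- enum 'I_n].
have char_A : char_poly (A^T *m A) = \prod_(y <- s) ('X - y%:P).
  rewrite big_map big_enum /=.
  transitivity (char_poly (diag_mx l)).
    rewrite AP /char_poly /char_poly_mx !map_mxM /=.
    pose C : 'M[{poly R}]_n := map_mx polyC P.
    have CtC : C^T *m C = 1%:M by rewrite /C map_trmx -map_mxM PtP map_mx1.
    have -> : map_mx polyC P^T = C^T by rewrite /C map_trmx.
    have XE : 'X%:M = C^T *m 'X%:M *m C.
      by rewrite mul_mx_scalar -scalemxAl CtC -mul_scalar_mx mulmx1.
    rewrite [in LHS]XE -mulmxBl -mulmxBr !det_mulmx mulrC mulrA -det_mulmx.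
    by rewrite (mulmx1C CtC) det1 mul1r.
  rewrite char_poly_trig ?diag_mx_is_trig//.
  by apply: eq_bigr => i _; rewrite mxE eqxx.
rewrite /singular_values char_A.
have -> : [seq Num.sqrt (l 0 i) | i <- enum 'I_n] = map Num.sqrt s.
  by rewrite /s -[RHS]map_comp.
set p := \prod_(_ <- s) _.
have p_neq0 : p != 0 by rewrite monic_neq0// monic_prod_XsubC.
have rs : rootsR p =i s.
  by move=> x; rewrite -(roots_on_rootsR p_neq0) in_itv /= /p root_prod_XsubC.
have srt : sorted >=%R (map Num.sqrt s).
  rewrite /s -[map _ (map _ _)]map_comp sorted_map.
  apply: (@sub_sorted _ (fun i j : 'I_n => (i <= j)%N)).
    by move=> i j ij /=; rewrite ler_wsqrtr// l_noninc.
  by have := iota_sorted 0 n; rewrite -val_enum_ord sorted_map.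
rewrite (_ : sort _ _ = sort >=%R (map Num.sqrt s)).
  apply: sorted_sort => //; by move=> x y z /= xy yz; exact: le_trans yz xy.
apply/perm_sortP.
- by move=> x y /=; rewrite orbC le_total.
- by move=> x y z /= xy yz; exact: le_trans yz xy.
- by move=> x y /= /andP[xy yx]; apply/eqP; rewrite eq_le yx.
rewrite (_ : flatten _ =
    flatten [seq nseq (count_mem x s) (Num.sqrt x) | x <- rootsR p]).
  by apply: perm_flatten_count => //; exact: uniq_roots.
by congr flatten; apply: eq_map => x; rewrite /p mu_prod_XsubC.
Qed.

(* Without this, failed unifications unfold characteristic polynomials. *)
Opaque singular_values.

Section SingularValues.
Context {R : realType} {n : nat}.
Implicit Types A B P : 'M[R]_n.

Lemma dotv_gram A (x : 'rV[R]_n) :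
  dotv (x *m (A^T *m A)) x = enorm (x *m A^T) ^+ 2.
Proof. by rewrite enorm_sq /dotv trmx_mul trmxK !mulmxA. Qed.

Lemma sv_spectral A :
  exists P : 'M[R]_n, [/\ P *m P^T = 1%:M,
    A^T *m A = P^T *m diag_mx (\row_(i < n) (singular_values A)`_i ^+ 2) *m P,
    size (singular_values A) = n,
    (forall i, 0 <= (singular_values A)`_i) &
    (forall i j, (i <= j)%N -> (singular_values A)`_j <= (singular_values A)`_i)].
Proof.
have symA : (A^T *m A)^T = A^T *m A by rewrite trmx_mul trmxK.
have [P [l [PP AP l_noninc]]] := sym_spectral symA.
have svE := singular_values_spectral PP AP l_noninc.
have svi (i : 'I_n) : (singular_values A)`_i = Num.sqrt (l 0 i).
  by rewrite svE (nth_map i) ?size_enum_ord// nth_ord_enum.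
have size_sv : size (singular_values A) = n by rewrite svE size_map size_enum_ord.
have l_ge0 i : 0 <= l 0 i.
  pose x : 'rV[R]_n := delta_mx 0 i *m P.
  have -> : l 0 i = dotv (x *m (A^T *m A)) x.
    rewrite AP /x !mulmxA -[_ *m P *m P^T]mulmxA PP mulmx1.
    rewrite -[_ *m diag_mx l]rowE row_diag_mx -scalemxAl dotvZl.
    by rewrite dotv_orth// /dotv trmx_delta mul_delta_mx mxE !eqxx mulr1.
  by rewrite dotv_gram sqr_ge0.
have sv_ge0 i : 0 <= (singular_values A)`_i.
  have [ni|ni] := leqP n i; first by rewrite nth_default ?size_sv.
  by rewrite -[i]/(nat_of_ord (Ordinal ni)) svi sqrtr_ge0.
exists P; split => //.
  rewrite AP; congr (_ *m diag_mx _ *m _); apply/rowP => i.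
  by rewrite mxE svi sqr_sqrtr.
move=> i j ij; have [nj|nj] := leqP n j; first by rewrite nth_default ?size_sv.
have ni : (i < n)%N by exact: leq_ltn_trans nj.
rewrite -[i]/(nat_of_ord (Ordinal ni)) -[j]/(nat_of_ord (Ordinal nj)) !svi.
by rewrite ler_wsqrtr// l_noninc.
Qed.

Lemma size_singular_values A : size (singular_values A) = n.
Proof. by have [P []] := sv_spectral A. Qed.

Lemma sv_ge0 A i : 0 <= (singular_values A)`_i.
Proof. by have [P []] := sv_spectral A. Qed.

Lemma sv_nonincreasing A i j : (i <= j)%N ->
  (singular_values A)`_j <= (singular_values A)`_i.
Proof. by have [P [_ _ _ _]] := sv_spectral A; apply. Qed.

Lemma sv_enorm A : exists P, [/\ P *m P^T = 1%:M, P^T *m P = 1%:M &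
  forall x : 'rV[R]_n, enorm (x *m A^T) ^+ 2 =
    \sum_(i < n) (singular_values A)`_i ^+ 2 * ((x *m P^T) 0 i) ^+ 2].
Proof.
have [P [PP AP _ _ _]] := sv_spectral A.
exists P; split => [//||x]; first exact: mulmx1C.
rewrite -dotv_gram AP !mulmxA mul_mx_diag.
have -> (u : 'rV[R]_n) : dotv (u *m P) x = dotv u (x *m P^T).
  by rewrite /dotv trmx_mul trmxK mulmxA.
by rewrite dotvE; apply: eq_bigr => i _; rewrite !mxE; ring.
Qed.

Lemma sv_attained A (i : 'I_n) : exists x : 'rV[R]_n,
  enorm x = 1 /\ enorm (x *m A^T) = (singular_values A)`_i.
Proof.
have [P [PP PtP Ax]] := sv_enorm A.
exists (delta_mx 0 i *m P); split.
  rewrite enorm_orth//; apply: (@pexpIrn _ 2) => //; rewrite ?nnegrE ?enorm_ge0//.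
  by rewrite enorm_sq /dotv trmx_delta mul_delta_mx mxE !eqxx expr1n.
apply: (@pexpIrn _ 2) => //; rewrite ?nnegrE ?enorm_ge0 ?sv_ge0//.
rewrite Ax -mulmxA PP mulmx1 (bigD1 i)//= big1 ?addr0.
  by rewrite mxE !eqxx expr1n mulr1.
by move=> j ji; rewrite mxE eqxx (negPf ji) expr0n mulr0.
Qed.

Lemma sv_le A c i : 0 <= c -> (forall x, enorm (x *m A^T) <= c * enorm x) ->
  (singular_values A)`_i <= c.
Proof.
move=> c0 Ac; have [ni|ni] := leqP n i.
  by rewrite nth_default ?size_singular_values.
have [x [x1 <-]] := sv_attained A (Ordinal ni).
by rewrite (le_trans (Ac x))// x1 mulr1.
Qed.

Lemma sv_ge A c (i : 'I_n) : (forall x, c * enorm x <= enorm (x *m A^T)) ->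
  c <= (singular_values A)`_i.
Proof.
move=> Ac; have [x [x1 <-]] := sv_attained A i.
by apply: le_trans (Ac x); rewrite x1 mulr1.
Qed.

Lemma enorm_mul_sv0 A (x : 'rV[R]_n) :
  enorm (x *m A^T) <= (singular_values A)`_0 * enorm x.
Proof.
rewrite -(@ler_pXn2r _ 2) ?nnegrE ?mulr_ge0 ?enorm_ge0 ?sv_ge0// exprMn.
have [P [PP PtP ->]] := sv_enorm A.
rewrite -(enorm_orth (P := P^T) x) ?trmxK// enorm_sq dotvE mulr_sumr ler_sum// => i _.
rewrite -expr2 ler_wpM2r ?sqr_ge0// ler_pXn2r ?nnegrE ?sv_ge0//.
exact: sv_nonincreasing.
Qed.

(** The integer case of [omega]; it makes sense for all [k], and is zero beyond the
    dimension. *)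
Definition sv_prod k A : R := \prod_(i < k) (singular_values A)`_i.

Lemma sv_prod_ge0 k A : 0 <= sv_prod k A.
Proof. by apply: prodr_ge0 => i _; exact: sv_ge0. Qed.

Lemma omegaE d A :
  omega d A = sv_prod (Num.truncn d) A *
    (singular_values A)`_(Num.truncn d) `^ (d - (Num.truncn d)%:R).
Proof. by []. Qed.

End SingularValues.

Opaque omega.

(** * Horn's inequality *)

(** The Cauchy-Binet formula, with the minors indexed by all maps
    ['I_k -> 'I_n]: each [k]-element set of rows is counted [k`!] times, and the
    non-injective maps contribute zero. *)
Lemma cauchy_binet (R : comNzRingType) n k (X Y : 'M[R]_(n, k)) :
  (k`!)%:R * \det (X^T *m Y) =
  \sum_(f : {ffun 'I_k -> 'I_n}) \det (rowsub f X) * \det (rowsub f Y).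
Proof.
have sgn2 (s : 'S_k) : (-1 : R) ^+ s * (-1) ^+ s = 1.
  by rewrite -expr2 sqrr_sign.
transitivity (\sum_(s : 'S_k) \sum_(t : 'S_k) (-1) ^+ s * (-1) ^+ t *
    \prod_i (X^T *m Y) (s i) (t i)).
  have detE (s : 'S_k) : \det (X^T *m Y) = \sum_(t : 'S_k) (-1) ^+ s * (-1) ^+ t *
      \prod_i (X^T *m Y) (s i) (t i).
    rewrite /determinant (reindex_inj (mulgI s^-1%g)) /=.
    apply: eq_bigr => t _; rewrite odd_permM odd_permV signr_addb.
    congr (_ * _); rewrite (reindex_inj (@perm_inj _ s)) /=.
    by apply: eq_bigr => i _; rewrite permM permK.
  rewrite (eq_bigr (fun=> \det (X^T *m Y))); last by move=> s _; rewrite -detE.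
  by rewrite sumr_const card_Sn mulr_natl.
transitivity (\sum_(s : 'S_k) \sum_(t : 'S_k) (-1) ^+ s * (-1) ^+ t *
    \sum_(f : {ffun 'I_k -> 'I_n}) \prod_i (X (f i) (s i) * Y (f i) (t i))).
  apply: eq_bigr => s _; apply: eq_bigr => t _; congr (_ * _).
  rewrite -(bigA_distr_bigA (fun i j => X j (s i) * Y j (t i))).
  by apply: eq_bigr => i _; rewrite mxE; apply: eq_bigr => j _; rewrite mxE.
under eq_bigr do under eq_bigr do rewrite mulr_sumr.
under eq_bigr do rewrite exchange_big /=.
rewrite exchange_big /=; apply: eq_bigr => f _.
rewrite /determinant mulr_suml; apply: eq_bigr => s _.
rewrite mulr_sumr; apply: eq_bigr => t _.
rewrite big_split /= mulrACA.
by congr (_ * _ * (_ * _)); apply: eq_bigr => i _; rewrite mxE.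
Qed.

Lemma det_rowsub_noninj (R : comNzRingType) n k (X : 'M[R]_(n, k))
    (f : {ffun 'I_k -> 'I_n}) : ~ injective f -> \det (rowsub f X) = 0.
Proof.
move=> f_ninj; have [/injectiveP//|] := boolP (injectiveb f).
move=> /injectivePn[i [j ij fij]].
by apply: (determinant_alternate ij) => h; rewrite !mxE fij.
Qed.

(** By exchange: as many of the first [k] entries are left out as entries beyond
    them are used, and [l k.-1] separates the two groups. *)
Lemma prod_inj_le (R : realDomainType) n k (l : nat -> R) (f : 'I_k -> 'I_n) :
  (forall i, 0 <= l i) -> (forall i j, (i <= j)%N -> l j <= l i) ->
  injective f -> \prod_i l (f i) <= \prod_(i < k) l i.
Proof.
move=> l0 l_noninc f_inj.
pose S := [set f i | i in [set: 'I_k]]%SET.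
have cardS : #|S| = k by rewrite card_imset// cardsT card_ord.
have kn : (k <= n)%N by rewrite -cardS (leq_trans (max_card _))// card_ord.
pose I : {set 'I_n} := [set i : 'I_n | (i < k)%N]%SET.
have cardI : #|I| = k.
  have -> : I = [set widen_ord kn i | i in [set: 'I_k]]%SET.
    apply/setP => i; rewrite inE; apply/idP/imsetP => [ik|[j _ ->]]; last by rewrite /= ltn_ord.
    by exists (Ordinal ik) => //; exact/val_inj.
  rewrite card_imset ?cardsT ?card_ord// => i j /(congr1 val) /= ij.
  exact/val_inj.
have -> : \prod_i l (f i) = \prod_(i in S) l i.
  rewrite big_imset /=; last by move=> i j _ _; exact: f_inj.
  by apply: eq_bigl => i; rewrite inE.
have -> : \prod_(i < k) l i = \prod_(i in I) l i.
  rewrite (eq_bigl (fun i : 'I_n => (i < k)%N)); last by move=> i; rewrite inE.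
  by rewrite (big_ord_narrow kn).
rewrite (big_setID I) /= [leRHS](big_setID S) /= finset.setIC.
apply: ler_wpM2l; first by apply: prodr_ge0.
have cardD : #|S :\: I| = #|I :\: S|.
  by rewrite !cardsD cardS cardI finset.setIC.
have [k0|k0] := posnP k.
  have -> : S :\: I = finset.set0.
    apply/eqP; rewrite -cards_eq0 -leqn0 -k0 -[X in (_ <= X)%N]cardS.
    exact/subset_leq_card/subsetDl.
  have -> : I :\: S = finset.set0.
    apply/eqP; rewrite -cards_eq0 -leqn0 -k0 -[X in (_ <= X)%N]cardI.
    exact/subset_leq_card/subsetDl.
  by rewrite !big_set0.
apply: (@le_trans _ _ (\prod_(i in S :\: I) l k.-1)).
  apply: ler_prod => i; rewrite !inE -leqNgt => /andP[ki _]; rewrite l0 /=.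
  by apply: l_noninc; rewrite (leq_trans _ ki)// leq_pred.
rewrite prodr_const cardD -prodr_const; apply: ler_prod => i.
rewrite !inE => /andP[_ ik]; rewrite l0 /=.
by apply: l_noninc; rewrite -ltnS prednK.
Qed.

Section Horn.
Context {R : realType} {n : nat}.
Implicit Types A B : 'M[R]_n.

(** In coordinates that diagonalize [A^T A], expand both Gram determinants by
    Cauchy-Binet: the term of an injective [f] on the right gets multiplied on the
    left by the product of the squares of the singular values at [f i]. *)
Lemma det_gram_le A k (X : 'M[R]_(n, k)) :
  \det ((A *m X)^T *m (A *m X)) <= sv_prod k A ^+ 2 * \det (X^T *m X).
Proof.
have [P [PP AP _ s_ge0 s_noninc]] := sv_spectral A.
set s := singular_values A in AP s_ge0 s_noninc.
pose d : 'rV[R]_n := \row_(i < n) s`_i ^+ 2.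
pose Y := P *m X.
have -> : (A *m X)^T *m (A *m X) = (diag_mx d *m Y)^T *m Y.
  rewrite trmx_mul mulmxA -(mulmxA _ A^T) AP /Y !trmx_mul tr_diag_mx.
  by rewrite !mulmxA.
have -> : X^T *m X = Y^T *m Y.
  by rewrite /Y trmx_mul mulmxA -(mulmxA X^T) (mulmx1C PP) mulmx1.
have kfact : 0 < (k`!)%:R :> R by rewrite ltr0n fact_gt0.
rewrite -(ler_pM2l kfact) mulrCA !cauchy_binet mulr_sumr ler_sum// => f _.
have [f_inj|f_ninj] := pselect (injective f); last first.
  by rewrite !(det_rowsub_noninj _ f_ninj) !mulr0.
have -> : rowsub f (diag_mx d *m Y) = diag_mx (\row_i d 0 (f i)) *m rowsub f Y.
  by apply/matrixP => i j; rewrite !mul_diag_mx !mxE.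
rewrite det_mulmx det_diag -mulrA ler_wpM2r -?expr2 ?sqr_ge0//.
rewrite /sv_prod -prodrXl (eq_bigr (fun i => s`_(f i) ^+ 2)); last first.
  by move=> i _; rewrite !mxE.
apply: (@prod_inj_le _ n k (fun i => s`_i ^+ 2)) => // [i|i j ij].
  exact: sqr_ge0.
by rewrite ler_pXn2r ?nnegrE// s_noninc.
Qed.

(** Equality holds for the leading [k] right singular vectors. *)
Lemma det_gram_attained A k : (k <= n)%N -> exists X : 'M[R]_(n, k),
  X^T *m X = 1%:M /\ \det ((A *m X)^T *m (A *m X)) = sv_prod k A ^+ 2.
Proof.
move=> kn; have [P [PP AP _ s_ge0 s_noninc]] := sv_spectral A.
set s := singular_values A in AP s_ge0 s_noninc.
pose E : 'M[R]_(n, k) := \matrix_(i, j) (i == widen_ord kn j)%:R.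
have colE (M : 'M[R]_n) : E^T *m M *m E = \matrix_(i, j) M (widen_ord kn i) (widen_ord kn j).
  apply/matrixP => i j; rewrite !mxE (bigD1 (widen_ord kn j))//= big1 => [|l lj].
    rewrite addr0 !mxE eqxx mulr1 (bigD1 (widen_ord kn i))//= big1 => [|l li].
      by rewrite !mxE eqxx mul1r addr0.
    by rewrite !mxE (negPf li) mul0r.
  by rewrite !mxE (negPf lj) mulr0.
exists (P^T *m E); split.
  rewrite trmx_mul trmxK mulmxA -(mulmxA _ P) PP colE.
  by apply/matrixP => i j; rewrite !mxE.
have -> : (A *m (P^T *m E))^T *m (A *m (P^T *m E)) =
    E^T *m diag_mx (\row_(i < n) s`_i ^+ 2) *m E.
  rewrite !trmx_mul trmxK !mulmxA -(mulmxA _ A^T) AP.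
  rewrite !mulmxA -[_ *m P *m P^T]mulmxA PP mulmx1.
  by rewrite -[_ *m P *m P^T]mulmxA PP mulmx1.
rewrite colE (_ : \matrix_(i, j) _ = diag_mx (\row_(i < k) s`_i ^+ 2)).
  by rewrite det_diag /sv_prod -prodrXl; apply: eq_bigr => i _; rewrite mxE.
apply/matrixP => i j; rewrite !mxE; congr (_ *+ _).
Qed.

(** Horn's inequality in integer dimension: apply the Gram bound first to [A], then
    to [B], starting from a frame that is extremal for [A B]. *)
Lemma sv_prod_mul k A B : sv_prod k (A *m B) <= sv_prod k A * sv_prod k B.
Proof.
have [kn|nk] := leqP k n; last first.
  have -> : sv_prod k (A *m B) = 0; last by rewrite mulr_ge0 ?sv_prod_ge0.
  apply/eqP; rewrite prodf_seq_eq0; apply/hasP; exists (Ordinal nk).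
    exact: mem_index_enum.
  by rewrite /= nth_default ?size_singular_values.
rewrite -(@ler_pXn2r _ 2) ?nnegrE ?mulr_ge0 ?sv_prod_ge0//.
have [X [XX <-]] := det_gram_attained (A *m B) kn.
rewrite -mulmxA (le_trans (det_gram_le A _))// exprMn ler_wpM2l ?sqr_ge0//.
by rewrite (le_trans (det_gram_le B _))// XX det1 mulr1.
Qed.

(** Geometric interpolation between integer dimensions, through which products of
    matrices in real dimension reduce to the integer case. *)
Lemma omega_interp d A : 0 <= d ->
  omega d A = sv_prod (Num.truncn d) A `^ (1 - (d - (Num.truncn d)%:R)) *
              sv_prod (Num.truncn d).+1 A `^ (d - (Num.truncn d)%:R).
Proof.
move=> d0; have /andP[kd dk] := truncn_itv d0; rewrite omegaE.
move: (Num.truncn d) kd dk => k kd dk.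
have [p0|p_neq0] := eqVneq (sv_prod k A) 0.
  rewrite p0 mul0r; case: (eqVneq (1 - (d - k%:R)) 0) => [e|e].
    by move: dk; rewrite -natr1; lra.
  by rewrite powR0// mul0r.
have -> : sv_prod k.+1 A = sv_prod k A * (singular_values A)`_k.
  by rewrite /sv_prod big_ord_recr.
rewrite powRM ?sv_prod_ge0 ?sv_ge0// mulrA -powRD ?p_neq0 ?implybT// subrK.
by rewrite powRr1 ?sv_prod_ge0.
Qed.

Lemma omega_mul d A B : 0 <= d -> omega d (A *m B) <= omega d A * omega d B.
Proof.
move=> d0; have /andP[kd dk] := truncn_itv d0; rewrite -natr1 in dk.
rewrite (omega_interp (A *m B) d0) (omega_interp A d0) (omega_interp B d0).
move: (Num.truncn d) kd dk => k kd dk.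
set a := 1 - _; set b := d - _.
have a0 : 0 <= a by rewrite /a; lra.
have b0 : 0 <= b by rewrite /b; lra.
have mono m c : 0 <= c ->
    sv_prod m (A *m B) `^ c <= sv_prod m A `^ c * sv_prod m B `^ c.
  move=> c0; rewrite -powRM ?sv_prod_ge0//.
  apply: ge0_ler_powR; rewrite ?nnegrE ?mulr_ge0 ?sv_prod_ge0//.
  exact: sv_prod_mul.
have [mA mB] := (mono k _ a0, mono k.+1 _ b0).
by apply: le_trans (ler_pM (powR_ge0 _ _) (powR_ge0 _ _) mA mB) _; rewrite mulrACA.
Qed.

Lemma omega_le_exp d A c : 0 <= d -> 0 < c ->
  (forall i, (singular_values A)`_i <= c) -> omega d A <= c `^ d.
Proof.
move=> d0 c0 sc; have /andP[kd dk] := truncn_itv d0.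
rewrite omegaE; move: (Num.truncn d) kd dk => k kd dk.
have -> : c `^ d = c ^+ k * c `^ (d - k%:R).
  rewrite -powR_mulrn ?ltW// -powRD ?(gt_eqF c0) ?implybT//.
  by congr (_ `^ _); rewrite addrC subrK.
apply: ler_pM; rewrite ?sv_prod_ge0 ?powR_ge0//.
  rewrite -[X in _ ^+ X]card_ord -prodr_const ler_prod// => i _.
  by rewrite sv_ge0 sc.
by apply: ge0_ler_powR; rewrite ?nnegrE ?sv_ge0 ?(ltW c0) ?subr_ge0.
Qed.

End Horn.

(** * Dependence of the singular value function on the dimension *)

Section OmegaDim.
Context {R : realType} {n : nat}.
Implicit Types A : 'M[R]_n.

Definition sv_positive A := forall s, s \in singular_values A -> 0 < s.

Lemma sv_gt0 A i : sv_positive A -> (i < n)%N -> 0 < (singular_values A)`_i.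
Proof. by move=> Apos ni; apply: Apos; rewrite mem_nth// size_singular_values. Qed.

Lemma sv_prod_gt0 A k : sv_positive A -> (k <= n)%N -> 0 < sv_prod k A.
Proof.
move=> Apos kn; apply: prodr_gt0 => i _; apply: sv_gt0 => //.
exact: leq_trans (ltn_ord i) kn.
Qed.

Lemma truncn_le_dim (d : R) : d <= n%:R -> (Num.truncn d <= n)%N.
Proof. by move=> /le_truncn; rewrite natrK. Qed.

Lemma truncn_lt_dim (d : R) : 0 <= d -> d < n%:R -> (Num.truncn d < n)%N.
Proof.
by move=> d0 dn; rewrite -(ltr_nat R); apply: le_lt_trans dn; case/andP: (truncn_itv d0).
Qed.

Lemma omega_gt0 A d : sv_positive A -> 0 <= d <= n%:R -> 0 < omega d A.
Proof.
move=> Apos /andP[d0 dn]; rewrite omegaE mulr_gt0//.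
  by rewrite sv_prod_gt0// truncn_le_dim.
rewrite le_eqVlt in dn; case/orP: dn => [/eqP ->|dn].
  by rewrite natrK subrr powRr0.
by rewrite powR_gt0// sv_gt0// truncn_lt_dim.
Qed.

Lemma omega0 A : omega 0 A = 1.
Proof. by rewrite omegaE truncn0 subrr powRr0 mulr1 /sv_prod big_ord0. Qed.

(** As a function of [d], [ln (omega d A)] vanishes at [0] and has slope
    [ln s_k] between [k] and [k + 1], where the singular values [s_k] decrease;
    so it is concave, and its mean slope decreases too. *)
Lemma ln_omega_concave A d d' : sv_positive A -> 0 < d -> d <= d' -> d' <= n%:R ->
  ln (omega d' A) <= d' / d * ln (omega d A).
Proof.
move=> Apos d0; rewrite le_eqVlt => /orP[/eqP <- _|dd' d'n].
  by rewrite divff ?mul1r ?gt_eqF.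
have d'0 : 0 < d' by exact: lt_trans dd'.
have kn : (Num.truncn d < n)%N by apply: truncn_lt_dim; [exact: ltW|exact: lt_le_trans d'n].
pose k := Num.truncn d; pose k' := Num.truncn d'.
pose c := (singular_values A)`_k.
have c0 : 0 < c by exact: sv_gt0.
have kk' : (k <= k')%N by apply: le_truncn; exact: ltW.
have /andP[kd _] := truncn_itv (ltW d0).
have /andP[k'd _] := truncn_itv (ltW d'0).
have cpow x y : c `^ (x + y) = c `^ x * c `^ y.
  by rewrite powRD// (gt_eqF c0) implybT.
have low : c `^ d <= omega d A.
  rewrite omegaE -[d in leLHS](subrKC k%:R) cpow ler_wpM2r ?powR_ge0//.
  rewrite powR_mulrn ?(ltW c0)// -[X in _ ^+ X]card_ord -prodr_const.
  apply: ler_prod => i _.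
  by rewrite (ltW c0) sv_nonincreasing// ltnW.
have up : omega d' A <= omega d A * c `^ (d' - d).
  have sv_k' : sv_prod k' A <= sv_prod k A * c ^+ (k' - k).
    rewrite /sv_prod -!(big_mkord xpredT (fun i => (singular_values A)`_i)).
    rewrite (@big_cat_nat _ _ _ k)//= ler_wpM2l//.
      by apply: prodr_ge0 => i _; exact: sv_ge0.
    rewrite -prodr_const_nat; rewrite big_nat [leRHS]big_nat.
    apply: ler_prod => i /andP[ki _].
    by rewrite sv_ge0 sv_nonincreasing.
  rewrite !omegaE -/k -/k' -/c -mulrA -cpow.
  have -> : d - k%:R + (d' - d) = (k' - k)%:R + (d' - k'%:R).
    by rewrite natrB//; ring.
  rewrite cpow powR_mulrn ?(ltW c0)// mulrA ler_pM ?sv_prod_ge0 ?powR_ge0//.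
  by rewrite ge0_ler_powR ?nnegrE ?sv_ge0 ?subr_ge0 ?sv_nonincreasing// ltW.
have w0 : 0 < omega d A by apply: omega_gt0; rewrite ?(ltW d0)//= ltW// (lt_le_trans dd').
have w'0 : 0 < omega d' A by apply: omega_gt0; rewrite ?(ltW d'0).
have cd0 := powR_gt0 (d' - d) c0; have cd := powR_gt0 d c0.
have {}up : ln (omega d' A) <= ln (omega d A) + (d' - d) * ln c.
  by rewrite -ln_powR -lnM ?posrE// ler_ln ?posrE// (mulr_gt0 w0 cd0).
have {}low : d * ln c <= ln (omega d A) by rewrite -ln_powR ler_ln ?posrE.
rewrite mulrAC ler_pdivlMr//.
have : (d' - d) * (d * ln c) <= (d' - d) * ln (omega d A).
  by rewrite ler_wpM2l// subr_ge0 ltW.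
have := ler_wpM2l (ltW d0) up; nra.
Qed.

(** With the exponent of the last factor positive and at most [1], instead of
    nonnegative and less than [1], the index [k] stays below the dimension also
    for [d = n]. *)
Lemma omega_ceil d : 0 < d -> exists k : nat,
  [/\ k%:R < d, d <= k.+1%:R & forall A : 'M[R]_n,
    omega d A = sv_prod k A * (singular_values A)`_k `^ (d - k%:R)].
Proof.
move=> d0; have /andP[kd dk] := truncn_itv (ltW d0); move: kd.
rewrite le_eqVlt => /orP[/eqP kd|kd]; last by exists (Num.truncn d); split => //; exact: ltW.
case: (Num.truncn d) kd dk => [|k] kd _; first by rewrite -kd ltxx in d0.
exists k; rewrite -kd ltr_nat; split => // B.
rewrite omegaE natrK subrr powRr0 mulr1 /sv_prod big_ord_recr /=.
by rewrite -natr1 addrAC subrr add0r powRr1 ?sv_ge0.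
Qed.

Lemma sv_positive_unit A : sv_positive A -> A \in unitmx.
Proof.
move=> Apos; have [P [PP AP _ _ _]] := sv_spectral A.
have : A^T *m A \in unitmx.
  have [Pu Ptu] := mulmx1_unit PP.
  rewrite AP !unitmx_mul Pu Ptu andbT unitmxE det_diag unitfE.
  by apply/prodf_neq0 => i _; rewrite mxE expf_neq0// gt_eqF// sv_gt0.
by rewrite unitmx_mul => /andP[].
Qed.

End OmegaDim.

(** * Uniform strict differentiability along a compact set *)

Section Enorm.
Context {R : realType} {n : nat}.
Implicit Types (x y v : 'rV[R]_n) (M : 'M[R]_n).

Lemma nbhs_enormP x (A : set 'rV[R]_n) :
  nbhs x A <-> exists2 e : R, 0 < e & forall y, enorm (y - x) < e -> A y.
Proof.
split=> [/nbhs_normP[e /= e0 eA]|[e e0 eA]].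
  exists e => // y yx; apply: eA => /=; rewrite /ball_ /= distrC.
  exact: le_lt_trans (norm_le_enorm _) yx.
have n1 : 0 < Num.sqrt n%:R + 1 :> R by rewrite ltr_wpDl ?sqrtr_ge0.
apply/nbhs_ballP; exists (e / (Num.sqrt n%:R + 1)); first by rewrite /= divr_gt0.
move=> y; rewrite -ball_normE /ball_ /= distrC ltr_pdivlMr// mulrC => yx; apply: eA.
apply: le_lt_trans (enorm_le_norm _) _; apply: le_lt_trans yx.
by rewrite ler_wpM2r// lerDl.
Qed.

Definition op_le M (c : R) := forall v, enorm (v *m M) <= c * enorm v.

Lemma op_le_trans M c c' : op_le M c -> c <= c' -> op_le M c'.
Proof. by move=> Mc cc' v; rewrite (le_trans (Mc v))// ler_wpM2r ?enorm_ge0. Qed.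

Lemma op_le_ex M : exists2 c, 0 < c & op_le M c.
Proof.
exists ((singular_values M^T)`_0 + 1); first by rewrite ltr_wpDl ?sv_ge0.
move=> v; rewrite -[M in leLHS]trmxK (le_trans (enorm_mul_sv0 _ _))//.
by rewrite ler_wpM2r ?enorm_ge0// lerDl.
Qed.

Lemma op_leD M N c c' : op_le M c -> op_le N c' -> op_le (M + N) (c + c').
Proof.
move=> Mc Nc v; rewrite mulmxDr (le_trans (enormD _ _))// mulrDl.
by rewrite lerD.
Qed.

Lemma op_le_entries M b : (forall i j, `|M i j| <= b) ->
  op_le M (Num.sqrt n%:R * n%:R * b).
Proof.
move=> Mb v; rewrite -!mulrA; have [->|v0] := eqVneq v 0.
  by rewrite mul0mx !enorm0 !mulr0.
have b0 : 0 <= b.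
  have [i _] : exists i, v 0 i != 0.
    by apply/existsP; apply: contraNT v0; rewrite negb_exists => /forallP v0;
      apply/eqP/rowP => i; rewrite mxE; apply/eqP; have := v0 i; rewrite negbK.
  exact: le_trans (normr_ge0 _) (Mb i i).
apply: enorm_le_coord => [|i].
  by rewrite !mulr_ge0 ?enorm_ge0.
rewrite mxE mulr_natl -[X in _ *+ X]card_ord -sumr_const.
rewrite (le_trans (ler_norm_sum _ _ _))// ler_sum// => j _.
by rewrite normrM mulrC ler_pM ?normr_ge0 ?coord_le_enorm.
Qed.

Lemma entry_le_norm M i j : `|M i j| <= `|M|.
Proof.
rewrite [leRHS]/Num.Def.normr/= mx_normrE.
by apply: (le_trans _ (le_bigmax _ _ (i, j))).
Qed.

(** Compactness in the form of a near covering, with the bound tending to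
    infinity; used with [c^-1] as a radius, it also makes radii uniform. *)
Lemma compact_uniform_bound (K : set 'rV[R]_n) (Q : R -> 'rV[R]_n -> Prop) :
  compact K -> (forall c c' x, 0 < c -> c <= c' -> Q c x -> Q c' x) ->
  (forall x, K x -> exists c, exists2 e, 0 < c /\ 0 < e &
    forall y, K y -> enorm (y - x) < e -> Q c y) ->
  exists2 c, 0 < c & forall x, K x -> Q c x.
Proof.
move=> /compact_near_coveringP cK Qmono Qloc.
have : \forall c \near +oo, K `<=` (fun x => K x -> Q c x).
  apply: cK => x Kx; have [c [e [c0 e0] cQ]] := Qloc x Kx.
  exists ([set y | enorm (y - x) < e], [set c' | c < c']); last first.
    by move=> [y c'] /= [yx cc'] Ky; apply: Qmono (ltW cc') (cQ y Ky yx).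
  split; first by apply/nbhs_enormP; exists e.
  by exists c; split => //; exact: num_real.
move=> [c [_ cQ]]; exists (Order.max c 0 + 1).
  by rewrite ltr_pwDr// le_max lexx orbT.
by move=> x Kx; apply: cQ => //; rewrite ltr_pwDr// le_max lexx.
Qed.

End Enorm.

Section StrictDiff.
Context {R : realType} {n : nat}.
Implicit Types (K U : set 'rV[R]_n) (f g : 'rV[R]_n -> 'rV[R]_n)
  (D E : 'rV[R]_n -> 'M[R]_n) (p q x y v : 'rV[R]_n).

(** Strict differentiability along [K], where [x] and [y] move independently near
    [p]. It is stable under composition, contains the continuity of [D], and is
    what estimates between trajectories provide. *)
Definition unif_sdiff K f D := forall e : R, 0 < e -> exists2 del : R, 0 < del &
  forall p x y, K p -> enorm (x - p) < del -> enorm (y - p) < del ->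
    enorm (f x - f y - (x - y) *m D p) <= e * enorm (x - y).

Lemma unif_sdiff_jacobian K f D p : unif_sdiff K f D -> K p -> 'J f p = D p.
Proof.
move=> fD Kp.
have lin_cont : continuous (mulmxr (D p) : 'rV[R]_n -> 'rV[R]_n).
  move=> x; have [c c0 Dc] := op_le_ex (D p).
  move=> A /nbhs_enormP[e e0 eA]; apply/nbhs_enormP.
  exists (e / c) => [|y]; first exact: divr_gt0.
  rewrite ltr_pdivlMr// mulrC => yx; apply: eA; rewrite /= -mulmxBl.
  exact: le_lt_trans (Dc _) yx.
have dE : 'd f p = mulmxr (D p) :> ('rV[R]_n -> 'rV[R]_n).
  apply: diff_unique => //; apply/eqaddoP => e e0.
  have n1 : 0 < Num.sqrt n%:R + 1 :> R by rewrite ltr_wpDl ?sqrtr_ge0.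
  have [del del0 fdel] := fD (e / (Num.sqrt n%:R + 1)) (divr_gt0 e0 n1).
  apply/nbhs_enormP; exists del => // h; rewrite subr0 => hdel.
  have := fdel p (h + p) p Kp; rewrite addrK subrr enorm0 => /(_ hdel del0) fh.
  apply: le_trans (norm_le_enorm _) _.
  have -> : (f \o shift p - (cst (f p) + mulmxr (D p))) h =
      f (h + p) - f p - h *m D p.
    by rewrite -[LHS]/(f (h + p) - (f p + h *m D p)) opprD addrA.
  apply: le_trans fh _.
  rewrite -mulrA ler_wpM2l ?(ltW e0)// mulrC ler_pdivrMr// mulrC.
  by apply: le_trans (enorm_le_norm _) _; rewrite ler_wpM2r// lerDl.
by apply/row_matrixP => i; rewrite !rowE /jacobian mul_rV_lin1 dE.
Qed.

Lemma unif_sdiff_continuous K f D : unif_sdiff K f D ->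
  forall e : R, 0 < e -> exists2 del : R, 0 < del &
  forall p q, K p -> K q -> enorm (p - q) < del -> op_le (D p - D q) e.
Proof.
move=> fD e e0; have [|del del0 fdel] := fD (e / 2); first exact: divr_gt0.
exists (del / 2) => [|p q Kp Kq pq v]; first exact: divr_gt0.
have [->|v0] := eqVneq v 0; first by rewrite mul0mx enorm0 mulr0.
have vp : 0 < enorm v by rewrite enorm_gt0.
(* compare the two derivatives on a segment that is close to both points *)
pose a := del / 4 / enorm v; pose w := a *: v.
have a0 : 0 < a by rewrite /a !divr_gt0.
have ew : enorm w = del / 4 by rewrite enormZ gtr0_norm// divfK// gt_eqF.
have e1 : enorm (p + w - p) < del by rewrite addrC addKr ew; lra.
have e2 : enorm (p - p) < del by rewrite subrr enorm0.
have e3 : enorm (p + w - q) < del.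
  by rewrite addrAC (le_lt_trans (enormD _ _))// ew; lra.
have e4 : enorm (p - q) < del by lra.
have h1 := fdel p _ _ Kp e1 e2; have h2 := fdel q _ _ Kq e3 e4.
rewrite (addrC p w) addrK in h1 h2.
have : enorm (w *m (D p - D q)) <= e * enorm w.
  set F := f _ - f _ in h1 h2.
  have -> : w *m (D p - D q) = (F - w *m D q) - (F - w *m D p).
    by rewrite mulmxBr opprB [RHS]addrC addrA subrK.
  apply: le_trans (enormB _ _) _; apply: le_trans (lerD h2 h1) _.
  by rewrite -mulrDl -splitr.
by rewrite /w -scalemxAl !enormZ mulrCA ler_pM2l// gtr0_norm.
Qed.

Lemma unif_sdiff_bounded K f D : compact K -> unif_sdiff K f D ->
  exists2 c, 0 < c & forall p, K p -> op_le (D p) c.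
Proof.
move=> cK fD; apply: compact_uniform_bound => // [c c' x _ cc' Dc|p Kp].
  exact: op_le_trans cc'.
have [del del0 Dcont] := unif_sdiff_continuous fD ltr01.
have [c c0 Dc] := op_le_ex (D p).
exists (1 + c), del => // [|q Kq qp]; first by rewrite addr_gt0.
by rewrite -[D q](subrK (D p)); apply: op_leD => //; exact: Dcont.
Qed.

Lemma unif_sdiff_lipschitz K f D : compact K -> unif_sdiff K f D ->
  exists c, exists2 del, 0 < c /\ 0 < del & forall p x y, K p ->
    enorm (x - p) < del -> enorm (y - p) < del ->
    enorm (f x - f y) <= c * enorm (x - y).
Proof.
move=> cK fD; have [c c0 Dc] := unif_sdiff_bounded cK fD.
have [del del0 fdel] := fD 1 ltr01.
exists (1 + c), del => [|p x y Kp xp yp]; first by rewrite addr_gt0.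
rewrite -[f x - f y](subrK ((x - y) *m D p)) mulrDl.
by rewrite (le_trans (enormD _ _))// lerD ?fdel// Dc.
Qed.

Lemma unif_sdiff_id K : unif_sdiff K id (fun=> 1%:M).
Proof.
move=> e e0; exists 1 => // p x y _ _ _; rewrite mulmx1 subrr enorm0.
by rewrite mulr_ge0 ?enorm_ge0 ?ltW.
Qed.

Lemma unif_sdiff_comp K f g D E : compact K -> (forall p, K p -> K (f p)) ->
  unif_sdiff K f D -> unif_sdiff K g E ->
  unif_sdiff K (g \o f) (fun p => D p *m E (f p)).
Proof.
move=> cK fK fD gE e e0.
have [c [d1 [c0 d10] fc]] := unif_sdiff_lipschitz cK fD.
have [b b0 Eb] := unif_sdiff_bounded cK gE.
have [|d2 d20 gd] := gE (e / 2 / c); first by rewrite !divr_gt0.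
have [|d3 d30 fd] := fD (e / 2 / b); first by rewrite !divr_gt0.
exists (Order.min d1 (Order.min d3 (d2 / c))).
  by rewrite !lt_min d10 d30 divr_gt0.
move=> p x y Kp; rewrite !lt_min.
move=> /and3P[xp1 xp3 xp2] /and3P[yp1 yp3 yp2].
have pp : enorm (p - p) < d1 by rewrite subrr enorm0.
have toball z : enorm (z - p) < d1 -> enorm (z - p) < d2 / c -> enorm (f z - f p) < d2.
  rewrite ltr_pdivlMr// => z1 z2.
  by apply: le_lt_trans (fc p z p Kp z1 pp) _; rewrite mulrC.
have h1 := gd (f p) (f x) (f y) (fK _ Kp) (toball x xp1 xp2) (toball y yp1 yp2).
have h2 := fd p x y Kp xp3 yp3; have h3 := fc p x y Kp xp1 yp1.
have -> : (g \o f) x - (g \o f) y - (x - y) *m (D p *m E (f p)) =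
    (g (f x) - g (f y) - (f x - f y) *m E (f p)) +
    (f x - f y - (x - y) *m D p) *m E (f p).
  by rewrite [X in _ = _ + X]mulmxBl mulmxA addrA subrK.
rewrite (le_trans (enormD _ _))// [e in leRHS]splitr mulrDl lerD//.
  apply: le_trans h1 _; rewrite -mulrA ler_wpM2l ?divr_ge0 ?(ltW e0)//.
  by rewrite mulrC ler_pdivrMr// mulrC.
apply: le_trans (Eb _ (fK _ Kp) _) _.
apply: le_trans (ler_wpM2l (ltW b0) h2) _.
by rewrite mulrA mulrCA divff ?gt_eqF// mulr1.
Qed.

(** The mean value theorem on the segment from [y] to [x], for each coordinate of
    [f] minus its linearization at a nearby base point. *)
Lemma C1_unif_sdiff U K f : open U -> K `<=` U -> compact K -> C1_on U f ->
  unif_sdiff K f (fun p => 'J f p).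
Proof.
move=> oU KU cK fC1 e e0.
pose s : R := Num.sqrt n%:R + 1.
have s0 : 0 < s by rewrite ltr_wpDl ?sqrtr_ge0.
pose Q (c : R) p := forall x y, enorm (x - p) < c^-1 -> enorm (y - p) < c^-1 ->
  enorm (f x - f y - (x - y) *m 'J f p) <= e * enorm (x - y).
suff [c c0 Qc] : exists2 c, 0 < c & forall p, K p -> Q c p.
  by exists c^-1 => [|p x y Kp]; [rewrite invr_gt0|exact: Qc].
apply: compact_uniform_bound => // [c c' p c0 cc' Qc x y xp yp|p Kp].
  have c'0 := lt_le_trans c0 cc'.
  have le_inv : c'^-1 <= c^-1 by rewrite lef_pV2.
  by apply: Qc; apply: lt_le_trans le_inv.
pose e1 := e / 2 / s.
have e10 : 0 < e1 by rewrite !divr_gt0.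
(* near [p], the Jacobian stays [e1]-close to its value at [p] *)
have [d d0 dU] : exists2 d : R, 0 < d & forall q, enorm (q - p) < d ->
    U q /\ op_le ('J f q - 'J f p) e1.
  pose m : R := Num.sqrt n%:R * n%:R + 1.
  have m0 : 0 < m by rewrite ltr_wpDl ?mulr_ge0 ?sqrtr_ge0.
  have [_ Dc] := fC1 p (KU _ Kp).
  have : nbhs p [set q | U q /\ `|Dmx f p - Dmx f q| < e1 / m].
    apply: filterI; first by apply: open_nbhs_nbhs; split => //; exact: KU.
    have em0 := divr_gt0 e10 m0.
    by have /cvgr_dist_lt/(_ _ em0) := Dc.
  move=> /nbhs_enormP[d d0 dq]; exists d => // q /dq[Uq]; rewrite distrC => Dq; split => //.
  apply: op_le_trans (op_le_entries (b := e1 / m) _) _.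
    move=> i j; apply: le_trans (ltW Dq); apply: le_trans (entry_le_norm _ j i).
    by rewrite /Dmx !mxE.
  apply: le_trans (_ : m * (e1 / m) <= _); last by rewrite mulrC divfK ?gt_eqF.
  by rewrite ler_wpM2r ?lerDl// divr_ge0// ltW.
have mvt x y : enorm (x - p) < d -> enorm (y - p) < d ->
    enorm (f x - f y - (x - y) *m 'J f p) <= e / 2 * enorm (x - y).
  move=> xp yp.
  have seg (t : R) : 0 <= t <= 1 -> enorm (y + t *: (x - y) - p) < d.
    move=> /andP[t0 t1].
    have -> : y + t *: (x - y) - p = t *: (x - p) + (1 - t) *: (y - p).
      by apply/rowP => i; rewrite !mxE; ring.
    apply: le_lt_trans (enormD _ _) _; rewrite !enormZ ger0_norm// ger0_norm ?subr_ge0//.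
    have [->|tn0] := eqVneq t 0; first by rewrite mul0r add0r subr0 mul1r.
    have tp : 0 < t by rewrite lt_def tn0.
    have := ltr_pM2l tp (enorm (x - p)) d; rewrite xp => h.
    have h2 : (1 - t) * enorm (y - p) <= (1 - t) * d.
      by rewrite ler_wpM2l ?subr_ge0// ltW.
    lra.
  have -> : e / 2 * enorm (x - y) = s * (e1 * enorm (x - y)).
    by rewrite /e1; field; rewrite gt_eqF.
  have ee := mulr_ge0 (ltW e10) (enorm_ge0 (x - y)).
  apply: le_trans (_ : Num.sqrt n%:R * (e1 * enorm (x - y)) <= _); last first.
    by apply: ler_wpM2r => //; rewrite /s lerDl.
  apply: enorm_le_coord => // j.
  pose h (t : R) := f (y + t *: (x - y)) 0 j.
  have dh t : 0 <= t <= 1 ->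
      is_derive (t : R) (1 : R) h (((x - y) *m 'J f (y + t *: (x - y))) 0 j).
    move=> t01; have [Uz _] := dU _ (seg t t01).
    have [dfz _] := fC1 _ Uz.
    have dv : derivable f (y + t *: (x - y)) (x - y) by exact: diff_derivable.
    have quot : (fun k : R => k^-1 *: ((h \o shift t) (k *: (1 : R)) - h t)) =
        (fun k => (k^-1 *: ((f \o shift (y + t *: (x - y))) (k *: (x - y))
                            - f (y + t *: (x - y)))) 0 j).
      apply/funext => k; rewrite !mxE /h /=; congr (_ * (f _ _ _ - _)).
      by rewrite [k%:A]mulr1 scalerDl addrCA.
    have lim : k^-1 *: ((h \o shift t) (k *: (1 : R)) - h t) @[k --> 0^'] -->
        ((x - y) *m 'J f (y + t *: (x - y))) 0 j.
      rewrite quot -deriveEjacobian//.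
      exact: (cvg_comp _ (fun M : 'rV[R]_n => M 0 j) dv
                (@coord_continuous _ _ _ 0 j _)).
    split; first by apply/cvg_ex; eexists; exact: lim.
    by rewrite /derive; apply: cvg_lim => //; exact: lim.
  have h_in t : t \in `]0, 1[%R ->
      is_derive (t : R) (1 : R) h (((x - y) *m 'J f (y + t *: (x - y))) 0 j).
    by rewrite in_itv /= => /andP[t0 t1]; apply: dh; rewrite !ltW.
  have h_cont : {within `[0, 1], continuous h}.
    apply: derivable_within_continuous => t; rewrite in_itv /= => t01.
    by have [] := dh t t01.
  have [c c01 hc] := MVT ltr01 h_in h_cont.
  have hE : (f x - f y - (x - y) *m 'J f p) 0 j =
      ((x - y) *m ('J f (y + c *: (x - y)) - 'J f p)) 0 j.
    rewrite mulmxBr [LHS]mxE [RHS]mxE; congr (_ + _).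
    move: hc; rewrite subr0 mulr1 => <-; rewrite /h scale1r scale0r addr0.
    by rewrite (addrC y) subrK [LHS]mxE [X in _ + X]mxE.
  rewrite hE; apply: le_trans (coord_le_enorm _ _) _.
  have [] := dU (y + c *: (x - y)); last by move=> _; apply.
  by apply: seg; move: c01; rewrite in_itv /= => /andP[c0 c1]; rewrite !ltW.
exists (2 / d), (d / 2) => [|q Kq qp x y xq yq]; first by rewrite !divr_gt0.
rewrite invf_div in xq yq.
have toball z : enorm (z - q) < d / 2 -> enorm (z - p) < d.
  by move=> zq; rewrite (le_lt_trans (enorm_triangle q _ _))//; lra.
have [//|_ Jqp] := dU q _; first by lra.
have -> : f x - f y - (x - y) *m 'J f q =
    (f x - f y - (x - y) *m 'J f p) - (x - y) *m ('J f q - 'J f p).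
  by rewrite mulmxBr opprB addrA subrK.
rewrite (le_trans (enormB _ _))// [e in leRHS]splitr mulrDl lerD ?mvt ?toball//.
apply: le_trans (Jqp _) _; rewrite ler_wpM2r ?enorm_ge0//.
rewrite /e1 ler_pdivrMr// ler_peMr ?divr_ge0 ?(ltW e0)// /s.
by rewrite lerDr sqrtr_ge0.
Qed.

End StrictDiff.

(** * Gronwall's inequality *)

Section Gronwall.
Context {R : realType} {n : nat}.
Implicit Types (w : R -> 'rV[R]_n) (L c T : R).

(** Stated with the Euclidean norm, so that linear combinations of trajectories
    are handled by the triangle inequality alone. *)
Definition right_cont w := forall e : R, 0 < e -> exists2 d : R, 0 < d &
  forall s, 0 < s -> s < d -> enorm (w s - w 0) <= e.

Lemma right_contZ w (a : R) : right_cont w -> right_cont (fun t => a *: w t).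
Proof.
move=> wc e e0; have a1 : 0 < `|a| + 1 by rewrite ltr_wpDl.
have [d d0 dw] := wc _ (divr_gt0 e0 a1); exists d => // s s0 sd.
rewrite -scalerBr enormZ; have := dw s s0 sd; rewrite ler_pdivlMr// => h.
apply: le_trans h; rewrite mulrC ler_wpM2l ?enorm_ge0//.
by rewrite lerDl.
Qed.

Lemma right_contB w w' : right_cont w -> right_cont w' ->
  right_cont (fun t => w t - w' t).
Proof.
move=> wc wc' e e0; have e2 : 0 < e / 2 by rewrite divr_gt0.
have [d d0 dw] := wc _ e2; have [d' d'0 dw'] := wc' _ e2.
exists (Order.min d d') => [|s s0]; first by rewrite lt_min d0.
rewrite lt_min => /andP[sd sd'].
have -> : w s - w' s - (w 0 - w' 0) = (w s - w 0) - (w' s - w' 0).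
  by apply/rowP => i; rewrite !mxE; ring.
rewrite (le_trans (enormB _ _))// [leRHS]splitr.
by rewrite lerD ?dw ?dw'.
Qed.

Lemma is_derive_coord w (t : R) (dw : 'rV[R]_n) i : is_derive t 1 w dw ->
  is_derive t 1 (fun t => w t 0 i) (dw 0 i).
Proof.
move=> [wt <-].
have quot : (fun k : R => k^-1 *: (((fun t => w t 0 i) \o shift t) (k *: (1 : R)) - w t 0 i)) =
    (fun k => (k^-1 *: ((w \o shift t) (k *: (1 : R)) - w t)) 0 i).
  by apply/funext => k; rewrite !mxE.
have lim : k^-1 *: (((fun t => w t 0 i) \o shift t) (k *: (1 : R)) - w t 0 i)
    @[k --> 0^'] --> ('D_1 w t) 0 i.
  rewrite quot; exact: (cvg_comp _ (fun M : 'rV[R]_n => M 0 i) wt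
                (@coord_continuous _ _ _ 0 i _)).
split; first by apply/cvg_ex; eexists; exact: lim.
by rewrite /derive; apply: cvg_lim => //; exact: lim.
Qed.

Lemma is_derive_dotv w (t : R) (dw : 'rV[R]_n) : is_derive t 1 w dw ->
  is_derive t 1 (fun t => dotv (w t) (w t)) (2 * dotv (w t) dw).
Proof.
move=> wt.
have -> : (fun t => dotv (w t) (w t)) = \sum_(i < n) (fun t => w t 0 i) ^+ 2.
  apply/funext => s; rewrite fct_sumE dotvE.
  by apply: eq_bigr => i _; rewrite -[RHS]/(_ ^+ 2) expr2.
have -> : 2 * dotv (w t) dw = \sum_(i < n) (2 *: (w t 0 i) ^+ 1) *: dw 0 i.
  rewrite dotvE mulr_sumr; apply: eq_bigr => i _.
  by rewrite expr1 /GRing.scale /= mulrA.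
apply: is_derive_sum => i.
by apply: is_deriveX; exact: is_derive_coord.
Qed.

Lemma is_derive_continuous w (t : R) (dw : 'rV[R]_n) : is_derive t 1 w dw ->
  forall e : R, 0 < e -> exists2 d : R, 0 < d &
  forall s, `|s - t| < d -> enorm (w s - w t) < e.
Proof.
move=> [/derivable1_diffP /differentiable_continuous wc _] e e0.
have : nbhs (w t) [set y | enorm (y - w t) < e] by apply/nbhs_enormP; exists e.
move=> /wc /nbhs_ballP[d /= d0 dw']; exists d => // s st; apply: dw'.
by rewrite /ball /= distrC.
Qed.

(** The squared norm [g] satisfies [g' <= (2 L + 1) g + c ^ 2], so that
    [exp (- (2 L + 1) t) g t - c ^ 2 t] is nonincreasing. *)
Lemma gronwall w (dw : R -> 'rV[R]_n) L c T : 0 <= L -> 0 <= c -> 0 < T ->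
  (forall t, 0 < t -> t <= T -> is_derive t 1 w (dw t)) -> right_cont w ->
  (forall t, 0 < t -> t < T -> enorm (dw t) <= L * enorm (w t) + c) ->
  enorm (w T) ^+ 2 <= expR ((2 * L + 1) * T) * (enorm (w 0) ^+ 2 + c ^+ 2 * T).
Proof.
move=> L0 c0 T0 w_der w_rc dw_le.
pose M := 2 * L + 1; have M0 : 0 <= M by rewrite /M; lra.
pose g t := dotv (w t) (w t).
pose G t := expR (- M * t) * g t - c ^+ 2 * t.
pose dG t := expR (- M * t) * (2 * dotv (w t) (dw t) - M * g t) - c ^+ 2.
have G_der t : 0 < t -> t <= T -> is_derive t 1 G (dG t).
  move=> t0 tT; have gt := is_derive_dotv (w_der t t0 tT).
  have lin (a : R) : is_derive t 1 (fun t => a * t) a.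
    have := is_deriveZ (f := id) a (is_derive_id t 1).
    by move=> h; apply: is_derive_eq h _; rewrite /GRing.scale /= mulr1.
  have ex : is_derive t 1 (fun t => expR (- M * t)) (expR (- M * t) * - M).
    exact: is_derive1_comp (is_derive_expR _) (lin (- M)).
  have := is_deriveB (is_deriveM ex gt) (lin (c ^+ 2)) => h.
  apply: is_derive_eq h _.
  by rewrite /dG /g /GRing.scale /=; ring.
have dG_le0 t : 0 < t -> t < T -> dG t <= 0.
  move=> t0 tT.
  have : 2 * dotv (w t) (dw t) - M * g t <= c ^+ 2.
    have h1 := dotv_le (w t) (dw t).
    have h2 := ler_wpM2l (enorm_ge0 (w t)) (dw_le t t0 tT).
    rewrite /g -enorm_sq /M; set a := enorm (w t) in h1 h2 *.
    have := sqr_ge0 (a - c); nra.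
  set b := _ - _ => bc.
  have e1 : expR (- M * t) <= 1 by rewrite expR_le1 mulNr oppr_le0 mulr_ge0// ltW.
  rewrite /dG -/b subr_le0; have [b0|b0] := leP b 0.
    by rewrite (le_trans _ (sqr_ge0 c))// mulr_ge0_le0 ?expR_ge0.
  by rewrite (le_trans _ bc)// ler_piMl// ltW.
have Geps s : 0 < s -> s < T -> G T <= G s.
  move=> s0 sT.
  have G_in t : t \in `]s, T[%R -> is_derive t 1 G (dG t).
    rewrite in_itv /= => /andP[st tT]; apply: G_der; last exact: ltW.
    exact: lt_trans st.
  have G_cont : {within `[s, T], continuous G}.
    apply: derivable_within_continuous => t; rewrite in_itv /= => /andP[st tT].
    by have [] := G_der t (lt_le_trans s0 st) tT.
  have [r] := MVT sT G_in G_cont; rewrite in_itv /= => /andP[sr rT] GG.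
  rewrite -subr_le0 GG mulr_le0_ge0 ?subr_ge0 ?(ltW sT)//.
  by apply: dG_le0 => //; exact: lt_trans sr.
have G0 : G T <= enorm (w 0) ^+ 2.
  apply/ler_addgt0Pr => e e0.
  pose a := enorm (w 0); have a0 : 0 <= a := enorm_ge0 _.
  pose eta := Order.min 1 (e / (2 * a + 1)).
  have den : 0 < 2 * a + 1 by lra.
  have eta0 : 0 < eta by rewrite lt_min ltr01 divr_gt0.
  have [d d0 dw'] := w_rc eta eta0.
  pose s := Order.min d T / 2.
  have m0 : 0 < Order.min d T by rewrite lt_min d0.
  have s0 : 0 < s by rewrite divr_gt0.
  have sm : s < Order.min d T by rewrite /s; lra.
  have /andP[sd sT] : (s < d) && (s < T) by rewrite -lt_min.
  apply: le_trans (Geps s s0 sT) _.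
  have ws : enorm (w s) <= a + eta.
    by rewrite -[w s](subrK (w 0)) (le_trans (enormD _ _))// addrC lerD2l dw'.
  have : G s <= enorm (w s) ^+ 2.
    have Ms : expR (- M * s) <= 1.
      by rewrite expR_le1 mulNr oppr_le0 mulr_ge0// ltW.
    have cs : 0 <= c ^+ 2 * s by rewrite mulr_ge0 ?sqr_ge0// ltW.
    rewrite /G /g -enorm_sq lerBlDr; apply: (@le_trans _ _ (enorm (w s) ^+ 2)).
      by rewrite ler_piMl ?sqr_ge0.
    by rewrite lerDl.
  move=> h; apply: le_trans h _.
  have : enorm (w s) ^+ 2 <= (a + eta) ^+ 2.
    by rewrite ler_pXn2r ?nnegrE ?enorm_ge0// addr_ge0// ltW.
  move=> h; apply: le_trans h _.
  have eta1 : eta <= 1 by rewrite ge_min lexx.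
  have eta2 : eta * (2 * a + 1) <= e by rewrite -ler_pdivlMr// ge_min lexx orbT.
  rewrite -/a; nra.
move: G0; rewrite /G /g -enorm_sq lerBlDr => h.
rewrite -ler_pdivrMl ?expR_gt0// -expRN.
by rewrite -mulNr.
Qed.

End Gronwall.

(** * Smooth dependence of a flow on the initial point *)

Section StrictQuotients.
Context {R : realType} {n : nat}.
Implicit Types (K : set 'rV[R]_n) (F : 'rV[R]_n -> 'rV[R]_n).

(** A criterion that mentions no derivative: difference quotients in a common
    direction [b] at nearby points agree up to [e]. Along basis vectors they have
    Cauchy limits, the rows of the Jacobian, and an increment telescopes into steps
    along the basis vectors. *)
Lemma strict_quotients_sdiff K F :
  (forall e : R, 0 < e -> exists2 del : R, 0 < del &
    forall p x y b (h k : R), K p ->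
      enorm (x - p) < del -> enorm (x + h *: b - p) < del ->
      enorm (y - p) < del -> enorm (y + k *: b - p) < del ->
      enorm (k *: (F (x + h *: b) - F x) - h *: (F (y + k *: b) - F y)) <=
      e * `|h| * `|k| * enorm b) ->
  unif_sdiff K F (fun p => 'J F p).
Proof.
move=> Fq.
pose e_ (i : 'I_n) : 'rV[R]_n := delta_mx 0 i.
have e1 i : enorm (e_ i) = 1.
  apply: (@pexpIrn _ 2) => //; rewrite ?nnegrE ?enorm_ge0//.
  by rewrite enorm_sq /dotv trmx_delta mul_delta_mx mxE !eqxx expr1n.
pose q p i (k : R) := k^-1 *: (F (p + k *: e_ i) - F p).
have q_cauchy p i : K p -> cvg (q p i k @[k --> 0^'+]).
  move=> Kp; apply: cauchy_cvg; apply: cauchy_exP => e e0.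
  have [del del0 Fdel] := Fq (e / 2) (divr_gt0 e0 (ltr0n R 2)).
  pose k0 := del / 2; have k00 : 0 < k0 by rewrite divr_gt0.
  exists (q p i k0); rewrite /fmap /= /nbhs /=.
  near=> k.
  have k_gt0 : 0 < k by near: k; exact: nbhs_right_gt.
  have kdel : k < del by near: k; exact: nbhs_right_lt.
  rewrite -ball_normE /ball_ /=; apply: le_lt_trans (norm_le_enorm _) _.
  have pp : enorm (p - p) < del by rewrite subrr enorm0.
  have pk a : 0 < a -> a < del -> enorm (p + a *: e_ i - p) < del.
    by move=> a0 ad; rewrite addrC addKr enormZ e1 mulr1 gtr0_norm.
  have k0del : k0 < del by rewrite /k0; lra.
  have := Fdel p p p (e_ i) k0 k Kp pp (pk k0 k00 k0del) pp (pk k k_gt0 kdel).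
  rewrite e1 mulr1 !gtr0_norm// => h.
  have -> : q p i k0 - q p i k = (k0 * k)^-1 *:
      (k *: (F (p + k0 *: e_ i) - F p) - k0 *: (F (p + k *: e_ i) - F p)).
    rewrite scalerBr !scalerA invfM -mulrA mulVf ?gt_eqF// mulr1.
    by rewrite mulrAC mulVf ?gt_eqF// mul1r.
  rewrite enormZ gtr0_norm ?invr_gt0 ?mulr_gt0// mulrC ltr_pdivrMr ?mulr_gt0//.
  apply: le_lt_trans h _; rewrite -mulrA ltr_pM2r ?mulr_gt0//; lra.
pose D p : 'M[R]_n := \matrix_(i, j) (lim (q p i k @[k --> 0^'+])) 0 j.
have rowD p i : K p -> q p i k @[k --> 0^'+] --> row i (D p).
  move=> Kp; have -> : row i (D p) = lim (q p i k @[k --> 0^'+]).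
    by apply/rowP => j; rewrite !mxE.
  exact: q_cauchy.
have step e : 0 < e -> exists2 del : R, 0 < del & forall p x i (h : R), K p ->
    enorm (x - p) < del -> enorm (x + h *: e_ i - p) < del ->
    enorm (F (x + h *: e_ i) - F x - h *: row i (D p)) <= e * `|h|.
  move=> e0; have [del del0 Fdel] := Fq (e / 2) (divr_gt0 e0 (ltr0n R 2)).
  exists del => // p x i h Kp xp xhp.
  have [->|h0] := eqVneq h 0.
    by rewrite !scale0r addr0 !subrr enorm0 normr0 mulr0.
  have h_gt0 : 0 < `|h| by rewrite normr_gt0.
  have : nbhs (row i (D p)) [set v | enorm (v - row i (D p)) < e / 2].
    by apply/nbhs_enormP; exists (e / 2) => //; rewrite divr_gt0.
  move=> /(rowD p i Kp); rewrite /fmap /= => qD.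
  near (0 : R)^'+ => k.
  have k_gt0 : 0 < k by near: k; exact: nbhs_right_gt.
  have kdel : k < del by near: k; exact: nbhs_right_lt.
  have qk : enorm (q p i k - row i (D p)) < e / 2 by near: k.
  have pp : enorm (p - p) < del by rewrite subrr enorm0.
  have pk : enorm (p + k *: e_ i - p) < del.
    by rewrite addrC addKr enormZ e1 mulr1 gtr0_norm.
  have := Fdel p x p (e_ i) h k Kp xp xhp pp pk.
  rewrite e1 mulr1 (gtr0_norm k_gt0) => hk.
  have -> : F (x + h *: e_ i) - F x - h *: row i (D p) =
    k^-1 *: (k *: (F (x + h *: e_ i) - F x) - h *: (F (p + k *: e_ i) - F p)) +
    h *: (q p i k - row i (D p)).
    rewrite /q; set r := row i _; apply/rowP => j; rewrite !mxE.
    by field; rewrite gt_eqF.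
  apply: le_trans (enormD _ _) _; rewrite !enormZ.
  have -> : e * `|h| = e / 2 * `|h| + `|h| * (e / 2) by field.
  apply: lerD; last by rewrite ler_wpM2l// ltW.
  rewrite gtr0_norm ?invr_gt0// mulrC ler_pdivrMr//.
have sd : unif_sdiff K F D.
  move=> e e0; have n1 : 0 < n%:R + 1 :> R by rewrite ltr_wpDl.
  have [del del0 stepd] := step (e / (n%:R + 1)) (divr_gt0 e0 n1).
  exists (del / 3) => [|p x y Kp xp yp]; first by rewrite divr_gt0.
  pose v := x - y.
  (* [z m] interpolates from [y] to [x] one coordinate at a time *)
  pose vm m : 'rV[R]_n := \row_(i < n) (if (i < m)%N then v 0 i else 0).
  pose z m := y + vm m.
  have vm_le m : enorm (vm m) <= enorm v.
    rewrite -(@ler_pXn2r _ 2) ?nnegrE ?enorm_ge0// !enorm_sq !dotvE ler_sum// => i _.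
    by rewrite mxE; case: ifP => // _; rewrite mul0r -expr2 sqr_ge0.
  have v_lt : enorm v < del / 3 + del / 3.
    rewrite /v (le_lt_trans (enorm_triangle p _ _))// ltrD// enormC.
    by [].
  have zp m : enorm (z m - p) < del.
    rewrite /z addrAC (le_lt_trans (enormD _ _))//.
    by have := vm_le m; lra.
  have z_step (i : 'I_n) : z i.+1 = z i + v 0 i *: e_ i.
    apply/rowP => j; rewrite !mxE -addrA; congr (_ + _).
    rewrite ltnS leq_eqVlt eqxx /=.
    case: (ltngtP j i) => [ji|ij|/val_inj ->].
    - by rewrite -val_eqE /= (ltn_eqF ji) mulr0 addr0.
    - by rewrite -val_eqE /= (gtn_eqF ij) mulr0 addr0.
    - by rewrite eqxx mulr1 add0r.
  have zn : z n = x.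
    rewrite /z (_ : vm n = v) ?/v ?[y + _]addrC ?subrK//.
    by apply/rowP => i; rewrite mxE ltn_ord.
  have z0 : z 0%N = y by rewrite /z (_ : vm 0%N = 0) ?addr0//; apply/rowP => i; rewrite !mxE.
  have -> : F x - F y - v *m D p =
      \sum_(i < n) (F (z i.+1) - F (z i) - v 0 i *: row i (D p)).
    rewrite sumrB mulmx_sum_row; congr (_ - _).
    by rewrite -(big_mkord xpredT (fun i => F (z i.+1) - F (z i))) telescope_sumr// zn z0.
  apply: le_trans (enorm_sum _ _ _) _.
  apply: (@le_trans _ _ (\sum_(i < n) e / (n%:R + 1) * enorm v)).
    apply: ler_sum => i _; rewrite z_step.
    apply: le_trans (stepd p (z i) i (v 0 i) Kp (zp i) _) _.
      by rewrite -z_step.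
    by rewrite ler_wpM2l ?coord_le_enorm// divr_ge0// ltW.
  rewrite sumr_const card_ord -[leLHS]mulr_natl mulrA ler_wpM2r ?enorm_ge0//.
  by rewrite mulrA ler_pdivrMr// mulrC ler_wpM2l ?(ltW e0)// lerDl.
move=> e e0; have [del del0 sdel] := sd e e0; exists del => // p x y Kp.
by rewrite (unif_sdiff_jacobian sd Kp); exact: sdel.
Unshelve. all: by end_near. Qed.

End StrictQuotients.

Section Flow.
Context {R : realType} {n : nat}.
Variables (U K : set 'rV[R]_n) (f : 'rV[R]_n -> 'rV[R]_n)
  (phi : R -> 'rV[R]_n -> 'rV[R]_n).
Hypotheses (U_open : open U) (f_C1 : C1_on U f) (phi_flow : is_semiflow U f phi)
  (K_compact : compact K) (K_sub_U : K `<=` U)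
  (K_inv : forall t u, 0 <= t -> K u -> K (phi t u)).

Lemma flow0 u : U u -> phi 0 u = u.
Proof. by move=> /phi_flow[]. Qed.

Lemma flow_in_U t u : U u -> 0 <= t -> U (phi t u).
Proof. by move=> /phi_flow[_ sol _] t0; have [] := sol t t0 (ltry _). Qed.

Lemma flow_derive (t : R) u : U u -> 0 < t -> is_derive t (1 : R) (phi ^~ u) (f (phi t u)).
Proof.
move=> /phi_flow[_ sol _] t0; have [_ + _] := sol t (ltW t0) (ltry _); exact.
Qed.

Lemma flow_right_cont u : U u -> right_cont (phi ^~ u).
Proof.
move=> /phi_flow[_ sol _]; have [_ _ /(_ erefl) h0] := sol 0 (lexx _) (ltry _).
move=> e e0; pose v := f (phi 0 u).
have v1 : 0 < enorm v + 1 by rewrite ltr_wpDl ?enorm_ge0.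
have : nbhs v [set y | enorm (y - v) < 1] by apply/nbhs_enormP; exists 1.
move=> /h0; rewrite /fmap /= => /nbhs_ballP[d /= d0 dv].
exists (Order.min d (e / (enorm v + 1))) => [|s s0].
  by rewrite lt_min d0 divr_gt0.
rewrite lt_min ltr_pdivlMr// => /andP[sd se].
have : enorm (s^-1 *: (phi s u - phi 0 u) - v) < 1.
  by apply: dv => //; rewrite /ball /= sub0r normrN gtr0_norm.
set w := _ - phi 0 u => h.
have : enorm (s^-1 *: w) <= enorm v + 1.
  rewrite -[_ *: w](subrK v) addrC (le_trans (enormD _ _))// lerD2l.
  exact: ltW.
rewrite enormZ gtr0_norm ?invr_gt0// mulrC ler_pdivrMr// => h'.
by rewrite (le_trans h')// mulrC ltW.
Qed.

Lemma flow_semigroup s t u : U u -> 0 <= s -> 0 <= t ->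
  phi (t + s) u = phi t (phi s u).
Proof.
move=> Uu; rewrite le_eqVlt => /orP[/eqP <- t0|s0 t0]; first by rewrite addr0 flow0.
have Us : U (phi s u) by apply: flow_in_U => //; exact: ltW.
have [_ _ uniq] := phi_flow Us.
apply: (uniq +oo%E (fun t => phi (t + s) u)) => //; last 2 first.
- by rewrite add0r.
- exact: ltry.
move=> r r0 _; split.
- by apply: flow_in_U => //; rewrite addr_ge0// ltW.
- move=> r_gt0; have [der val] := flow_derive Uu (addr_gt0 r_gt0 s0).
  have quot : (fun h : R => h^-1 *: (((fun t => phi (t + s) u) \o shift r) (h *: (1 : R))
        - phi (r + s) u)) =
      (fun h => h^-1 *: (((phi ^~ u) \o shift (r + s)) (h *: (1 : R)) - phi (r + s) u)).
    by apply/funext => h /=; rewrite addrA.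
  by split; rewrite ?/derivable ?/derive quot.
- move=> _; rewrite add0r; have [der val] := flow_derive Uu s0.
  rewrite -val /derive; have quot : (fun h : R => h^-1 *: (phi (h + s) u - phi s u)) =
      (fun h => h^-1 *: (((phi ^~ u) \o shift s) (h *: (1 : R)) - phi s u)).
    by apply/funext => h /=; rewrite [h%:A]mulr1.
  by rewrite quot; apply: cvg_dnbhs_at_right; exact: der.
Qed.

Let f_sd : unif_sdiff K f (fun p => 'J f p).
Proof. exact: C1_unif_sdiff U_open K_sub_U K_compact f_C1. Qed.

Lemma compact_sub_open_ball : exists2 r : R, 0 < r &
  forall u x, K u -> enorm (x - u) < r -> U x.
Proof.
have [c c0 Uc] : exists2 c : R, 0 < c & forall u, K u ->
    forall x, enorm (x - u) < c^-1 -> U x.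
  apply: compact_uniform_bound => // [c c' u c0 cc' Uc x xu|u Ku].
    by apply: Uc; apply: lt_le_trans xu _; rewrite lef_pV2 ?posrE// (lt_le_trans c0).
  have : nbhs u U by apply: open_nbhs_nbhs; split => //; exact: K_sub_U.
  move=> /nbhs_enormP[e e0 eU]; exists (2 / e), (e / 2) => [|v Kv vu x].
    by rewrite !divr_gt0.
  rewrite invf_div => xv; apply: eU.
  by rewrite (le_lt_trans (enorm_triangle v _ _))//; lra.
by exists c^-1 => [|u x Ku]; [rewrite invr_gt0|exact: Uc].
Qed.

(** Trajectories starting near [K] cannot leave a given tube before time [T]: up to
    the first exit time, Gronwall's inequality keeps them well inside it. *)
Lemma flow_tube (T r : R) : 0 < T -> 0 < r -> exists2 del : R, 0 < del &
  forall u x, K u -> enorm (x - u) < del -> U x /\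
    forall t, 0 <= t -> t <= T -> enorm (phi t x - phi t u) < r.
Proof.
move=> T0 r0.
have [L [r1 [L0 r10] fL]] := unif_sdiff_lipschitz K_compact f_sd.
have [rU rU0 rUU] := compact_sub_open_ball.
pose r' := Order.min r r1; have r'0 : 0 < r' by rewrite lt_min r0.
have rr : r' <= r by rewrite ge_min lexx.
have rr1 : r' <= r1 by rewrite ge_min lexx orbT.
pose M := 2 * L + 1; have M0 : 0 < M by rewrite /M; lra.
pose E := expR (M * T).
have E1 : 1 <= E by rewrite -expR0 ler_expR mulr_ge0// ltW.
have E0 : 0 < E by exact: expR_gt0.
exists (Order.min rU (r' / 2 / E)); first by rewrite lt_min rU0 !divr_gt0.
move=> u x Ku; rewrite lt_min => /andP[xrU xE].
have Uu := K_sub_U Ku; have Ux := rUU u x Ku xrU; split => // t1 t10 t1T.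
pose w t := phi t x - phi t u.
have w0 : enorm (w 0) < r' / 2 / E by rewrite /w !flow0.
have w0r : enorm (w 0) < r' / 2.
  by apply: lt_le_trans w0 _; rewrite ler_pdivrMr// ler_peMr// divr_ge0// ltW.
have w_rc : right_cont w by apply: right_contB; exact: flow_right_cont.
have w_der t : 0 < t -> is_derive (t : R) (1 : R) w (f (phi t x) - f (phi t u)).
  by move=> t0; apply: is_deriveB; exact: flow_derive.
have inside t : 0 < t -> t <= T -> (forall s, 0 < s -> s < t -> enorm (w s) < r') ->
    enorm (w t) < r' / 2.
  move=> t0 tT wr.
  have : enorm (w t) ^+ 2 <= expR (M * t) * (enorm (w 0) ^+ 2 + 0 ^+ 2 * t).
    apply: (gronwall (dw := fun t => f (phi t x) - f (phi t u)) (ltW L0)) => //.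
      by move=> s s0 _; exact: w_der.
    move=> s s0 st; rewrite addr0; apply: (fL (phi s u)).
    - by apply: K_inv => //; exact: ltW.
    - by apply: lt_le_trans rr1; exact: wr.
    - by rewrite subrr enorm0.
  rewrite expr0n mul0r addr0 => h.
  have h' : enorm (w t) ^+ 2 <= (E * enorm (w 0)) ^+ 2.
    apply: le_trans h _; rewrite exprMn ler_wpM2r ?sqr_ge0//.
    apply: (@le_trans _ _ E); first by rewrite ler_expR ler_wpM2l// ltW.
    by rewrite expr2 ler_peMr// ltW.
  move: h'; rewrite ler_pXn2r ?nnegrE ?mulr_ge0 ?enorm_ge0 ?(ltW E0)// => h'.
  by apply: le_lt_trans h' _; rewrite mulrC -ltr_pdivlMr.
suff S0 : forall t, 0 <= t -> t <= T -> enorm (w t) < r'.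
  exact: lt_le_trans (S0 t1 t10 t1T) rr.
apply: contrapT => /existsNP[t2 /not_implyP[t20 /not_implyP[t2T /negP]]].
rewrite -leNgt => wt2.
pose S := [set t | [/\ 0 <= t, t <= T & r' <= enorm (w t)]].
have St2 : S t2 by [].
have S_ne : S !=set0 by exists t2.
have S_lb0 : lbound S 0 by move=> t [].
have S_lb : has_lbound S by exists 0.
have infS : has_inf S by [].
pose tau := inf S.
have tau0 : 0 <= tau by exact: lb_le_inf.
have tauT : tau <= T by apply: le_trans t2T; exact: ge_inf.
have before s : 0 <= s -> s < tau -> enorm (w s) < r'.
  move=> s0 stau; rewrite ltNge; apply/negP => wsr.
  have : tau <= s.
    apply: ge_inf => //.
    by split => //; apply: le_trans tauT; exact: ltW.
  by rewrite leNgt stau.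
have [e e0 after] : exists2 e : R, 0 < e & forall s, tau <= s -> s < tau + e -> enorm (w s) < r'.
  move: tau0; rewrite le_eqVlt => /orP[/eqP tau0|tau0].
    have [e e0 we] := w_rc (r' / 2) (divr_gt0 r'0 (ltr0n R 2)).
    exists e => // s; rewrite -tau0 add0r le_eqVlt => /orP[/eqP <- _|s0 se].
      by lra.
    have := we s s0 se; rewrite -[w s in X in _ -> X](subrK (w 0)) => h.
    by apply: le_lt_trans (enormD _ _) _; lra.
  have wtau : enorm (w tau) < r' / 2.
    by apply: inside => // s s0 st; apply: before => //; exact: ltW.
  have [e e0 we] := is_derive_continuous (w_der tau tau0) (divr_gt0 r'0 (ltr0n R 2)).
  exists e => // s taus se; have := we s; rewrite ger0_norm ?subr_ge0// ltrBlDl.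
  move=> /(_ se) h; rewrite -[w s](subrK (w tau)).
  by apply: le_lt_trans (enormD _ _) _; lra.
have [s [s0 sT ws] se] := inf_adherent e0 infS.
have taus : tau <= s by exact: ge_inf.
by have := after s taus se; rewrite ltNge ws.
Qed.

(** Trajectories from points near [K] stay in a neighbourhood of the invariant
    compact set [K], where [f] has one Lipschitz constant. *)
Lemma flow_lipschitz (T : R) : 0 < T -> exists E, exists2 del, 1 <= E /\ 0 < del &
  forall u x y t, K u -> enorm (x - u) < del -> enorm (y - u) < del ->
    0 <= t -> t <= T -> enorm (phi t x - phi t y) <= E * enorm (x - y).
Proof.
move=> T0.
have [L [r1 [L0 r10] fL]] := unif_sdiff_lipschitz K_compact f_sd.
have [del del0 tube] := flow_tube T0 r10.
pose M := 2 * L + 1; have M0 : 0 < M by rewrite /M; lra.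
pose E := expR (M * T).
have E1 : 1 <= E by rewrite -expR0 ler_expR mulr_ge0// ltW.
have E0 : 0 < E by exact: expR_gt0.
exists E, del => // u x y t Ku xu yu t0 tT.
have [Ux xtube] := tube u x Ku xu; have [Uy ytube] := tube u y Ku yu.
move: t0; rewrite le_eqVlt => /orP[/eqP <-|t0].
  by rewrite !flow0// ler_peMl// enorm_ge0.
pose w t := phi t x - phi t y.
have w_rc : right_cont w by apply: right_contB; exact: flow_right_cont.
have : enorm (w t) ^+ 2 <= expR (M * t) * (enorm (w 0) ^+ 2 + 0 ^+ 2 * t).
  apply: (gronwall (dw := fun t => f (phi t x) - f (phi t y)) (ltW L0)) => //.
    by move=> s s0 _; apply: is_deriveB; exact: flow_derive.
  move=> s s0 st; rewrite addr0; have sT := ltW (lt_le_trans st tT).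
  apply: (fL (phi s u)); first by apply: K_inv => //; exact: ltW.
    exact: xtube (ltW s0) sT.
  exact: ytube (ltW s0) sT.
rewrite expr0n mul0r addr0 /w !flow0// => h.
rewrite -(@ler_pXn2r _ 2) ?nnegrE ?mulr_ge0 ?enorm_ge0 ?(ltW E0)//.
apply: le_trans h _; rewrite exprMn ler_wpM2r ?sqr_ge0//.
apply: (@le_trans _ _ E); first by rewrite ler_expR ler_wpM2l// ltW.
by rewrite expr2 ler_peMr// ltW.
Qed.

(** The difference of two rescaled increments of the flow satisfies, up to a
    small error, the linearized equation along a trajectory in [K], with zero
    initial value. *)
Lemma flow_unif_sdiff (T : R) : 0 <= T -> unif_sdiff K (phi T) (fun p => 'J (phi T) p).
Proof.
rewrite le_eqVlt => /orP[/eqP <-|T0].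
  have [rU rU0 rUU] := compact_sub_open_ball.
  have sd : unif_sdiff K (phi 0) (fun=> 1%:M).
    move=> e e0; exists rU => // p x y Kp xp yp.
    rewrite (flow0 (rUU p x Kp xp)) (flow0 (rUU p y Kp yp)) mulmx1 subrr enorm0.
    by rewrite mulr_ge0 ?enorm_ge0 ?(ltW e0).
  move=> e e0; have [del del0 sdel] := sd e e0; exists del => // p x y Kp.
  by rewrite (unif_sdiff_jacobian sd Kp); exact: sdel.
apply: strict_quotients_sdiff => e e0.
have [E [d1 [E1 d10] lip]] := flow_lipschitz T0.
have [B B0 fB] := unif_sdiff_bounded K_compact f_sd.
have E0 : 0 < E by exact: lt_le_trans E1.
pose M := 2 * B + 1; pose G := expR (M * T) * T.
have G0 : 0 < G by rewrite mulr_gt0// expR_gt0.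
pose eta := e / (2 * E * (G + 1)).
have den : 0 < 2 * E * (G + 1) by rewrite !mulr_gt0// addr_gt0.
have eta0 : 0 < eta by rewrite divr_gt0.
have [d2 d20 fd] := f_sd eta0.
have [d3 d30 tube] := flow_tube T0 d20.
exists (Order.min d1 d3); first by rewrite lt_min d10.
move=> u x y b h k Ku; rewrite !lt_min.
move=> /andP[x1 x3] /andP[xh1 xh3] /andP[y1 y3] /andP[yk1 yk3].
have [Ux xt] := tube u _ Ku x3; have [Uxh xht] := tube u _ Ku xh3.
have [Uy yt] := tube u _ Ku y3; have [Uyk ykt] := tube u _ Ku yk3.
pose w t := k *: (phi t (x + h *: b) - phi t x) - h *: (phi t (y + k *: b) - phi t y).
pose dw t := k *: (f (phi t (x + h *: b)) - f (phi t x)) -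
  h *: (f (phi t (y + k *: b)) - f (phi t y)).
have w_rc : right_cont w.
  by apply: right_contB; apply: right_contZ; apply: right_contB; exact: flow_right_cont.
have w_der t : 0 < t -> is_derive (t : R) (1 : R) w (dw t).
  move=> t0; apply: is_deriveB; apply: is_deriveZ; apply: is_deriveB; exact: flow_derive.
pose N := `|h| * `|k| * enorm b.
have N0 : 0 <= N by rewrite /N !mulr_ge0 ?normr_ge0 ?enorm_ge0.
pose c := 2 * eta * E * N.
have c0 : 0 <= c.
  by apply: mulr_ge0 => //; apply: mulr_ge0 (ltW E0); apply: mulr_ge0 (ltW eta0).
have dw_le t : 0 < t -> t < T -> enorm (dw t) <= B * enorm (w t) + c.
  move=> t0 tT; have [t0' tT'] := (ltW t0, ltW tT).
  have Kt : K (phi t u) by exact: K_inv.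
  have e1 := fd _ _ _ Kt (xht t t0' tT') (xt t t0' tT').
  have e2 := fd _ _ _ Kt (ykt t t0' tT') (yt t t0' tT').
  have l1 := lip u _ _ t Ku xh1 x1 t0' tT'.
  have l2 := lip u _ _ t Ku yk1 y1 t0' tT'.
  rewrite (addrC x) addrK enormZ in l1; rewrite (addrC y) addrK enormZ in l2.
  rewrite (addrC (h *: b)) in l1; rewrite (addrC (k *: b)) in l2.
  set X1 := phi t (x + _) in e1 l1; set X2 := phi t x in e1 l1.
  set Y1 := phi t (y + _) in e2 l2; set Y2 := phi t y in e2 l2.
  have -> : dw t = w t *m 'J f (phi t u) +
      (k *: (f X1 - f X2 - (X1 - X2) *m 'J f (phi t u)) -
       h *: (f Y1 - f Y2 - (Y1 - Y2) *m 'J f (phi t u))).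
    rewrite /dw /w -/X1 -/X2 -/Y1 -/Y2 [in RHS]mulmxBl -!scalemxAl.
    set P1 := (X1 - X2) *m _; set P2 := (Y1 - Y2) *m _.
    by apply/rowP => i; rewrite !mxE; ring.
  apply: le_trans (enormD _ _) _; apply: lerD; first exact: fB.
  apply: le_trans (enormB _ _) _; rewrite !enormZ.
  have -> : c = `|k| * (eta * (E * (`|h| * enorm b))) + `|h| * (eta * (E * (`|k| * enorm b))).
    by rewrite /c /N; ring.
  by apply: lerD; apply: ler_wpM2l => //;
    [apply: le_trans e1 _|apply: le_trans e2 _]; apply: ler_wpM2l => //; exact: ltW.
have := gronwall (ltW B0) c0 T0 (fun t t0 _ => w_der t t0) w_rc dw_le.
have -> : enorm (w 0) = 0.
  rewrite /w !flow0// (addrC x) (addrC y) !addrK !scalerA (mulrC k) subrr.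
  by rewrite enorm0.
rewrite expr0n add0r => hw.
have -> : e * `|h| * `|k| * enorm b = e * N by rewrite /N; ring.
have eN0 : 0 <= e * N by exact: mulr_ge0 (ltW e0) N0.
rewrite -(@ler_pXn2r _ 2) ?nnegrE ?enorm_ge0//.
apply: le_trans hw _.
have -> : expR ((2 * B + 1) * T) * (c ^+ 2 * T) = G * c ^+ 2 by rewrite /G /M; ring.
have -> : c = e * N / (G + 1).
  by rewrite /c /eta; field; rewrite !gt_eqF// addr_gt0.
rewrite exprMn mulrCA -[leRHS]mulr1 ler_wpM2l ?sqr_ge0//.
rewrite exprVn ler_pdivrMr ?exprn_gt0 ?addr_gt0// mul1r; nra.
Qed.

Lemma flow_jacobian_bounded (T : R) : 0 < T -> exists2 C : R, 0 < C &
  forall t p, 0 <= t -> t <= T -> K p -> op_le ('J (phi t) p) C.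
Proof.
move=> T0; have [E [d1 [E1 d10] lip]] := flow_lipschitz T0.
have E0 : 0 < E by exact: lt_le_trans E1.
exists (E + 1) => [|t p t0 tT Kp v]; first by rewrite addr_gt0.
have [->|v0] := eqVneq v 0; first by rewrite mul0mx enorm0 mulr0.
have vp : 0 < enorm v by rewrite enorm_gt0.
have [d2 d20 sd] := flow_unif_sdiff t0 ltr01.
pose m := Order.min d1 d2; have m0 : 0 < m by rewrite lt_min d10.
pose a := m / 2 / enorm v; pose w := a *: v.
have a0 : 0 < a by rewrite !divr_gt0.
have ew : enorm w < m by rewrite enormZ gtr0_norm// divfK ?gt_eqF//; lra.
have [w1 w2] : enorm w < d1 /\ enorm w < d2 by apply/andP; rewrite -lt_min.
have e1 d : enorm w < d -> enorm (p + w - p) < d by rewrite addrC addKr.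
have e2 d : 0 < d -> enorm (p - p) < d by rewrite subrr enorm0.
have h1 := lip p _ _ t Kp (e1 _ w1) (e2 _ d10) t0 tT.
have h2 := sd p _ _ Kp (e1 _ w2) (e2 _ d20).
rewrite addrAC subrr add0r in h1 h2.
have : enorm (w *m 'J (phi t) p) <= (E + 1) * enorm w.
  set F := phi t _ - phi t p in h1 h2.
  have -> : w *m 'J (phi t) p = F - (F - w *m 'J (phi t) p).
    by rewrite opprB addrC subrK.
  by apply: le_trans (enormB _ _) _; rewrite mulrDl; apply: lerD.
by rewrite /w -scalemxAl !enormZ mulrCA ler_pM2l// gtr0_norm.
Qed.

End Flow.

(** * The derivative cocycle over the compact set *)

Section Times.
Context {R : realType}.
Implicit Types (tau : time_kind) (s t : R).

Lemma times_ge0 tau t : times tau t -> 0 <= t.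
Proof. by case: tau => //= -[k _ <-]. Qed.

Lemma timesD tau s t : times tau s -> times tau t -> times tau (s + t).
Proof.
case: tau => /=; first exact: addr_ge0.
by move=> [k _ <-] [l _ <-]; exists (k + l)%N => //; rewrite natrD.
Qed.

Lemma timesB tau s t : times tau s -> times tau t -> s <= t -> times tau (t - s).
Proof.
case: tau => /=; first by rewrite subr_ge0.
by move=> [k _ <-] [l _ <-]; rewrite ler_nat => kl; exists (l - k)%N => //; rewrite natrB.
Qed.

Lemma times_nat tau (k : nat) : times tau (k%:R : R).
Proof. by case: tau => /=; [exact: ler0n|exists k]. Qed.

Lemma times_gt tau t : exists2 s, times tau s & t < s.
Proof.
exists (Num.truncn `|t|).+1%:R; first exact: times_nat.
by apply: le_lt_trans (ler_norm t) _; exact: truncnS_gt.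
Qed.

End Times.

Section Cocycle.
Context {R : realType} {n : nat}.

Record smooth_cocycle (tau : time_kind) (K : set 'rV[R]_n)
    (phi : R -> 'rV[R]_n -> 'rV[R]_n) : Prop := SmoothCocycle {
  cocycle_invariant : forall t u, times tau t -> K u -> K (phi t u);
  cocycle_sdiff : forall t, times tau t -> unif_sdiff K (phi t) (fun p => 'J (phi t) p);
  cocycle_mul : forall s t u, times tau s -> times tau t -> K u ->
    'J (phi (t + s)) u = 'J (phi s) u *m 'J (phi t) (phi s u);
  cocycle_bounded : forall T, exists2 C, 0 < C & forall t p,
    times tau t -> t <= T -> K p -> op_le ('J (phi t) p) C }.

Lemma unif_sdiff_eq_open (U K : set 'rV[R]_n) (F G : 'rV[R]_n -> 'rV[R]_n) D :
  open U -> K `<=` U -> compact K -> {in U, F =1 G} ->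
  unif_sdiff K F D -> unif_sdiff K G D.
Proof.
move=> oU KU cK FG sd e e0; have [d d0 Fd] := sd e e0.
have [r r0 rU] := compact_sub_open_ball oU cK KU.
exists (Order.min d r) => [|p x y Kp]; first by rewrite lt_min d0.
rewrite !lt_min => /andP[xd xr] /andP[yd yr].
rewrite -!FG ?inE; [exact: Fd|exact: rU yr|exact: rU xr].
Qed.

Lemma unif_sdiff_to_jacobian (K : set 'rV[R]_n) (F : 'rV[R]_n -> 'rV[R]_n) D :
  unif_sdiff K F D -> unif_sdiff K F (fun p => 'J F p).
Proof.
move=> sd e e0; have [del del0 sdel] := sd e e0; exists del => // p x y Kp.
by rewrite (unif_sdiff_jacobian sd Kp); exact: sdel.
Qed.

(** For continuous time these facts come from the estimates on the flow, for
    discrete time from composing [C1] maps. *)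
Lemma smooth_system_cocycle (tau : time_kind) (U K : set 'rV[R]_n)
    (phi : R -> 'rV[R]_n -> 'rV[R]_n) :
  open U -> smooth_dynamical_system tau U phi -> compact K -> K `<=` U ->
  (forall t u, times tau t -> K u -> K (phi t u)) ->
  smooth_cocycle tau K phi.
Proof.
move=> oU ds cK KU K_inv.
(* the cocycle identity is the chain rule for [phi (t + s) = phi t \o phi s] *)
have chain : (forall s t u, times tau s -> times tau t -> U u ->
      phi (t + s) u = phi t (phi s u)) ->
    (forall t, times tau t -> unif_sdiff K (phi t) (fun p => 'J (phi t) p)) ->
    forall s t u, times tau s -> times tau t -> K u ->
    'J (phi (t + s)) u = 'J (phi s) u *m 'J (phi t) (phi s u).
  move=> semi sd s t u Ts Tt Ku.
  have comp := unif_sdiff_comp cK (fun p => K_inv s p Ts) (sd s Ts) (sd t Tt).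
  have comp' : unif_sdiff K (phi (t + s))
      (fun p => 'J (phi s) p *m 'J (phi t) (phi s p)).
    apply: (unif_sdiff_eq_open oU KU cK _ comp) => // v; rewrite inE => Uv /=.
    by rewrite semi.
  exact: (unif_sdiff_jacobian comp' Ku).
case: tau ds K_inv chain => /=.
  move=> [f f_C1 flow] K_inv chain.
  have sd t : 0 <= t -> unif_sdiff K (phi t) (fun p => 'J (phi t) p).
    by move=> t0; apply: (flow_unif_sdiff oU f_C1 flow cK KU) => // s u; exact: K_inv.
  split => //.
  - apply: chain => // s t u s0 t0 Uu; exact: flow_semigroup flow _ _ _ Uu s0 t0.
  - move=> T; have T1 : 0 < `|T| + 1 by rewrite ltr_wpDl.
    have [C C0 bd] := flow_jacobian_bounded oU f_C1 flow cK KU (fun s u => K_inv s u) T1.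
    exists C => // t p t0 tT; apply: bd => //.
    by apply: le_trans tT _; rewrite (le_trans (ler_norm T))// lerDl.
move=> [g [g_C1 gU phiE]] K_inv chain.
have iterU k u : U u -> U (iter k g u) by move=> Uu; elim: k => //= k; exact: gU.
have gK u : K u -> K (g u).
  move=> Ku; have := K_inv 1%:R u; rewrite phiE; last exact: KU.
  by apply => //; exists 1%N.
have g_sd := C1_unif_sdiff oU KU cK g_C1.
have sd_nat (k : nat) : unif_sdiff K (phi k%:R) (fun p => 'J (phi k%:R) p).
  elim: k => [|k IH].
    apply: (@unif_sdiff_to_jacobian _ _ (fun=> 1%:M)).
    apply: (unif_sdiff_eq_open oU KU cK _ (unif_sdiff_id K)) => // v; rewrite inE => Uv.
    by rewrite (phiE 0%N).
  apply: unif_sdiff_to_jacobian.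
  have kK p : K p -> K (phi k%:R p) by apply: K_inv; exists k.
  apply: (unif_sdiff_eq_open oU KU cK _ (unif_sdiff_comp cK kK IH g_sd)) => // v; rewrite inE => Uv.
  by rewrite /= !phiE.
have sd t : range (fun k : nat => k%:R) t -> unif_sdiff K (phi t) (fun p => 'J (phi t) p).
  move=> [k _ <-]; exact: sd_nat.
have mul : forall s t u, range (fun k : nat => k%:R) s ->
    range (fun k : nat => k%:R) t -> K u ->
    'J (phi (t + s)) u = 'J (phi s) u *m 'J (phi t) (phi s u).
  apply: chain => // _ _ u [k _ <-] [l _ <-] Uu.
  by rewrite -natrD !phiE ?iterD//; exact: iterU.
split => //.
have T1 : range (fun k : nat => k%:R) (1%:R : R) by exists 1%N.
have [c c0 bd] := unif_sdiff_bounded cK (sd _ T1).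
pose C := c + 1; have C1 : 1 <= C by rewrite lerDr ltW.
have C0 : 0 < C by exact: lt_le_trans C1.
have bdk (k : nat) p : K p -> op_le ('J (phi k%:R) p) (C ^+ k).
  elim: k p => [|k IH] p Kp v.
    have -> : 'J (phi 0%:R) p = 1%:M.
      have id_sd : unif_sdiff K (phi 0%:R) (fun=> 1%:M).
        apply: (unif_sdiff_eq_open oU KU cK _ (unif_sdiff_id K)) => // w; rewrite inE => Uw.
        by rewrite (phiE 0%N).
      exact: unif_sdiff_jacobian id_sd Kp.
    by rewrite mulmx1 expr0 mul1r.
  have Tk : range (fun k : nat => k%:R) (k%:R : R) by exists k.
  have := mul 1%:R k%:R p T1 Tk Kp; rewrite -natrD addn1 => ->.
  rewrite mulmxA; apply: le_trans (IH _ (K_inv _ _ T1 Kp) _) _.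
  rewrite exprSr -mulrA ler_wpM2l ?exprn_ge0 ?(ltW C0)//.
  apply: le_trans (bd p Kp v) _; rewrite ler_wpM2r ?enorm_ge0// lerDl.
  exact: ler01.
move=> T; exists (C ^+ Num.truncn `|T|) => [|_ p [k _ <-] kT Kp].
  by rewrite exprn_gt0.
apply: op_le_trans (bdk k p Kp) _; apply: ler_weXn2l => //.
have : k%:R <= `|T| by apply: le_trans kT (ler_norm T).
by move=> /le_truncn; rewrite natrK.
Qed.

End Cocycle.

(** * Growth rates of the singular value function *)

Lemma ln_le_mul (R : realType) (a b c : R) :
  0 < a -> 0 < b -> 0 < c -> c <= a * b -> ln c <= ln a + ln b.
Proof. by move=> a0 b0 c0 cab; rewrite -lnM ?posrE// ler_ln ?posrE ?mulr_gt0. Qed.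

Section OmegaEstimates.
Context {R : realType} {n : nat}.

Lemma op_le_sv (A : 'M[R]_n) c i : 0 <= c -> op_le A^T c -> (singular_values A)`_i <= c.
Proof. by move=> c0 Ac; apply: sv_le. Qed.

Lemma ln_omega_le (A : 'M[R]_n) d c : 0 <= d <= n%:R -> 1 <= c -> sv_positive A ->
  op_le A^T c -> ln (omega d A) <= n%:R * ln c.
Proof.
move=> /[dup] dn /andP[d0 dn'] c1 Apos Ac; have c0 := lt_le_trans ltr01 c1.
apply: (@le_trans _ _ (d * ln c)); last by rewrite ler_wpM2r ?ln_ge0.
rewrite -ln_powR ler_ln ?posrE ?powR_gt0 ?omega_gt0//.
by apply: omega_le_exp => // i; apply: op_le_sv => //; exact: ltW.
Qed.

(** Upper semicontinuity, from [A = (A A0^-1) A0] and Horn's inequality: the first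
    factor is close to the identity. *)
Lemma ln_omega_perturb (A A0 : 'M[R]_n) d e C : 0 <= d <= n%:R ->
  sv_positive A -> sv_positive A0 -> 0 <= e -> 0 <= C ->
  op_le (invmx A0)^T C -> op_le (A^T - A0^T) e ->
  ln (omega d A) <= n%:R * (e * C) + ln (omega d A0).
Proof.
move=> dn Apos A0pos e0 C0 invC AA0.
have A0u := sv_positive_unit A0pos.
have AE : A = (A *m invmx A0) *m A0 by rewrite mulmxKV.
have B_le : op_le (A *m invmx A0)^T (1 + e * C).
  move=> x; rewrite trmx_mul mulmxA.
  have -> : x *m (invmx A0)^T *m A^T = x + x *m (invmx A0)^T *m (A^T - A0^T).
    rewrite mulmxBr -[X in _ - X]mulmxA -trmx_mul mulmxV// trmx1 mulmx1.
    by rewrite addrC subrK.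
  rewrite mulrDl mul1r (le_trans (enormD _ _))// lerD2l.
  apply: le_trans (AA0 _) _; rewrite -mulrA ler_wpM2l//.
have w0 := omega_gt0 A0pos dn; have w1 := omega_gt0 Apos dn.
have eC : 0 <= e * C by rewrite mulr_ge0.
have c0 : 0 < 1 + e * C by rewrite ltr_wpDr.
have /andP[d0 dn'] := dn.
have w2 : omega d (A *m invmx A0) <= (1 + e * C) `^ d.
  by apply: omega_le_exp => // i; apply: op_le_sv => //; exact: ltW.
have p0 : 0 < (1 + e * C) `^ d by rewrite powR_gt0.
have h : omega d A <= (1 + e * C) `^ d * omega d A0.
  have := omega_mul (A *m invmx A0) A0 d0; rewrite -AE => h.
  exact: le_trans h (ler_wpM2r (ltW w0) w2).
apply: le_trans (ln_le_mul p0 w0 w1 h) _; rewrite lerD2r ln_powR.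
have l0 : 0 <= ln (1 + e * C) by rewrite ln_ge0// lerDl.
apply: le_trans (ler_wpM2r l0 dn') _; rewrite ler_wpM2l// le_ln1Dx//.
by apply: lt_le_trans eC; rewrite ltrN10.
Qed.

Lemma ln_omega_perturb_tr (J J0 : 'M[R]_n) d e C : 0 <= d <= n%:R ->
  sv_positive J^T -> sv_positive J0^T -> 0 <= e -> 0 <= C ->
  op_le (invmx J0^T)^T C -> op_le (J - J0) e ->
  ln (omega d J^T) <= n%:R * (e * C) + ln (omega d J0^T).
Proof.
move=> dn Jpos J0pos e0 C0 invC JJ0; apply: ln_omega_perturb => //.
by rewrite !trmxK.
Qed.

Lemma ln_omega_le_tr (J : 'M[R]_n) d c : 0 <= d <= n%:R -> 1 <= c -> sv_positive J^T ->
  op_le J c -> ln (omega d J^T) <= n%:R * ln c.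
Proof. by move=> dn c1 Jpos Jc; apply: ln_omega_le => //; rewrite trmxK. Qed.

End OmegaEstimates.

Section Growth.
Context {R : realType} {n : nat}.
Variables (tau : time_kind) (K : set 'rV[R]_n) (phi : R -> 'rV[R]_n -> 'rV[R]_n).
Hypotheses (K_compact : compact K) (phi_cc : smooth_cocycle tau K phi)
  (D_pos : forall t u, times tau t -> K u -> sv_positive (Dmx (phi t) u)).

Definition lnomega (d t : R) (u : 'rV[R]_n) := ln (omega d (Dmx (phi t) u)).

Lemma lnomegaE d t u : lnomega d t u = ln (omega d (Dmx (phi t) u)).
Proof. by []. Qed.

(* Comparing [lnomega] at two points by unfolding would compare two derivatives. *)
Opaque lnomega.

Lemma lnomega_subadditive d s t u : 0 <= d <= n%:R -> times tau s -> times tau t ->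
  K u -> lnomega d (t + s) u <= lnomega d t (phi s u) + lnomega d s u.
Proof.
move=> dn Ts Tt Ku; have Ksu := cocycle_invariant phi_cc Ts Ku.
have w1 := omega_gt0 (D_pos Tt Ksu) dn; have w2 := omega_gt0 (D_pos Ts Ku) dn.
have w3 := omega_gt0 (D_pos (timesD Tt Ts) Ku) dn.
have E : Dmx (phi (t + s)) u = Dmx (phi t) (phi s u) *m Dmx (phi s) u.
  by have := cocycle_mul phi_cc Ts Tt Ku; rewrite /Dmx => ->; rewrite trmx_mul.
have d0 : 0 <= d by case/andP: dn.
have := omega_mul (Dmx (phi t) (phi s u)) (Dmx (phi s) u) d0; rewrite -E !lnomegaE.
exact: ln_le_mul.
Qed.

Lemma lnomega_bounded d T : 0 <= d <= n%:R -> exists2 B, 0 <= B &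
  forall t u, times tau t -> t <= T -> K u -> lnomega d t u <= B.
Proof.
move=> dn; have [C C0 bd] := cocycle_bounded phi_cc T.
have C1 : 1 <= C + 1 by rewrite lerDr ltW.
exists (n%:R * ln (C + 1)) => [|t u Tt tT Ku]; first by rewrite mulr_ge0// ln_ge0.
rewrite lnomegaE.
have Jc : op_le ('J (phi t) u) (C + 1).
  by apply: op_le_trans (bd t u Tt tT Ku) _; rewrite lerDl ler01.
exact: ln_omega_le_tr dn C1 (D_pos Tt Ku) Jc.
Qed.

Lemma lnomega_usc d t u c : 0 <= d <= n%:R -> times tau t -> K u ->
  lnomega d t u < c -> exists2 del : R, 0 < del &
    forall v, K v -> enorm (v - u) < del -> lnomega d t v < c.
Proof.
move=> dn Tt Ku wc.
have [C C0 invC] := op_le_ex (invmx (Dmx (phi t) u))^T.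
pose gap := c - lnomega d t u; have gap0 : 0 < gap by rewrite subr_gt0.
have n1 : 0 < n%:R + 1 :> R by rewrite ltr_wpDl.
have e0 : 0 < gap / (n%:R + 1) / C by rewrite divr_gt0 ?divr_gt0.
have [del del0 Jcont] := unif_sdiff_continuous (cocycle_sdiff phi_cc Tt) e0.
exists del; first exact: del0.
move=> v Kv vu.
have dA := Jcont v u Kv Ku vu.
have h := ln_omega_perturb_tr dn (D_pos Tt Kv) (D_pos Tt Ku) (ltW e0) (ltW C0) invC dA.
rewrite lnomegaE; apply: le_lt_trans h _.
rewrite -[ln _]/(lnomega d t u) divfK ?gt_eqF// -ltrBrDr -/gap.
by rewrite mulrA ltr_pdivrMr// mulrC ltr_pM2l// ltrDl.
Qed.

(** If every point of [K] has some time at which [lnomega] lies below the line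
    [c * t], finitely many such times serve all of [K] by compactness and
    semicontinuity, with a uniform gain; concatenating them along an orbit bounds
    [lnomega] by a line of strictly smaller slope for all times. *)
Lemma lnomega_uniform d c : 0 <= d <= n%:R ->
  (forall u, K u -> exists t, [/\ times tau t, 0 < t & lnomega d t u < c * t]) ->
  exists c' B, c' < c /\ forall t u, times tau t -> K u -> lnomega d t u <= c' * t + B.
Proof.
move=> dn c_loc.
pose Q (M : R) u := exists t, [/\ times tau t, M^-1 <= t, t <= M &
  lnomega d t u < (c - M^-1) * t].
have [M M0 QM] : exists2 M : R, 0 < M & forall u, K u -> Q M u.
  apply: compact_uniform_bound => // [M M' u M0 MM' [t [Tt Mt tM w]]|u Ku].
    have M'M : M'^-1 <= M^-1 by rewrite lef_pV2 ?posrE// (lt_le_trans M0).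
    have Mi : 0 < M^-1 by rewrite invr_gt0.
    exists t; split => //; [exact: le_trans Mt|exact: le_trans tM _|].
    apply: lt_le_trans w _; rewrite ler_wpM2r ?lerD2l ?lerN2//.
    by apply: le_trans Mt; exact: ltW.
  have [t [Tt t0 w]] := c_loc u Ku.
  pose gap := c * t - lnomega d t u; have gap0 : 0 < gap by rewrite subr_gt0.
  pose M := t + t^-1 + t / gap.
  have ti : 0 < t^-1 by rewrite invr_gt0.
  have tg : 0 < t / gap by rewrite divr_gt0.
  have M0 : 0 < M by rewrite !addr_gt0.
  have w' : lnomega d t u < (c - M^-1) * t.
    rewrite mulrBl ltrBrDr addrC -ltrBrDr -/gap mulrC ltr_pdivrMr//.
    by rewrite mulrC -ltr_pdivrMr// /M; lra.
  have [del del0 usc] := lnomega_usc dn Tt Ku w'.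
  exists M, del; first by split.
  move=> v Kv vu; exists t; split; [exact: Tt| | |exact: usc].
    by rewrite -[t in leRHS]invrK lef_pV2 ?posrE// /M; lra.
  by rewrite /M; lra.
have Mi : 0 < M^-1 by rewrite invr_gt0.
have [B0 B00 bd] := lnomega_bounded M dn.
pose c' := c - M^-1; exists c', (B0 + `|c'| * M).
split; first by rewrite /c' ltrBlDr ltrDl.
suff main (k : nat) t u : times tau t -> K u -> t <= k%:R / M ->
    lnomega d t u <= c' * t + (B0 + `|c'| * M).
  move=> t u Tt Ku; apply: (main (Num.truncn (t * M)).+1) => //.
  by rewrite ler_pdivlMr// ltW// truncnS_gt.
have short t' v : times tau t' -> K v -> t' <= M ->
    lnomega d t' v <= c' * t' + (B0 + `|c'| * M).
  move=> Tt Kv tM; apply: le_trans (bd t' v Tt tM Kv) _.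
  rewrite addrCA lerDl -lerBlDl sub0r -mulNr.
  apply: (@le_trans _ _ (`|c'| * t')); last by rewrite ler_wpM2l.
  by rewrite ler_wpM2r ?(times_ge0 Tt)// -normrN ler_norm.
elim: k t u => [|k IH] t u Tt Ku tk.
  by apply: short => //; rewrite mul0r in tk; apply: le_trans tk (ltW M0).
have [tM|Mt] := leP t M; first exact: short.
have [s [Ts Ms sM ws]] := QM u Ku.
have st : s <= t by apply: le_trans sM (ltW Mt).
have Tts := timesB Ts Tt st.
have := lnomega_subadditive dn Ts Tts Ku; rewrite subrK => h.
apply: le_trans h _.
have tsk : t - s <= k%:R / M.
  by move: tk; rewrite -natr1 mulrDl mul1r; lra.
have h' := IH (t - s) (phi s u) Tts (cocycle_invariant phi_cc Ts Ku) tsk.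
apply: le_trans (lerD h' (ltW ws)) _; rewrite -/c'.
by rewrite mulrBr addrAC subrK.
Qed.

End Growth.

(** * Lyapunov dimensions of a family of growth functions *)

Section TimesFilter.
Context {R : realType} (tau : time_kind).

Lemma times_to_ooP (P : set R) : times_to_oo tau P <->
  exists M, forall t, M < t -> times tau t -> P t.
Proof.
split=> [[M [_ MP]]|[M MP]]; first by exists M => t Mt; exact: MP.
by exists M; split => //; exact: num_real.
Qed.

Lemma times_to_oo_proper : ProperFilter (times_to_oo (R := R) tau).
Proof.
split; last by apply: within_filter; exact: proper_pinfty_nbhs.
move=> /times_to_ooP[M h]; have [s Ts Ms] := times_gt tau M.
exact: h Ms Ts.
Qed.

End TimesFilter.

(** Here [l d t u] stands for the logarithm of [omega d] of the derivative at time
    [t] and point [u]. The relations between the dimensions depend only on its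
    normalization at [d = 0], its concavity in [d] and the uniform estimate
    obtained from compactness. *)
Section AbstractDimensions.
Context {R : realType} {n : nat} {V : Type}.
Variables (tau : time_kind) (K : set V) (l : R -> R -> V -> R).
Hypotheses (K_ne : K !=set0)
  (l0 : forall t u, l 0 t u = 0)
  (l_concave : forall d d' t u, times tau t -> K u -> 0 < d -> d <= d' -> d' <= n%:R ->
    l d' t u <= d' / d * l d t u)
  (l_uniform : forall d c, 0 <= d <= n%:R ->
    (forall u, K u -> exists t, [/\ times tau t, 0 < t & l d t u < c * t]) ->
    exists c' B, c' < c /\ forall t u, times tau t -> K u -> l d t u <= c' * t + B).

Local Notation F := (times_to_oo (R := R) tau).
Let FF : ProperFilter F := times_to_oo_proper tau.
#[local] Existing Instance FF.

Definition rate d t u : \bar R := (t^-1 * l d t u)%:E.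
Definition max_rate d t : \bar R := ereal_sup [set rate d t u | u in K].

Definition dim_at t u := sup [set d : R | 0 <= d <= n%:R /\ 0 <= l d t u].
Definition dim_on t := sup [set dim_at t u | u in K].
Definition dim_inf := inf [set dim_on t | t in [set t : R | times tau t /\ 0 < t]].
Definition decay_on := [set d : R | 0 <= d <= n%:R /\
  (lim (max_rate d t @[t --> F]) < 0)%E].
Definition decay_at u := [set d : R | 0 <= d <= n%:R /\
  (limf_esup (fun t => rate d t u) F < 0)%E].

Lemma rate_lt d t u c : 0 < t -> (rate d t u < c%:E)%E = (l d t u < c * t).
Proof. by move=> t0; rewrite lte_fin mulrC ltr_pdivrMr. Qed.

Lemma rate_le_max d t u : K u -> (rate d t u <= max_rate d t)%E.
Proof. by move=> Ku; apply: ereal_sup_ubound; exists u. Qed.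

Lemma l_linear_rate d c c' B : c' < c ->
  (forall t u, times tau t -> K u -> l d t u <= c' * t + B) ->
  exists2 M, 0 < M & forall t u, times tau t -> M < t -> K u ->
    (rate d t u <= c%:E)%E.
Proof.
move=> cc lB; have cc0 : 0 < c - c' by rewrite subr_gt0.
exists (`|B| / (c - c') + 1) => [|t u Tt Mt Ku].
  by rewrite ltr_wpDl// divr_ge0// ltW.
have h : `|B| / (c - c') < t by lra.
have t0 : 0 < t by apply: le_lt_trans h; rewrite divr_ge0// ltW.
rewrite lee_fin mulrC ler_pdivrMr//; apply: le_trans (lB t u Tt Ku) _.
move: h; rewrite ltr_pdivrMr// => h.
by have := ler_norm B; nra.
Qed.

(** Fekete's lemma: any line [c * t] above the value at one time bounds the whole
    function up to a constant, by [l_uniform]. *)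
Lemma max_rate_cvg d : 0 <= d <= n%:R -> max_rate d t @[t --> F] -->
  ereal_inf [set max_rate d t | t in [set t | times tau t /\ 0 < t]].
Proof.
move=> dn; set L := ereal_inf _.
have lower : \forall t \near F, (L <= max_rate d t)%E.
  apply/times_to_ooP; exists 0 => t t0 Tt.
  by apply: ereal_inf_lbound; exists t.
have upper c : (L < c%:E)%E -> \forall t \near F, (max_rate d t <= c%:E)%E.
  move=> /ereal_inf_lt[_ [t0 [Tt0 t0_gt0] <-] Gt0].
  have [u Ku|c' [B [cc lB]]] := @l_uniform d c dn.
    by exists t0; split => //; rewrite -rate_lt//; apply: le_lt_trans Gt0; exact: rate_le_max.
  have [M M0 lM] := l_linear_rate cc lB.
  apply/times_to_ooP; exists M => t Mt Tt.
  by apply: ge_ereal_sup => _ [u Ku <-]; exact: lM.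
move: lower upper; case: L => [r| |] lower upper.
- have low_up e : 0 < e -> \forall t \near F,
      (r%:E <= max_rate d t)%E /\ (max_rate d t <= (r + e)%:E)%E.
    move=> e0; near=> t; split; near: t => //.
    by apply: upper; rewrite lte_fin ltrDl.
  apply/fine_cvgP; split.
    have := low_up 1 ltr01; apply: filterS => t [h1 h2].
    rewrite fin_numE; apply/andP; split.
      by rewrite -ltNye (lt_le_trans _ h1)// ltNyr.
    by rewrite -ltey (le_lt_trans h2)// ltry.
  apply/cvgrPdist_le => e e0; have := low_up e e0; apply: filterS => t [h1 h2] /=.
  move: h1 h2; case: (max_rate d t) => [s| |] //=; rewrite ?lee_fin => h1 h2.
  by rewrite ler_norml; apply/andP; split; lra.
- apply: cvg_near_cst; apply: filterS lower => t.
  by rewrite leye_eq => /eqP.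
- apply/cvgeNyPler => A _; apply: upper; exact: ltNyr.
Unshelve. all: by end_near. Qed.

Definition contracting d := forall u, K u -> exists t,
  [/\ times tau t, 0 < t & l d t u < 0].

(** A single time of contraction at each point already forces uniform exponential
    decay. So decay of the maximal rate, decay at every point, and contraction
    everywhere at one common time are all equivalent to [contracting]. *)
Lemma contracting_uniform d : 0 <= d <= n%:R -> contracting d ->
  exists c' B, c' < 0 /\ forall t u, times tau t -> K u -> l d t u <= c' * t + B.
Proof.
move=> dn dc; apply: l_uniform => // u Ku; have [t [Tt t0 lt]] := dc u Ku.
by exists t; rewrite mul0r.
Qed.

Lemma contracting_decay_rate d : 0 <= d <= n%:R -> contracting d ->
  exists c M, [/\ c < 0, 0 < M & forall t u, times tau t -> M < t -> K u ->
    (rate d t u <= c%:E)%E].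
Proof.
move=> dn /(contracting_uniform dn)[c [B [c0 lB]]].
have cc : c < c / 2 by lra.
have [M M0 lM] := l_linear_rate cc lB.
by exists (c / 2), M; split => //; lra.
Qed.

Lemma decay_onP d : 0 <= d <= n%:R -> decay_on d <-> contracting d.
Proof.
move=> dn; rewrite /decay_on /= (cvg_lim _ (max_rate_cvg dn))//.
split=> [[_ /ereal_inf_lt[_ [t [Tt t0] <-] Gt]] u Ku|dc].
  exists t; split => //; rewrite -(mul0r t) -rate_lt//.
  by apply: le_lt_trans Gt; exact: rate_le_max.
split => //; have [c [M [c0 M0 lM]]] := contracting_decay_rate dn dc.
have [t Tt Mt] := times_gt tau M.
apply: (@le_lt_trans _ _ (max_rate d t)).
  by apply: ereal_inf_lbound; exists t => //; split => //; exact: lt_trans Mt.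
apply: (@le_lt_trans _ _ c%:E); last by rewrite lte_fin.
by apply: ge_ereal_sup => _ [u Ku <-]; exact: lM.
Qed.

Lemma decay_atP d u : 0 <= d <= n%:R -> K u -> decay_at u d <->
  exists c M, [/\ c < 0, 0 < M & forall t, times tau t -> M < t ->
    (rate d t u <= c%:E)%E].
Proof.
move=> dn Ku; split=> [[_ /ereal_inf_lt[_ [A FA <-] sA]]|[c [M [c0 M0 lM]]]].
  have [c c0 sAc] : exists2 c : R, c < 0 & (ereal_sup [set rate d t u | t in A] <= c%:E)%E.
    move: sA; case: (ereal_sup _) => [s| |] //=.
      by rewrite lte_fin => s0; exists s.
    by move=> _; exists (- 1); [rewrite ltrN10|exact: leNye].
  move: FA => /times_to_ooP[M MA]; exists c, (Order.max M 0 + 1); split => //.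
    by rewrite ltr_pwDr// le_max lexx orbT.
  move=> t Tt Mt; apply: le_trans sAc; apply: ereal_sup_ubound; exists t => //.
  apply: MA => //; apply: lt_trans Mt; rewrite ltr_pwDr// le_max lexx//.
split => //; apply: (@le_lt_trans _ _ c%:E); last by rewrite lte_fin.
apply: ge_ereal_inf; exists (ereal_sup [set rate d t u | t in [set t | times tau t /\ M < t]]).
  exists [set t | times tau t /\ M < t] => //.
  by apply/times_to_ooP; exists M.
by apply: ge_ereal_sup => _ [t [Tt Mt] <-]; exact: lM.
Qed.

Lemma decay_at_up d d' u : K u -> d <= d' -> d' <= n%:R -> decay_at u d -> decay_at u d'.
Proof.
move=> Ku dd' d'n ud; have [dn _] := ud.
have /andP[d0 dn'] := dn.
have d'0 := le_trans d0 dd'.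
have [c [M [c0 M0 lM]]] := (decay_atP dn Ku).1 ud.
have d_gt0 : 0 < d.
  rewrite lt_def d0 andbT; apply/eqP => d00.
  have [t Tt Mt] := times_gt tau M; have := lM t Tt Mt.
  by rewrite /rate d00 l0 mulr0 lee_fin leNgt c0.
apply/decay_atP => //; first by rewrite d'0.
exists c, M; split => // t Tt Mt; apply: le_trans (lM t Tt Mt).
have t0 := lt_trans M0 Mt.
have lt0 : l d t u <= 0.
  have := lM t Tt Mt; rewrite /rate lee_fin mulrC ler_pdivrMr// => h.
  by apply: le_trans h _; rewrite mulr_le0_ge0// ltW.
rewrite lee_fin ler_wpM2l ?invr_ge0 ?(ltW t0)//.
apply: le_trans (l_concave Tt Ku d_gt0 dd' d'n) _.
rewrite ler_neMl// ler_pdivlMr// mul1r//.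
Qed.

Lemma contracting_at d : 0 <= d <= n%:R ->
  contracting d <-> forall u, K u -> decay_at u d.
Proof.
move=> dn; split=> [dc u Ku|ud u Ku].
  have [c [M [c0 M0 lM]]] := contracting_decay_rate dn dc.
  by apply/decay_atP => //; exists c, M; split => // t Tt Mt; exact: lM.
have [c [M [c0 M0 lM]]] := (decay_atP dn Ku).1 (ud u Ku).
have [t Tt Mt] := times_gt tau M; have t0 := lt_trans M0 Mt.
exists t; split => //; rewrite -(mul0r t) -rate_lt//.
by apply: le_lt_trans (lM t Tt Mt) _; rewrite lte_fin.
Qed.

Let dim_set_sup t u :
  has_sup [set d : R | 0 <= d <= n%:R /\ 0 <= l d t u].
Proof.
split; first by exists 0; rewrite /= lexx l0 lexx ler0n.
by exists n%:R => d [/andP[]].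
Qed.

Lemma dim_at_bounds t u : 0 <= dim_at t u <= n%:R.
Proof.
have [ne ub] := dim_set_sup t u; apply/andP; split.
  by apply: ub_le_sup => //; rewrite /= lexx l0 lexx ler0n.
by apply: ge_sup => // d [/andP[]].
Qed.

Let dim_on_sup t : has_sup [set dim_at t u | u in K].
Proof.
have [u Ku] := K_ne; split; first by exists (dim_at t u); exists u.
by exists n%:R => _ [v Kv <-]; case/andP: (dim_at_bounds t v).
Qed.

Lemma dim_on_bounds t : 0 <= dim_on t <= n%:R.
Proof.
have [ne ub] := dim_on_sup t; apply/andP; split.
  have [u Ku] := K_ne; apply: (@le_trans _ _ (dim_at t u)).
    by case/andP: (dim_at_bounds t u).
  by apply: ub_le_sup => //; exists u.
by apply: ge_sup => // _ [v Kv <-]; case/andP: (dim_at_bounds t v).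
Qed.

Lemma dim_on_lt t d u : dim_on t < d -> d <= n%:R -> K u -> l d t u < 0.
Proof.
move=> td dn Ku; rewrite ltNge; apply/negP => ld.
have /andP[t0 _] := dim_on_bounds t.
have : d <= dim_at t u.
  have [_ ub] := dim_set_sup t u; apply: ub_le_sup => //.
  by split => //; rewrite dn andbT (le_trans t0)// ltW.
have : dim_at t u <= dim_on t.
  by have [_ ub] := dim_on_sup t; apply: ub_le_sup => //; exists u.
by move=> h1 h2; have := le_lt_trans (le_trans h2 h1) td; rewrite ltxx.
Qed.

Lemma dim_on_le t d : times tau t -> 0 <= d <= n%:R ->
  (forall u, K u -> l d t u < 0) -> dim_on t <= d.
Proof.
move=> Tt /andP[d0 dn] ld; have [ne ub] := dim_on_sup t.
apply: ge_sup => // _ [u Ku <-]; have [ne' ub'] := dim_set_sup t u.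
apply: ge_sup => // d' [/andP[d'0 d'n] ld'].
rewrite leNgt; apply/negP => dd'.
have d_gt0 : 0 < d.
  rewrite lt_def d0 andbT; apply/eqP => d00.
  by have := ld u Ku; rewrite d00 l0 ltxx.
have := l_concave Tt Ku d_gt0 (ltW dd') d'n; rewrite leNgt => /negP; apply.
apply: lt_le_trans ld'; rewrite pmulr_rlt0 ?ld//.
by rewrite divr_gt0// (lt_trans d_gt0).
Qed.

Let dim_inf_set_inf :
  has_inf [set dim_on t | t in [set t : R | times tau t /\ 0 < t]].
Proof.
have [t Tt t0] := times_gt tau (0 : R).
split; first by exists (dim_on t); exists t.
by exists 0 => _ [s _ <-]; case/andP: (dim_on_bounds s).
Qed.

Lemma dim_inf_le t : times tau t -> 0 < t -> dim_inf <= dim_on t.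
Proof. by move=> Tt t0; apply: ge_inf; [case: dim_inf_set_inf|exists t]. Qed.

Lemma dim_inf_ge0 : 0 <= dim_inf.
Proof.
have [ne _] := dim_inf_set_inf; apply: lb_le_inf => // _ [s _ <-].
by case/andP: (dim_on_bounds s).
Qed.

Lemma dim_inf_le_dim : dim_inf <= n%:R.
Proof.
have [t Tt t0] := times_gt tau (0 : R).
by apply: le_trans (dim_inf_le Tt t0) _; case/andP: (dim_on_bounds t).
Qed.

Lemma dim_inf_lt d : dim_inf < d -> d <= n%:R -> contracting d.
Proof.
move=> Ld dn u Ku; have e0 : 0 < d - dim_inf by rewrite subr_gt0.
have [_ [t [Tt t0] <-]] := inf_adherent e0 dim_inf_set_inf.
rewrite addrC subrK => td; exists t; split => //; exact: dim_on_lt.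
Qed.

Lemma contracting_dim_inf d : 0 <= d <= n%:R -> contracting d -> dim_inf <= d.
Proof.
move=> dn dc; have [c [M [c0 M0 lM]]] := contracting_decay_rate dn dc.
have [t Tt Mt] := times_gt tau M; have t0 := lt_trans M0 Mt.
apply: le_trans (dim_inf_le Tt t0) _; apply: dim_on_le => // u Ku.
rewrite -(mul0r t) -rate_lt//.
by apply: le_lt_trans (lM t u Tt Mt Ku) _; rewrite lte_fin.
Qed.

Lemma inf_or_n_le (D : set R) d : (forall d, D d -> 0 <= d) -> D d ->
  @inf_or_n R n D <= d.
Proof.
move=> D0 Dd; rewrite /inf_or_n; case: eqP => [D00|_]; first by rewrite D00 in Dd.
by apply: ge_inf => //; exists 0 => x; exact: D0.
Qed.

Lemma inf_or_n_le_dim (D : set R) : (forall d, D d -> 0 <= d <= n%:R) ->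
  @inf_or_n R n D <= n%:R.
Proof.
move=> D0; rewrite /inf_or_n; case: eqP => [//|/eqP/set0P[d Dd]].
have /andP[d0 dn] := D0 d Dd; apply: le_trans dn; apply: ge_inf => //.
by exists 0 => x /D0/andP[].
Qed.

Lemma inf_or_n_ge (D : set R) x : x <= n%:R -> (forall d, D d -> x <= d) ->
  x <= @inf_or_n R n D.
Proof.
move=> xn xD; rewrite /inf_or_n; case: eqP => [//|/eqP/set0P Dne].
exact: lb_le_inf.
Qed.

Lemma inf_or_n_lt (D : set R) x : @inf_or_n R n D < x -> x <= n%:R ->
  exists2 d, D d & d < x.
Proof.
rewrite /inf_or_n; case: eqP => [_ nx xn|/eqP/set0P Dne Dx _].
  by have := lt_le_trans nx xn; rewrite ltxx.
exact: inf_lt.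
Qed.

Theorem dim_inf_decay : dim_inf = @inf_or_n R n decay_on.
Proof.
apply/eqP; rewrite eq_le; apply/andP; split.
  apply: inf_or_n_ge; first exact: dim_inf_le_dim.
  by move=> d dd; have [dn _] := dd; apply: contracting_dim_inf => //; apply/decay_onP.
rewrite leNgt; apply/negP => h.
pose d := (dim_inf + @inf_or_n R n decay_on) / 2.
have En : @inf_or_n R n decay_on <= n%:R by apply: inf_or_n_le_dim => x [].
have Ld : dim_inf < d by rewrite /d; lra.
have dE : d < @inf_or_n R n decay_on by rewrite /d; lra.
have dn : d <= n%:R by lra.
have d0 : 0 <= d by apply: le_trans dim_inf_ge0 (ltW Ld).
have dn' : 0 <= d <= n%:R by rewrite d0.
have : @inf_or_n R n decay_on <= d.
  apply: inf_or_n_le => [x [/andP[]]//|].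
  by apply/decay_onP => //; exact: dim_inf_lt.
by rewrite leNgt dE.
Qed.

Theorem decay_on_sup :
  @inf_or_n R n decay_on = sup [set @inf_or_n R n (decay_at u) | u in K].
Proof.
set E := [set _ | _ in _].
have ubE : has_ubound E.
  by exists n%:R => _ [u Ku <-]; apply: inf_or_n_le_dim => x [].
have [u0 Ku0] := K_ne.
have neE : E !=set0 by exists (@inf_or_n R n (decay_at u0)); exists u0.
apply/eqP; rewrite eq_le; apply/andP; split; last first.
  apply: ge_sup => // _ [u Ku <-].
  apply: inf_or_n_ge => [|d dd]; first by apply: inf_or_n_le_dim => x [].
  have [dn _] := dd; apply: inf_or_n_le => [x [/andP[]]//|].
  by apply: (contracting_at dn).1 => //; apply/decay_onP.
rewrite leNgt; apply/negP => h.
pose d := (sup E + @inf_or_n R n decay_on) / 2.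
have En : @inf_or_n R n decay_on <= n%:R by apply: inf_or_n_le_dim => x [].
have Ed : sup E < d by rewrite /d; lra.
have dE : d < @inf_or_n R n decay_on by rewrite /d; lra.
have dn : d <= n%:R by lra.
have at_d u : K u -> decay_at u d.
  move=> Ku; have ud : @inf_or_n R n (decay_at u) < d.
    by apply: le_lt_trans Ed; apply: ub_le_sup => //; exists u.
  have [d' ud' d'd] := inf_or_n_lt ud dn.
  by apply: decay_at_up ud' => //; exact: ltW.
have [dn' _] := at_d u0 Ku0.
have : @inf_or_n R n decay_on <= d.
  apply: inf_or_n_le => [x [/andP[]]//|].
  by apply/decay_onP => //; apply/contracting_at.
by rewrite leNgt dE.
Qed.

End AbstractDimensions.

(** * Hausdorff measure zero by repeated refinement of covers *)

Section Covers.
Context {R : realType} {n : nat}.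
Implicit Types (G H K : set 'rV[R]_n) (F : 'rV[R]_n -> 'rV[R]_n) (r s : R).

Definition diam_le G r := forall x y, G x -> G y -> enorm (x - y) <= r.

Definition covers K (L : seq (set 'rV[R]_n)) := forall x, K x -> exists2 G, G \in L & G x.

Lemma diam_le_subset G H r : G `<=` H -> diam_le H r -> diam_le G r.
Proof. by move=> GH Hr x y /GH Hx /GH Hy; exact: Hr. Qed.

Lemma hausdorff_weight_le s r G : 0 < s -> diam_le G r ->
  (hausdorff_weight s G <= (r `^ s)%:E)%E.
Proof.
move=> s0 Gr; rewrite /hausdorff_weight; case: eqP => [_|/eqP/set0P[x Gx]].
  by rewrite lee_fin powR_ge0.
have D_ne : [set enorm (p.1 - p.2) | p in G `*` G] !=set0.
  by exists (enorm (x - x)); exists (x, x).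
have D_ub : ubound [set enorm (p.1 - p.2) | p in G `*` G] r.
  by move=> _ [[y z] [/= Gy Gz] <-]; exact: Gr.
have d0 : 0 <= diam G.
  apply: ub_le_sup; first by exists r.
  by exists (x, x) => //=; rewrite subrr enorm0.
have dr : diam G <= r by exact: ge_sup.
rewrite lee_fin; apply: ge0_ler_powR; rewrite ?nnegrE ?(ltW s0)//.
exact: le_trans dr.
Qed.

(** A finite list becomes a sequence of sets by padding with the empty set, whose
    weight is zero. *)
Lemma hausdorff_premeasure_le s del K (L : seq (set 'rV[R]_n * R)) : 0 < s ->
  (forall G r, (G, r) \in L -> diam_le G r /\ r <= del) ->
  covers K (unzip1 L) ->
  (hausdorff_premeasure s del K <= (\sum_(g <- L) g.2 `^ s)%:E)%E.
Proof.
move=> s0 Ldiam Lcov.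
pose G i := (nth (set0, 0) L i).1.
have Gout i : (size L <= i)%N -> G i = set0 by move=> Li; rewrite /G nth_default.
apply: (@le_trans _ _ (\sum_(0 <= i <oo) hausdorff_weight s (G i))%E).
  apply: ereal_inf_lbound; exists G => //; split.
    move=> x Kx; have [A AL Ax] := Lcov x Kx.
    exists (index A (unzip1 L)) => //; rewrite /G.
    rewrite -(nth_map (set0, 0) set0 fst) ?nth_index//.
    by rewrite -(size_map fst) index_mem.
  move=> i x y Gx Gy; have [iL|iL] := ltnP i (size L); last by rewrite Gout in Gx.
  have := mem_nth (set0, 0) iL; rewrite [nth _ _ _]surjective_pairing => /Ldiam[].
  by move=> dG rdel; apply: le_trans (dG _ _ Gx Gy) rdel.
have w0 i : (0 <= hausdorff_weight s (G i))%E.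
  by rewrite /hausdorff_weight; case: ifP => // _; rewrite lee_fin powR_ge0.
rewrite (nneseries_split 0 (size L)) ?add0n//.
rewrite eseries0 ?adde0; last first.
  by move=> i iL _; rewrite Gout// /hausdorff_weight eqxx.
rewrite -sumEFin (big_nth (set0, 0)); rewrite [X in (_ <= X)%E]big_nat [X in (X <= _)%E]big_nat.
apply: lee_sum => i /andP[_ iL].
apply: hausdorff_weight_le => //.
by have := mem_nth (set0, 0) iL; rewrite [nth _ _ _]surjective_pairing => /Ldiam[].
Qed.

Lemma hausdorff_measure_eq0 s K : 0 < s ->
  (forall e del : R, 0 < e -> 0 < del -> exists L : seq (set 'rV[R]_n * R),
    [/\ forall G r, (G, r) \in L -> diam_le G r /\ r <= del,
        covers K (unzip1 L) & \sum_(g <- L) g.2 `^ s <= e]) ->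
  hausdorff_measure s K = 0%E.
Proof.
move=> s0 small.
have pre0 del : 0 < del -> hausdorff_premeasure s del K = 0%E.
  move=> del0; apply/eqP; rewrite eq_le; apply/andP; split; last first.
    apply: le_ereal_inf_tmp => _ [G _ <-]; apply: nneseries_ge0 => i _ _.
    by rewrite /hausdorff_weight; case: ifP => // _; rewrite lee_fin powR_ge0.
  apply/lee_addgt0Pr => e e0; rewrite add0e.
  have [L [Ldiam Lcov Lsum]] := small e del e0 del0.
  by apply: le_trans (hausdorff_premeasure_le s0 Ldiam Lcov) _; rewrite lee_fin.
rewrite /hausdorff_measure (_ : [set _ | _ in _] = [set 0%E]) ?ereal_sup1//.
apply/seteqP; split => [_ [del /= del0 <-]|_ ->]; first by rewrite /= pre0.
by exists 1; rewrite /= ?ltr01// pre0.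
Qed.

(** On [G] the functional [f i] ranges over an interval of length at most [2 r],
    which meets at most [2 r / w i + 1 <= 3 r / w i] slices of width [w i]. *)
Lemma split_slices (I : seq 'I_n) (f : 'I_n -> 'rV[R]_n -> R) (w : 'I_n -> R) G r :
  0 < r -> diam_le G r -> (forall i, 0 < w i <= r) ->
  (forall i x y, `|f i x - f i y| <= enorm (x - y)) ->
  exists L : seq (set 'rV[R]_n),
    [/\ (size L)%:R <= \prod_(i <- I) (3 * r / w i), covers G L &
        forall H, H \in L -> H `<=` G /\
          forall i x y, i \in I -> H x -> H y -> `|f i x - f i y| <= w i].
Proof.
move=> r0 Gr w_r f_lip.
have [G0|/set0P[x0 Gx0]] := eqVneq G set0.
  exists [::]; split => //=; last by move=> x; rewrite G0.
  by apply: prodr_ge0 => i _; have /andP[wi _] := w_r i; rewrite divr_ge0 ?mulr_ge0 ?ltW.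
elim: I => [|i I [L [Lsize Lcov LG]]].
  exists [:: G]; split; first by rewrite big_nil.
    by move=> x Gx; exists G => //; rewrite mem_head.
  by move=> H; rewrite inE => /eqP ->; split.
have /andP[wi wr] := w_r i.
pose N := (Num.truncn (2 * r / w i)).+1.
pose slice x := Num.truncn ((f i x - f i x0 + r) / w i).
have slice_ge0 x : G x -> 0 <= (f i x - f i x0 + r) / w i.
  move=> Gx; rewrite divr_ge0 ?(ltW wi)//.
  have := le_trans (f_lip i x x0) (Gr x x0 Gx Gx0); rewrite ler_norml; lra.
have slice_lt x : G x -> (slice x < N)%N.
  move=> Gx; rewrite ltnS; apply: le_truncn; rewrite ler_pM2r ?invr_gt0//.
  have := le_trans (f_lip i x x0) (Gr x x0 Gx Gx0); rewrite ler_norml; lra.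
exists [seq H `&` [set x | slice x = j] | H <- L, j <- iota 0 N]; split.
- rewrite size_allpairs size_iota natrM big_cons mulrC ler_pM//.
  have q0 : 0 <= 2 * r / w i by rewrite divr_ge0 ?mulr_ge0 ?ltW.
  have /andP[+ _] := truncn_itv q0; rewrite /N -natr1.
  have : 1 <= r / w i by rewrite ler_pdivlMr// mul1r.
  have -> : 3 * r / w i = 2 * r / w i + r / w i by field; rewrite gt_eqF.
  lra.
- move=> x Gx; have [H HL Hx] := Lcov x Gx.
  exists (H `&` [set y | slice y = slice x]) => //.
  apply/allpairsP; exists (H, slice x); split; [exact: HL| |by []].
  by rewrite mem_iota slice_lt.
- move=> _ /allpairsP[[H j] [/= HL _ ->]]; have [HG Hf] := LG H HL.
  split; first by move=> x [/HG].
  move=> k x y; rewrite inE => /orP[/eqP ->|kI] [Hx sx] [Hy sy]; last exact: Hf.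
  have /andP[x1 x2] := truncn_itv (slice_ge0 x (HG x Hx)).
  have /andP[y1 y2] := truncn_itv (slice_ge0 y (HG y Hy)).
  rewrite -/(slice x) sx in x1 x2; rewrite -/(slice y) sy in y1 y2.
  rewrite ler_pdivlMr// in x1; rewrite ltr_pdivrMr// -natr1 mulrDl mul1r in x2.
  rewrite ler_pdivlMr// in y1; rewrite ltr_pdivrMr// -natr1 mulrDl mul1r in y2.
  by rewrite ler_norml; lra.
Qed.

(** One step of the Douady-Oesterle argument. All the new pieces share one diameter
    bound [r'], so that content is a count times a power. *)
Definition refines F K s theta del := forall G r, G `<=` K -> 0 < r -> r < del ->
  diam_le G r -> exists L r', [/\ 0 < r', covers (F @` G) L,
    forall H, H \in L -> diam_le H r' & (size L)%:R * r' `^ s <= theta * r `^ s].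

Lemma compact_small_cover K del : compact K -> 0 < del ->
  exists L : seq (set 'rV[R]_n * R), covers K (unzip1 L) /\
    forall G r, (G, r) \in L -> [/\ diam_le G r, 0 < r & r < del].
Proof.
move=> cK del0.
have [c c0 Kc] : exists2 c : R, 0 < c & forall x, K x -> enorm x <= c.
  apply: compact_uniform_bound => // [c c' x _ cc' xc|x Kx]; first exact: le_trans cc'.
  exists (enorm x + 1), 1; first by rewrite ltr_wpDl ?enorm_ge0.
  move=> y _ yx; rewrite -[y](subrK x) (le_trans (enormD _ _))// addrC lerD2l.
  exact: ltW.
have n1 : 0 < Num.sqrt n%:R + 1 :> R by rewrite ltr_wpDl ?sqrtr_ge0.
pose w := Order.min (2 * c) (del / 2 / (Num.sqrt n%:R + 1)).
have w0 : 0 < w by rewrite lt_min mulr_gt0// !divr_gt0.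
have wc : w <= 2 * c by rewrite ge_min lexx.
have K2c : diam_le K (2 * c).
  by move=> x y Kx Ky; apply: le_trans (enormB _ _) _; have := Kc x Kx; have := Kc y Ky; lra.
have c2 : 0 < 2 * c by rewrite mulr_gt0.
have lip (i : 'I_n) (x y : 'rV[R]_n) : `|x 0 i - y 0 i| <= enorm (x - y).
  by have := coord_le_enorm (x - y) i; rewrite !mxE.
have w_in (i : 'I_n) : 0 < w <= 2 * c by rewrite w0.
have [L [_ Lcov LK]] := split_slices (index_enum 'I_n) c2 K2c w_in lip.
exists [seq (H, (Num.sqrt n%:R + 1) * w) | H <- L]; split.
  by rewrite /unzip1 -map_comp map_id_in.
move=> G r /mapP[H HL [-> ->]]; have [HK Hw] := LK H HL; split.
- move=> x y Hx Hy; apply: le_trans (_ : Num.sqrt n%:R * w <= _).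
    apply: enorm_le_coord => [|i]; first exact: ltW.
    by have := Hw i x y (mem_index_enum i) Hx Hy; rewrite !mxE.
  by rewrite ler_wpM2r ?(ltW w0)// lerDl.
- by rewrite mulr_gt0.
- apply: (@le_lt_trans _ _ (del / 2)); last first.
    by rewrite ltr_pdivrMr// ltr_pMr// ltr1n.
  by rewrite mulrC -ler_pdivlMr// ge_min lexx orbT.
Qed.

(** As [K] is contained in its image, refining a cover and mapping it by [F] gives
    a cover again, with content multiplied by [theta]. The diameters tend to zero
    along with the content that bounds their [s]-th powers. *)
Lemma refines_measure0 F K s theta del : compact K -> 0 < s -> 0 <= theta ->
  theta < 1 -> 0 < del -> K `<=` F @` K -> refines F K s theta del ->
  hausdorff_measure s K = 0%E.
Proof.
move=> cK s0 th0 th1 del0 KF ref.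
pose good (L : seq (set 'rV[R]_n * R)) :=
  forall G r, (G, r) \in L -> [/\ diam_le G r, 0 < r & r < del].
pose content (L : seq (set 'rV[R]_n * R)) := \sum_(g <- L) g.2 `^ s.
(* refining each piece of a cover of [K] and mapping it by [F] covers [K] again *)
have step L : good L -> exists L', [/\ good L', content L' <= theta * content L &
    covers (F @` (K `&` [set x | exists2 G, G \in unzip1 L & G x])) (unzip1 L')].
  elim: L => [_|[G r] L IH Lgood].
    exists [::]; split => //; first by rewrite /content !big_nil mulr0.
    by move=> y [x [_ [G]]].
  have [|L1 [L1good L1c L1cov]] := IH.
    by move=> H r' HL; apply: Lgood; rewrite inE HL orbT.
  have [Gr r0 rdel] := Lgood G r (mem_head _ _).
  have [|L2 [r' [r'0 L2cov L2diam L2c]]] := ref (K `&` G) r (@subIsetl _ _ _) r0 rdel.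
    exact: diam_le_subset Gr.
  exists ([seq (H, r') | H <- L2] ++ L1); split.
  - move=> H r1; rewrite mem_cat => /orP[/mapP[H' H'L [-> ->]]|]; last exact: L1good.
    split => //; first exact: L2diam.
    apply: le_lt_trans rdel; rewrite leNgt; apply/negP => rr'.
    have : r `^ s < r' `^ s by apply: gt0_ltr_powR; rewrite ?nnegrE ?(ltW r0) ?(ltW r'0).
    apply/negP; rewrite -leNgt.
    have L2n : 1 <= (size L2)%:R :> R by case: (L2) H'L => // a l _; rewrite ler1n.
    have rs0 := powR_ge0 r s; have r's0 := powR_ge0 r' s.
    apply: (@le_trans _ _ ((size L2)%:R * r' `^ s)); first by rewrite ler_peMl.
    by apply: le_trans L2c _; rewrite ler_piMl// ltW.
  - rewrite /content big_cat /= big_map (eq_bigr (fun=> r' `^ s))//.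
    rewrite big_const_seq count_predT iter_addr_0.
    by rewrite big_cons mulrDr lerD// -mulr_natl.
  - move=> y [x [Kx [H]]]; rewrite /= inE => /orP[/eqP -> Gx <-|HL Hx <-].
      have [|H' H'L FH] := L2cov (F x); first by exists x.
      exists H' => //; rewrite /unzip1 map_cat -map_comp mem_cat.
      by rewrite map_id_in ?H'L.
    have [|H' H'L FH] := L1cov (F x); first by exists x => //; split => //; exists H.
    by exists H' => //; rewrite /unzip1 map_cat mem_cat H'L orbT.
have [L0 [L0cov L0good]] := compact_small_cover cK del0.
have iterated m : exists L, [/\ good L, content L <= theta ^+ m * content L0 &
    covers K (unzip1 L)].
  elim: m => [|m [L [Lgood Lc Lcov]]]; first by exists L0; rewrite expr0 mul1r.
  have [L' [L'good L'c L'cov]] := step L Lgood; exists L'; split => //.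
    by apply: le_trans L'c _; rewrite exprS -mulrA ler_wpM2l.
  move=> x /KF[y Ky <-]; apply: L'cov; exists y => //; split => //; exact: Lcov.
apply: hausdorff_measure_eq0 => // e d e0 d0.
(* once the content is below [d ^ s], every piece has size at most [d] *)
pose e' := Order.min e (d `^ s); have e'0 : 0 < e' by rewrite lt_min e0 powR_gt0.
have S0 : 0 <= content L0 by apply: sumr_ge0 => g _; exact: powR_ge0.
have [m th_m] : exists m, theta ^+ m * content L0 <= e'.
  have S1 : 0 < content L0 + 1 by rewrite ltr_wpDl.
  have th1' : `|theta| < 1 by rewrite ger0_norm.
  have := cvg_expr th1' => /cvgrPdist_le/(_ (e' / (content L0 + 1)) (divr_gt0 e'0 S1)).
  case=> m _ /(_ m (leqnn m)) /=; rewrite sub0r normrN ger0_norm ?exprn_ge0// => h.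
  exists m; move: h; rewrite ler_pdivlMr// => h; apply: le_trans h.
  by rewrite ler_wpM2l ?exprn_ge0// lerDl.
have [L [Lgood Lc Lcov]] := iterated m.
have Le' : content L <= e' by exact: le_trans th_m.
exists L; split => //; last by apply: le_trans Le' _; rewrite ge_min lexx.
move=> G r GL; have [Gr r0 _] := Lgood G r GL; split => //.
rewrite leNgt; apply/negP => dr.
have : d `^ s < r `^ s by apply: gt0_ltr_powR; rewrite ?nnegrE ?(ltW r0) ?(ltW d0).
apply/negP; rewrite -leNgt; apply: (@le_trans _ _ (content L)).
  rewrite /content (big_rem _ GL) /= lerDl; apply: sumr_ge0 => g _; exact: powR_ge0.
by apply: le_trans Le' _; rewrite ge_min lexx orbT.
Qed.

End Covers.

(** * The Douady-Oesterle refinement *)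

Section DouadyOesterle.
Context {R : realType} {n : nat}.
Implicit Types (K : set 'rV[R]_n) (F : 'rV[R]_n -> 'rV[R]_n).

Let N1 : R := Num.sqrt n%:R + 1.
Let N1_gt0 : 0 < N1. Proof. by rewrite ltr_wpDl ?sqrtr_ge0. Qed.

Lemma coordB (x y : 'rV[R]_n) i : (x - y) 0 i = x 0 i - y 0 i.
Proof. by rewrite !mxE. Qed.

(** The factor [3 ^+ n] accounts for rounding the numbers of slices up, and [N1]
    for passing from coordinates to the norm and for the nonlinearity of the map. *)
Definition refine_const (s : R) : R := 3 ^+ n * N1 `^ s.

Lemma refine_const_ge1 s : 0 <= s -> 1 <= refine_const s.
Proof.
move=> s0; rewrite -[1]mulr1 ler_pM//; first by rewrite exprn_ege1// ler1n.
by rewrite -(powRr0 N1) ler_powR// lerDr sqrtr_ge0.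
Qed.

(** Cut a piece of diameter [r] along the singular directions into slices of
    width [r * min 1 (s_k / s_i)]: about [prod_(i < k) s_i / s_k] boxes, each
    mapped to a set of diameter of order [s_k * r]. *)
Lemma sdiff_refines K F (D : 'rV[R]_n -> 'M[R]_n) (s theta c : R) (k : nat) :
  unif_sdiff K F D -> 0 < s -> (k < n)%N -> 0 < c -> 0 <= theta ->
  (forall p, K p -> c <= (singular_values (D p)^T)`_k) ->
  (forall p, K p -> refine_const s *
     (sv_prod k (D p)^T * (singular_values (D p)^T)`_k `^ (s - k%:R)) <= theta) ->
  exists2 del, 0 < del & refines F K s theta del.
Proof.
move=> FD s0 kn c0 th0 sv_c th; have [del del0 Fd] := FD c c0.
exists del => // G r GK r0 rdel Gr.
have [G0|/set0P[p Gp]] := eqVneq G set0.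
  exists [::], r; split => //; first by move=> y [x]; rewrite G0.
  by rewrite mul0r mulr_ge0 ?powR_ge0.
have Kp := GK p Gp.
pose A := (D p)^T; pose sv i := (singular_values A)`_i.
have [P [PP PtP AE]] := sv_enorm A; rewrite trmxK in AE.
have sk0 : 0 < sv k by apply: lt_le_trans c0 (sv_c p Kp).
pose w (i : 'I_n) := if (i < k)%N then r * (sv k / sv i) else r.
have sv_le i : (i < k)%N -> 0 < sv i /\ sv k / sv i <= 1.
  move=> ik; have ki : sv k <= sv i by apply: sv_nonincreasing; exact: ltnW.
  have si : 0 < sv i by exact: lt_le_trans ki.
  by rewrite ler_pdivrMr// mul1r.
have w_in i : 0 < w i <= r.
  rewrite /w; case: ifP => [/sv_le[si q1]|_]; last by rewrite r0 lexx.
  by rewrite mulr_gt0 ?divr_gt0//= ler_piMr// ltW.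
have lip (i : 'I_n) (x y : 'rV[R]_n) :
    `|(x *m P^T) 0 i - (y *m P^T) 0 i| <= enorm (x - y).
  rewrite -(@enorm_orth _ _ P^T) ?trmxK// mulmxBl.
  by rewrite -coordB coord_le_enorm.
have [L [Lsize Lcov LG]] := split_slices (index_enum 'I_n) r0 Gr w_in lip.
exists [seq F @` H | H <- L], (N1 * sv k * r); split.
- by rewrite !mulr_gt0.
- move=> _ [x Gx <-]; have [H HL Hx] := Lcov x Gx.
  by exists (F @` H); [apply/mapP; exists H|exists x].
- move=> _ /mapP[H HL ->] _ _ [x Hx <-] [y Hy <-]; have [HG Hw] := LG H HL.
  have small z : G z -> enorm (z - p) < del.
    by move=> Gz; apply: le_lt_trans rdel; exact: Gr.
  have Gx := HG x Hx; have Gy := HG y Hy.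
  rewrite -[F x - F y](subrK ((x - y) *m D p)).
  apply: le_trans (enormD _ _) _.
  rewrite addrC /N1 mulrDl mul1r mulrDl lerD//; last first.
    apply: le_trans (Fd p x y Kp (small x Gx) (small y Gy)) _.
    by apply: ler_pM; rewrite ?enorm_ge0 ?(ltW c0) ?Gr//; exact: sv_c.
  have b0 : 0 <= Num.sqrt n%:R * sv k * r.
    by rewrite mulr_ge0 ?(ltW r0)// mulr_ge0 ?sqrtr_ge0// ltW.
  rewrite -(@ler_pXn2r _ 2) ?nnegrE ?enorm_ge0// AE.
  rewrite -mulrA exprMn sqr_sqrtr// mulr_natl -[X in _ *+ X]card_ord -sumr_const.
  apply: ler_sum => i _; rewrite -exprMn.
  rewrite -[leLHS]real_normK ?num_real// ler_pXn2r ?nnegrE ?normr_ge0//; last first.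
    by rewrite mulr_ge0// ltW.
  rewrite normrM ger0_norm ?sv_ge0//.
  have := Hw i x y (mem_index_enum i) Hx Hy; rewrite /w.
  have -> : (x *m P^T) 0 i - (y *m P^T) 0 i = ((x - y) *m P^T) 0 i.
    by rewrite mulmxBl coordB.
  move=> wi; apply: (le_trans (ler_wpM2l (sv_ge0 A i) wi)); rewrite -/(sv i).
  case: ifP => [/sv_le[si _]|/negbT].
    have -> : sv i * (r * (sv k / sv i)) = sv k * r by field; rewrite gt_eqF.
    by [].
  by rewrite -leqNgt => ki; rewrite ler_wpM2r ?(ltW r0)// sv_nonincreasing.
- rewrite size_map.
  have sizeE : \prod_(i <- index_enum 'I_n) (3 * r / w i) =
      3 ^+ n * (sv_prod k A / sv k ^+ k).
    rewrite (eq_bigr (fun i => 3 * (r / w i))); last by move=> i _; rewrite mulrA.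
    rewrite big_split /= prodr_const card_ord; congr (_ * _).
    rewrite (bigID (fun i : 'I_n => (i < k)%N)) /= [X in _ * X]big1 ?mulr1; last first.
      by move=> i /negbTE ik; rewrite /w ik divff// gt_eqF.
    rewrite (eq_bigr (fun i : 'I_n => sv i / sv k)); last first.
      move=> i ik; rewrite /w ik; have [si _] := sv_le i ik.
      by field; rewrite !gt_eqF.
    rewrite (big_ord_narrow (ltnW kn)) /= big_split /= prodr_const card_ord.
    by rewrite exprVn.
  rewrite sizeE in Lsize.
  apply: le_trans (ler_wpM2r (powR_ge0 _ _) Lsize) _.
  have -> : (N1 * sv k * r) `^ s = N1 `^ s * sv k `^ s * r `^ s.
    by rewrite !powRM ?mulr_ge0 ?(ltW N1_gt0) ?(ltW sk0) ?(ltW r0).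
  have -> : sv k `^ s = sv k ^+ k * sv k `^ (s - k%:R).
    rewrite -powR_mulrn ?(ltW sk0)// -powRD ?(gt_eqF sk0) ?implybT//.
    by congr (_ `^ _); rewrite addrC subrK.
  have skk : sv k ^+ k != 0 by rewrite expf_neq0// gt_eqF.
  have -> : 3 ^+ n * (sv_prod k A / sv k ^+ k) *
      (N1 `^ s * (sv k ^+ k * sv k `^ (s - k%:R)) * r `^ s) =
      refine_const s * (sv_prod k A * sv k `^ (s - k%:R)) * r `^ s.
    by rewrite /refine_const; field.
  by rewrite ler_wpM2r ?powR_ge0// th.
Qed.

(** For [s] above the dimension of the space, slicing into [q ^+ n] cubes of
    relative size [q^-1] reduces the content when [q] is large. *)
Lemma id_refines K (s : R) : n%:R < s -> refines id K s (1 / 2) 1.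
Proof.
move=> ns G r GK r0 _ Gr.
have s0 : 0 < s by apply: le_lt_trans ns.
have C1 := refine_const_ge1 (ltW s0); have C0 := lt_le_trans ltr01 C1.
(* this [q] solves [refine_const s * q `^ (n%:R - s) = 1 / 2] *)
pose q : R := (2 * refine_const s) `^ (s - n%:R)^-1.
have sn : 0 < s - n%:R by rewrite subr_gt0.
have C2 : 0 < 2 * refine_const s by rewrite mulr_gt0.
have q0 : 0 < q by rewrite powR_gt0.
have q1 : 1 <= q.
  have C21 : 1 <= 2 * refine_const s by rewrite mulr_ege1// ler1n.
  have sni : 0 <= (s - n%:R)^-1 by rewrite invr_ge0 ltW.
  by have := ler_powR C21 sni; rewrite powRr0.
have qs : q `^ (s - n%:R) = 2 * refine_const s.
  by rewrite -powRrM mulVf ?gt_eqF// powRr1// ltW.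
have w_in (i : 'I_n) : 0 < r / q <= r.
  by rewrite divr_gt0//= ler_pdivrMr// ler_peMr// ltW.
have lip (i : 'I_n) (x y : 'rV[R]_n) : `|x 0 i - y 0 i| <= enorm (x - y).
  by have := coord_le_enorm (x - y) i; rewrite !mxE.
have [L [Lsize Lcov LG]] := split_slices (index_enum 'I_n) r0 Gr w_in lip.
exists L, (N1 * (r / q)); split.
- by rewrite mulr_gt0// divr_gt0.
- by move=> _ [x Gx <-]; exact: Lcov.
- move=> H HL x y Hx Hy; have [HG Hw] := LG H HL.
  have rq : 0 <= r / q by rewrite ltW// divr_gt0.
  apply: le_trans (_ : Num.sqrt n%:R * (r / q) <= _).
    apply: enorm_le_coord => // i.
    by have := Hw i x y (mem_index_enum i) Hx Hy; rewrite !mxE.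
  by rewrite ler_wpM2r// lerDl.
rewrite prodr_const card_ord in Lsize.
apply: le_trans (ler_wpM2r (powR_ge0 _ _) Lsize) _.
have -> : 3 * r / (r / q) = 3 * q by field; rewrite !gt_eqF.
have qV : 0 <= q^-1 by rewrite invr_ge0 ltW.
rewrite !powRM ?(ltW N1_gt0) ?(ltW r0)//; last by rewrite mulr_ge0 ?(ltW r0).
have qns : q `^ s = q ^+ n * q `^ (s - n%:R).
  rewrite -powR_mulrn ?(ltW q0)// -powRD ?(gt_eqF q0) ?implybT//.
  by congr (_ `^ _); rewrite addrC subrK.
have q_s_neq0 : q `^ s != 0 by rewrite gt_eqF// powR_gt0.
have -> : q^-1 `^ s = (q ^+ n * q `^ (s - n%:R))^-1.
  rewrite -qns; apply: (mulIf q_s_neq0).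
  rewrite (mulVf q_s_neq0) -(powRM _ qV (ltW q0)).
  by rewrite mulVf ?gt_eqF// powR1.
rewrite qs exprMn le_eqVlt; apply/orP; left; apply/eqP.
have N1s : 0 < N1 `^ s by rewrite powR_gt0.
rewrite /refine_const; field.
by rewrite !expf_neq0 ?gt_eqF// ?powR_gt0.
Qed.

(** An invertible matrix expands all vectors by at least some factor, and nearby
    matrices by at least half of it. *)
Lemma sv_lower_bound K (D : 'rV[R]_n -> 'M[R]_n) : compact K ->
  (forall e : R, 0 < e -> exists2 del : R, 0 < del &
    forall p q, K p -> K q -> enorm (p - q) < del -> op_le (D p - D q) e) ->
  (forall p, K p -> sv_positive (D p)^T) ->
  exists2 c : R, 0 < c & forall p (i : 'I_n), K p -> c <= (singular_values (D p)^T)`_i.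
Proof.
move=> cK Dcont Dpos.
have [c c0 cs] : exists2 c : R, 0 < c & forall p, K p ->
    forall i : 'I_n, c^-1 <= (singular_values (D p)^T)`_i.
  apply: compact_uniform_bound => // [c c' p c0 cc' cs i|p Kp].
    by apply: le_trans (cs i); rewrite lef_pV2 ?posrE// (lt_le_trans c0).
  have Du : D p \in unitmx by rewrite -unitmx_tr; apply: sv_positive_unit; exact: Dpos.
  have [C C0 invC] := op_le_ex (invmx (D p)).
  have Ci : 0 < C^-1 by rewrite invr_gt0.
  have low x : C^-1 * enorm x <= enorm (x *m D p).
    by rewrite mulrC ler_pdivrMr// mulrC -{1}[x](mulmxK Du) invC.
  have [del del0 Dd] := Dcont (C^-1 / 2) (divr_gt0 Ci (ltr0n R 2)).
  exists (2 * C), del => [|q Kq qp i]; first by rewrite mulr_gt0.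
  apply: sv_ge => x; rewrite trmxK.
  have h1 := Dd q p Kq Kp qp x; have h2 := low x.
  have := enormB (x *m D q) (x *m (D q - D p)).
  rewrite {1}mulmxBr opprB addrC subrK invfM mulrC => h3.
  have : enorm (x *m D p) <= enorm (x *m D q) + C^-1 / 2 * enorm x.
    by apply: le_trans h3 _; rewrite lerD2l.
  have := enorm_ge0 x; nra.
by exists c^-1 => [|p i Kp]; [rewrite invr_gt0|exact: cs].
Qed.

End DouadyOesterle.

(** * The Lyapunov dimension bound and its equivalent forms *)

Section LyapunovDimension.
Context {R : realType} {n : nat}.
Variables (tau : time_kind) (K : set 'rV[R]_n) (phi : R -> 'rV[R]_n -> 'rV[R]_n).
Hypotheses (K_ne : K !=set0) (K_compact : compact K)
  (phi_cc : smooth_cocycle tau K phi)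
  (K_invariant : forall t : R, times tau t -> phi t @` K = K)
  (D_pos : forall t u, times tau t -> K u -> sv_positive (Dmx (phi t) u)).

Local Notation l := (lnomega phi).

Lemma lnomega0 t u : l 0 t u = 0.
Proof. by rewrite lnomegaE omega0 ln1. Qed.

Lemma lnomega_concave d d' t u : times tau t -> K u -> 0 < d -> d <= d' ->
  d' <= n%:R -> l d' t u <= d' / d * l d t u.
Proof.
move=> Tt Ku d0 dd' d'n; rewrite (lnomegaE phi d') (lnomegaE phi d).
exact: ln_omega_concave (D_pos Tt Ku) d0 dd' d'n.
Qed.

Let l_uniform := lnomega_uniform K_compact phi_cc D_pos.

Lemma dL_atE t u : times tau t -> K u -> dL_at (phi t) u = dim_at (n := n) l t u.
Proof.
move=> Tt Ku; congr sup; apply/seteqP; split => d [dn h]; split => //.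
  by rewrite lnomegaE; exact: ln_ge0.
have w0 := omega_gt0 (D_pos Tt Ku) dn.
move: h; rewrite lnomegaE; move: (omega _ _) w0 => w w0 h.
by rewrite leNgt; apply/negP => w1; have := ln_lt0 (x := w); rewrite w0 w1 ltNge h => /(_ isT).
Qed.

Lemma dL_onE t : times tau t -> dL_on (phi t) K = dim_on (n := n) K l t.
Proof.
move=> Tt; congr sup; apply: eq_imagel => u Ku; exact: dL_atE.
Qed.

Lemma dLE : dL tau phi K = dim_inf (n := n) tau K l.
Proof.
congr inf; apply: eq_imagel => t [Tt _]; exact: dL_onE.
Qed.

Let growthE : growth phi = rate l.
Proof.
apply/funext => d; apply/funext => t; apply/funext => u.
by rewrite /rate lnomegaE.
Qed.

Lemma dLE_onE : dLE_on tau phi K = @inf_or_n R n (decay_on (n := n) tau K l).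
Proof. by rewrite /dLE_on /decay_on /max_rate growthE. Qed.

Lemma dLE_atE u : dLE_at tau phi u = @inf_or_n R n (decay_at (n := n) tau l u).
Proof. by rewrite /dLE_at /decay_at growthE. Qed.

Theorem dL_eq_dLE_on : dL tau phi K = dLE_on tau phi K.
Proof.
rewrite dLE dLE_onE; exact: dim_inf_decay K_ne lnomega0 lnomega_concave l_uniform.
Qed.

Theorem dLE_on_eq_sup : dLE_on tau phi K = sup [set dLE_at tau phi u | u in K].
Proof.
rewrite dLE_onE (decay_on_sup K_ne lnomega0 lnomega_concave l_uniform).
by congr sup; apply: eq_imagel => u _; rewrite dLE_atE.
Qed.

Theorem dL_le_dL_on t : times tau t -> 0 < t -> dL tau phi K <= dL_on (phi t) K.
Proof.
by move=> Tt t0; rewrite dLE dL_onE//; apply: dim_inf_le => //; exact: lnomega0.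
Qed.

(** Above the Lyapunov dimension the singular value function contracts
    exponentially, so for a large time it beats the constant lost in one
    refinement step. *)
Lemma hausdorff_measure_eq0_above (s : R) : dL tau phi K < s ->
  hausdorff_measure s K = 0%E.
Proof.
move=> Ls.
have dL0 : 0 <= dL tau phi K by rewrite dLE; exact: dim_inf_ge0 K_ne lnomega0.
have s0 : 0 < s by exact: le_lt_trans Ls.
have half1 : 1 / 2 < 1 :> R by lra.
have half0 : 0 <= 1 / 2 :> R by lra.
have [sn|ns] := leP s n%:R; last first.
  apply: (refines_measure0 K_compact s0 half0 half1 ltr01 _ (id_refines ns)).
  by move=> x Kx; exists x.
have sn' : 0 <= s <= n%:R by rewrite ltW.
rewrite dLE in Ls.
have sc := dim_inf_lt K_ne lnomega0 Ls sn.
have [c [B [c0 lB]]] := contracting_uniform l_uniform sn' sc.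
have C1 := refine_const_ge1 (n := n) (ltW s0).
pose C := 2 * refine_const (n := n) s.
have C0 : 0 < C by rewrite mulr_gt0// (lt_le_trans ltr01).
(* beyond this time [c * t + B <= - ln C] *)
have [t Tt tB] := times_gt tau ((B + ln C) / - c).
have [k [ks sk omE]] := @omega_ceil R n s s0.
have kn : (k < n)%N by rewrite -(ltr_nat R); exact: lt_le_trans sn.
have om_le p : K p -> omega s (Dmx (phi t) p) <= C^-1.
  move=> Kp; have w0 := omega_gt0 (D_pos Tt Kp) sn'.
  have := lB t p Tt Kp; rewrite lnomegaE; move: (omega _ _) w0 => w w0 h.
  rewrite -ler_ln ?posrE ?invr_gt0// lnV ?posrE//; apply: le_trans h _.
  move: tB; rewrite ltr_pdivrMr ?oppr_gt0// mulrN; lra.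
have sd := cocycle_sdiff phi_cc Tt.
have pos p : K p -> sv_positive ('J (phi t) p)^T by exact: D_pos.
have [b b0 bs] := sv_lower_bound K_compact (unif_sdiff_continuous sd) pos.
have [||del del0 ref] := sdiff_refines (theta := 1 / 2) sd s0 kn b0 half0.
- by move=> p Kp; exact: (bs p (Ordinal kn) Kp).
- move=> p Kp; rewrite -omE.
  apply: (@le_trans _ _ (refine_const (n := n) s * C^-1)).
    by rewrite ler_wpM2l ?(le_trans ler01)//; exact: om_le.
  by rewrite /C invfM mulrCA mulfV ?gt_eqF ?(lt_le_trans ltr01)// mulr1 div1r.
by apply: (refines_measure0 K_compact s0 half0 half1 del0 _ ref); rewrite K_invariant.
Qed.

Theorem hausdorff_dim_le_dL : (hausdorff_dim K <= (dL tau phi K)%:E)%E.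
Proof.
apply/lee_addgt0Pr => e e0; apply: ereal_inf_lbound.
exists (dL tau phi K + e) => //; split.
  by rewrite addr_ge0 ?(ltW e0)// dLE; exact: dim_inf_ge0 K_ne lnomega0.
by apply: hausdorff_measure_eq0_above; rewrite ltrDl.
Qed.

End LyapunovDimension.

Theorem theorem3 (R : realType) (n : nat) (tau : time_kind)
    (U K : set 'rV[R]_n) (phi : R -> 'rV[R]_n -> 'rV[R]_n)
    (U_open : open U)
    (phi_ds : smooth_dynamical_system tau U phi)
    (K_nonempty : K !=set0) (K_compact : compact K) (K_sub_U : K `<=` U)
    (K_invariant : forall t : R, times tau t -> phi t @` K = K)
    (sv_pos : forall (t : R) (u : 'rV[R]_n), times tau t -> U u ->
       forall s : R, s \in singular_values (Dmx (phi t) u) -> 0 < s) :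
  forall t : R, times tau t -> 0 < t ->
    [/\ (hausdorff_dim K <= (dL tau phi K)%:E)%E,
        dL tau phi K = dLE_on tau phi K,
        dLE_on tau phi K = sup [set dLE_at tau phi u | u in K],
        sup [set dLE_at tau phi u | u in K] <= dL_on (phi t) K
      & dL_on (phi t) K = sup [set dL_at (phi t) u | u in K]].
Proof.
move=> t Tt t0.
have K_inv s u : times tau s -> K u -> K (phi s u).
  by move=> Ts Ku; rewrite -(K_invariant s Ts); exists u.
have cc := smooth_system_cocycle U_open phi_ds K_compact K_sub_U K_inv.
have D_pos s u : times tau s -> K u -> sv_positive (Dmx (phi s) u).
  by move=> Ts Ku; exact: sv_pos Ts (K_sub_U u Ku).
have E1 := dL_eq_dLE_on K_nonempty K_compact cc D_pos.
have E2 := dLE_on_eq_sup K_nonempty K_compact cc D_pos.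
split => //.
- exact: hausdorff_dim_le_dL.
- by rewrite -E2 -E1; exact: dL_le_dL_on.
Qed.
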